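(* Let $\mathcal X,\mathcal Y$ be Hilbert spaces and let $F:\mathcal D(F)\subset\mathcal X\to\mathcal Y$ be Fréchet differentiable, with $x^\dagger\in\mathcal D(F)$ and $F(x^\dagger)=y$. Let $\rho>0$ and $B_\rho(x^\dagger)=\{x\in\mathcal X:\|x-x^\dagger\|\le\rho\}\subset\mathcal D(F)$. Assume: (i) there is $K_0\ge 0$ such that $\|[F'(x)-F'(z)]h\|\le K_0\|x-z\|\,\|F'(z)h\|$ for all $h\in\mathcal X$ and all $x,z\in B_\rho(x^\dagger)$; (ii) there is $\Theta<1$ such that $\|F'(x)\|\le\Theta<1$ for all $x\in B_\rho(x^\dagger)$. Let $\tau>2$ and $0<\eta<1$ be such that $\tau\eta>2$. Fix one of the four inexact Newton regularization methods described in the context (inner scheme: Landweber iteration, the implicit iteration, the asymptotic regularization, or Tikhonov regularization). (1) There is $\varepsilon>0$, depending only on $\tau,\eta,\Theta$, such that if $x_0\in B_\rho(x^\dagger)$ and $K_0\|x_0-x^\dagger\|\le\varepsilon$, then for every $\delta>0$ and every $y^\delta\in\mathcal Y$ with $\|y^\delta-y\|\le\delta$ the method started at $x_0$ is well-defined and terminates after $n_\delta=O(1+|\log\delta|)$ iterations, i.e. $n_\delta\le C'(1+|\log\delta|)$ with $C'$ independent of $\delta$ and $y^\delta$. (2) Let in addition $0<\mu\le 1/2$. There are $\varepsilon'>0$, depending only on $\tau,\eta,\Theta,\mu$, and a constant $C>0$, independent of $\delta$, $y^\delta$, $x_0$ and $\omega$ (in particular of $\|\omega\|$), such that if $x_0\in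 B_\rho(x^\dagger)$ satisfies $K_0\|x_0-x^\dagger\|\le\varepsilon$, if $$x_0-x^\dagger=(F'(x^\dagger)^*F'(x^\dagger))^\mu\omega\quad\text{for some }\omega\in\mathcal N(F'(x^\dagger))^\perp\subset\mathcal X,$$ and if $K_0\|\omega\|\le\varepsilon'$, then for every $\delta>0$ and every $y^\delta\in\mathcal Y$ with $\|y^\delta-y\|\le\delta$, $$\|x_{n_\delta}-x^\dagger\|\le C\,\|\omega\|^{\frac{1}{1+2\mu}}\,\delta^{\frac{2\mu}{1+2\mu}}.$$
   Context: $F'(x)$ is the Fréchet derivative of $F$ at $x$, $F'(x)^*$ its Hilbert space adjoint, and $\mathcal N(\cdot)$ denotes the null space. The methods. For $t>0$ and $\lambda\ge 0$ let $g_t(\lambda)$ be one of the following four functions, where $[t]$ is the largest integer not greater than $t$ and empty sums are $0$: - Landweber iteration: $g_t(\lambda)=\sum_{j=0}^{[t]-1}(1-\lambda)^j$; - implicit iteration: $g_t(\lambda)=\sum_{j=1}^{[t]}(1+\lambda)^{-j}$; - asymptotic regularization: $g_t(\lambda)=\frac1\lambda(1-e^{-t\lambda})$ (with value $t$ at $\lambda=0$); - Tikhonov regularization: $g_t(\lambda)=\left(\frac1t+\lambda\right)^{-1}$. Given $x_0$, $\delta>0$, data $y^\delta$, and parameters $\tau>1$, $0<\eta<1$, the method is as follows. Given a current iterate $x_n$, put $$u_n(t)=g_t\big(F'(x_n)^*F'(x_n)\big)F'(x_n)^*\big(y^\delta-F(x_n)\big),$$ defined by functional calculus. Let $t_n$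 be the smallest number $t_n>0$ such that $$\|y^\delta-F(x_n)-F'(x_n)u_n(t_n)\|\le\eta\|y^\delta-F(x_n)\|,$$ and set $x_{n+1}=x_n+u_n(t_n)$. The iteration is terminated by the discrepancy principle: $n_\delta$ is the integer $n_\delta\ge0$ with $$\|y^\delta-F(x_{n_\delta})\|\le\tau\delta<\|y^\delta-F(x_n)\|,\qquad 0\le n<n_\delta .$$ The output is $x_{n_\delta}$. ''Well-defined'' means that $x_n\in\mathcal D(F)$ for $0\le n\le n_\delta$ and that $t_n$ exists for every $0\le n<n_\delta$; ''terminates after $n_\delta$ iterations'' means that a finite such $n_\delta$ exists. *)

(* Defs.v *)
From HB Require Import structures.
From mathcomp Require Import all_boot all_order all_algebra.
From mathcomp Require Import sesquilinear.
From mathcomp Require Import all_classical all_reals all_analysis.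

Set Implicit Arguments.
Unset Strict Implicit.
Unset Printing Implicit Defensive.

Import Order.TTheory GRing.Theory Num.Theory.
Import numFieldNormedType.Exports.

Local Open Scope classical_set_scope.
Local Open Scope ring_scope.

(* Real Hilbert spaces.  A complex Hilbert space is a real one for the real
   part of its inner product, with the same norm, bounded adjoints, orthogonal
   complements of complex subspaces and functional calculus of positive
   operators. *)
HB.mixin Record CompleteNormedModule_isHilbert (R : realType) V
    of CompleteNormedModule R V := {
  inner : {dot V for (@idfun R)} ;
  sqr_norm_inner : forall x : V, `|x| ^+ 2 = inner x x }.

#[short(type="hilbertType")]
HB.structure Definition Hilbert (R : realType) :=
  {V of CompleteNormedModule_isHilbert R V & CompleteNormedModule R V}.

Section Operators.
Context {R : realType}.

Definition opnorm (X Y : hilbertType R) (T : X -> Y) : R :=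
  sup [set `|T h| | h in [set h : X | `|h| <= 1]].

(* By the Riesz theorem the set below is a singleton when [T] is linear and
   continuous. *)
Definition adjoint (X Y : hilbertType R) (T : X -> Y) (y : Y) : X :=
  get [set z : X | forall x : X, inner (T x) y = inner x z].

Definition null_space (X Y : hilbertType R) (T : X -> Y) : set X :=
  [set x | T x = 0].

Definition orthocomplement (X : hilbertType R) (A : set X) : set X :=
  [set w | forall z, A z -> inner w z = 0].

Definition bounded_inverse (X : hilbertType R) (A S : X -> X) : Prop :=
  [/\ cancel A S, cancel S A & exists c : R, forall x, `|S x| <= c * `|x|].

(* Real spectrum; the whole spectrum when [A] is self-adjoint. *)
Definition spectrum (X : hilbertType R) (A : X -> X) : set R :=
  [set l | ~ exists S, bounded_inverse (fun x => A x - l *: x) S].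

Definition op_horner (X : hilbertType R) (p : {poly R}) (A : X -> X) (x : X)
  : X := \sum_(i < size p) p`_i *: iter i A x.

(* Continuous functional calculus of a bounded self-adjoint operator [A]:
   [B = f(A)] iff [B] is the limit in operator norm of polynomials [p(A)] with
   [p -> f] uniformly on the spectrum of [A].  The bound on [p(A) - B] is not
   stated with [opnorm], whose value is meaningless on an unbounded map. *)
Definition is_fun_calculus (X : hilbertType R) (A : X -> X) (f : R -> R)
    (B : X -> X) : Prop :=
  forall e : R, 0 < e -> exists p : {poly R},
    (forall l, spectrum A l -> `|p.[l] - f l| <= e) /\
    (forall x, `|op_horner p A x - B x| <= e * `|x|).

Definition fun_calculus (X : hilbertType R) (A : X -> X) (f : R -> R)
  : X -> X := get [set B : X -> X | is_fun_calculus A f B].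

(* Fréchet derivative of [F : D -> Y] at [x], relative to the domain [D]; at an
   interior point of [D] this is the usual one. *)
Definition is_frechet (X Y : hilbertType R) (D : set X) (F : X -> Y) (x : X)
    (T : {linear X -> Y}) : Prop :=
  continuous T /\
  forall e : R, 0 < e ->
    \forall z \near within D (nbhs x),
      `|F z - F x - T (z - x)| <= e * `|z - x|.

End Operators.

Variant inner_scheme := Landweber | Implicit | Asymptotic | Tikhonov.

(* [Num.truncn t] is the integer part of [t] since [t] is nonnegative. *)
Definition scheme_fun (R : realType) (m : inner_scheme) (t l : R) : R :=
  match m with
  | Landweber => \sum_(0 <= j < Num.truncn t) (1 - l) ^+ j
  | Implicit => \sum_(1 <= j < (Num.truncn t).+1) (1 + l) ^- j
  | Asymptotic => if l == 0 then t else l^-1 * (1 - expR (- (t * l)))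
  | Tikhonov => (t^-1 + l)^-1
  end.

Section Method.
Context {R : realType} {X Y : hilbertType R}.
Variables (m : inner_scheme) (tau eta : R).
Variables (D : set X) (F : X -> Y) (F' : X -> {linear X -> Y}).
Variables (x0 : X) (delta : R) (yd : Y).

Definition inner_update (x : X) (t : R) : X :=
  fun_calculus (adjoint (F' x) \o F' x) (scheme_fun m t)
    (adjoint (F' x) (yd - F x)).

Definition inner_admissible (x : X) : set R :=
  [set t | 0 < t /\
     `|yd - F x - F' x (inner_update x t)| <= eta * `|yd - F x|].

Definition is_inner_stop (x : X) (t : R) : Prop :=
  inner_admissible x t /\ forall s, inner_admissible x s -> t <= s.

Definition inner_stop (x : X) : R := get [set t | is_inner_stop x t].

Definition newton_iterate (n : nat) : X :=
  iter n (fun x => x + inner_update x (inner_stop x)) x0.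

Definition discrepancy_stop (n : nat) : Prop :=
  `|yd - F (newton_iterate n)| <= tau * delta /\
  forall k, (k < n)%N -> tau * delta < `|yd - F (newton_iterate k)|.

(* [newton_iterate] is total: it is the iteration of the method only as long as
   the iterates stay in [D] and the smallest admissible [t] exists. *)
Definition newton_well_defined (n : nat) : Prop :=
  (forall k, (k <= n)%N -> D (newton_iterate k)) /\
  (forall k, (k < n)%N -> exists t, is_inner_stop (newton_iterate k) t).

End Method.

Definition ball_le (R : realType) (X : hilbertType R) (c : X) (r : R) : set X :=
  [set x | `|x - c| <= r].

Record newton_setting (R : realType) (X Y : hilbertType R) (Theta : R)
    (D : set X) (F : X -> Y) (F' : X -> {linear X -> Y}) (xd : X) (y : Y)
    (rho K0 : R) : Prop := {
  setting_frechet : forall x, D x -> is_frechet D F x (F' x) ;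
  setting_xd : D xd ;
  setting_Fxd : F xd = y ;
  setting_rho : 0 < rho ;
  setting_ball : ball_le xd rho `<=` D ;
  setting_K0 : 0 <= K0 ;
  setting_lipschitz : forall x z, ball_le xd rho x -> ball_le xd rho z ->
    forall h, `|F' x h - F' z h| <= K0 * `|x - z| * `|F' z h| ;
  setting_Theta : Theta < 1 ;
  setting_opnorm : forall x, ball_le xd rho x -> opnorm (F' x) <= Theta }.

(* Main.v *)
Require Import Defs.
From mathcomp Require Import all_boot all_order all_algebra.
From mathcomp Require Import sesquilinear ring lra.
From mathcomp Require Import all_classical all_reals all_analysis.
From mathcomp Require complex.
Set Implicit Arguments.
Unset Strict Implicit.
Import Order.TTheory GRing.Theory Num.Theory.
Import numFieldNormedType.Exports.
Local Open Scope classical_set_scope.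
Local Open Scope ring_scope.

(** Write [e_n = x_n - x^+] for the error of the [n]-th iterate, [b_n] for the
    residual [y^d - F (x_n)], [nu] for the noise [y^d - y], [T] for the
    derivative at the solution [x^+] and [T_n] for that at [x_n].

    Every inner scheme is built from steps of one kind: Landweber iteration
    consists of explicit Euler steps of length 1 for [u' = T_n^* (b_n - T_n u)],
    the implicit iteration of implicit steps of length 1, Tikhonov
    regularization is a single implicit step of length [t], and asymptotic
    regularization is the limit of [k] implicit steps of length [t / k].  All
    estimates are energy estimates for one step; they pass to the limit.  The
    functional calculus only has to translate between filter functions and
    steps, and to provide the powers of [T^* T].  It is constructed from the
    bound of the norm of [q(A)] by the supremum of [|q|] over the spectrum
    (op_horner_norm_le) and from polynomial approximation (quad_cont_bernstein).

    Well-posedness and termination.  The condition on [F'] gives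
    [|b_n + T_n e_n| <= theta |b_n|] with [2 theta < eta], as long as
    [|b_n| > tau delta] (newton_approx).  Hence an inner step decreases the
    error while the inner residual exceeds [eta |b_n|], and
    [|e_(n+1)|^2 + c t_n |b_n|^2 <= |e_n|^2] (scheme_stop).  This bounds the
    inner times that are not admissible, keeps the iterates in the ball, and
    with the linearization error yields [|b_(n+1)| <= q |b_n|] with [q < 1]
    (newton_step), whence logarithmically many outer steps (active_count).

    Rate.  The inner iteration for [T_n] and [b_n] is one for the fixed operator
    [T] and the data [nu], with a perturbation of size [7 K0 |e_n| |b_n|]
    (residual_transfer).  So all inner steps together form one linear iteration,
    whose error splits as [e_n = A^mu p_n + N_n] with [A = T^* T]
    (error_decomposition): [N_n] is started at 0 and driven by [nu] alone, so
    that [|T N_n - nu| <= delta] and [|N_n|^2 <= s_n delta^2], where [s_n] is the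
    elapsed inner time; [p_n] is driven by the perturbations alone.  Because
    [mu <= 1/2], the vector [T^* f] is [A^mu] applied to [A^(1/2 - mu) f'], and
    the dissipation in the energy estimate for [p_n] absorbs the perturbation up
    to [|p_(n+1)|^alpha <= |p_n|^alpha + 6 t_n (7 K0 |e_n| |b_n|)^alpha] with
    [alpha = 2 / (1 + 2 mu)] (implicit_source_step, explicit_source_step).

    These estimates close.  Interpolation bounds [|A^mu p|^2] by
    [2 |p|^alpha |T A^mu p|^(2 - alpha)]; with the energy estimate, the
    geometric decay of [|b_n|] and [delta < |b_n|], it first gives
    [s_(n+1) |b_n|^alpha <= G |omega|^alpha], then geometric decay of [|e_n|],
    and finally [|p_n|^alpha <= 2 |omega|^alpha] if [K0 |omega| ] is small
    (rate_recursion).  At the stopping index [|T e_n|] is of order [delta], and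
    the same interpolation is the asserted rate (newton_rate). *)

(** * Inner products *)

Section InnerProduct.
Context {R : realType} {X : hilbertType R}.
Implicit Types (x y z : X) (a : R).

Lemma innerC x y : inner x y = inner y x.
Proof. by rewrite hermC /= expr0 mul1r. Qed.

Lemma innerDl x y z : inner (x + y) z = inner x z + inner y z.
Proof. by rewrite linearDl. Qed.

Lemma innerDr x y z : inner x (y + z) = inner x y + inner x z.
Proof. by rewrite linearD. Qed.

Lemma innerZl a x y : inner (a *: x) y = a * inner x y.
Proof. by rewrite linearZl_LR. Qed.

Lemma innerZr a x y : inner x (a *: y) = a * inner x y.
Proof. by rewrite innerC innerZl innerC. Qed.

Lemma innerNl x y : inner (- x) y = - inner x y.
Proof. by rewrite -scaleN1r innerZl mulN1r. Qed.

Lemma innerNr x y : inner x (- y) = - inner x y.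
Proof. by rewrite innerC innerNl innerC. Qed.

Lemma innerBl x y z : inner (x - y) z = inner x z - inner y z.
Proof. by rewrite innerDl innerNl. Qed.

Lemma innerBr x y z : inner x (y - z) = inner x y - inner x z.
Proof. by rewrite innerDr innerNr. Qed.

Lemma inner0l x : inner 0 x = 0.
Proof. by rewrite -(scale0r 0) innerZl mul0r. Qed.

Lemma inner0r x : inner x 0 = 0.
Proof. by rewrite innerC inner0l. Qed.

Definition innerE := (innerDl, innerDr, innerNl, innerNr, innerZl, innerZr).

Lemma sqnormD x y : `|x + y| ^+ 2 = `|x| ^+ 2 + 2 * inner x y + `|y| ^+ 2.
Proof. rewrite !sqr_norm_inner !innerE (innerC y x); ring. Qed.

Lemma sqnormB x y : `|x - y| ^+ 2 = `|x| ^+ 2 - 2 * inner x y + `|y| ^+ 2.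
Proof. by rewrite sqnormD innerNr normrN mulrN. Qed.

Lemma normZ_sqr a x : `|a *: x| ^+ 2 = a ^+ 2 * `|x| ^+ 2.
Proof. by rewrite normrZ exprMn real_normK ?num_real. Qed.

Lemma CauchySchwarz_inner x y : inner x y <= `|x| * `|y|.
Proof.
have [->|x0] := eqVneq x 0; first by rewrite inner0l normr0 mul0r.
have [->|y0] := eqVneq y 0; first by rewrite inner0r normr0 mulr0.
have xp : 0 < `|x| by rewrite normr_gt0.
have yp : 0 < `|y| by rewrite normr_gt0.
have := sqr_ge0 `| `|y| *: x - `|x| *: y |.
rewrite sqnormB !normZ_sqr innerZl innerZr.
have -> : `|y| ^+ 2 * `|x| ^+ 2 - 2 * (`|y| * (`|x| * inner x y)) +
  `|x| ^+ 2 * `|y| ^+ 2 = (2 * `|x| * `|y|) * (`|x| * `|y| - inner x y) by ring.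
by rewrite pmulr_rge0 ?subr_ge0 // mulr_gt0 // mulr_gt0.
Qed.

Lemma CauchySchwarz_abs x y : `|inner x y| <= `|x| * `|y|.
Proof.
rewrite ler_norml CauchySchwarz_inner andbT lerNl -innerNl.
by rewrite (le_trans (CauchySchwarz_inner _ _)) // normrN.
Qed.

Lemma inner_ext x y : (forall z, inner x z = inner y z) -> x = y.
Proof.
move=> h; apply/eqP; rewrite -subr_eq0 -normr_eq0 -sqrf_eq0 sqr_norm_inner.
by rewrite innerBl h subrr.
Qed.

End InnerProduct.

(** Identities between linear combinations of vectors are identities between
    their inner products with a fixed vector. *)
Ltac vector_ring := apply: inner_ext => ?; rewrite ?innerE; ring.

Section Limits.
Context {R : realType}.

(** Passing to the limit in an inequality between norms. *)
Lemma norm_le_approx (V : normedModType R) (x : V) (c : R) :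
  (forall e : R, 0 < e -> exists2 z, `|x - z| <= e & `|z| <= c) -> `|x| <= c.
Proof.
move=> h; apply/ler_addgt0Pr => e e0; have [z xz zc] := h e e0.
by rewrite -(subrK z x) (le_trans (ler_normD _ _)) // addrC lerD.
Qed.

Lemma eq_of_approx (V : normedModType R) (x y : V) :
  (forall e : R, 0 < e -> `|x - y| <= e) -> x = y.
Proof.
move=> h; apply/eqP; rewrite -subr_eq0 -normr_le0.
by apply/ler_addgt0Pr => e e0; rewrite add0r h.
Qed.

Lemma cauchy_limit (V : completeNormedModType R) (u : nat -> V) :
  (forall e : R, 0 < e -> exists N, forall m n, (N <= m)%N -> (N <= n)%N ->
     `|u m - u n| <= e) ->
  exists l, forall e : R, 0 < e -> exists N, forall n, (N <= n)%N ->
     `|u n - l| <= e.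
Proof.
move=> h.
have cu : cvgn u.
  apply/cauchy_cvgP/cauchy_exP => e e0.
  have [N hN] := h (e / 2) (divr_gt0 e0 (ltr0Sn R 1)).
  exists (u N); exists N => // n /= Nn.
  rewrite -ball_normE /ball_ /=; apply: le_lt_trans (hN N n _ Nn) _ => //.
  by rewrite ltr_pdivrMr // ltr_pMr // ltr1n.
exists (limn u) => e e0.
move/cvgrPdist_le: cu => /(_ e e0) [N _ hN].
by exists N => n Nn; rewrite distrC; exact: hN.
Qed.

End Limits.

(** * Representation of functionals and adjoints *)

Section LinearMaps.
Context {R : realType} {U V : lmodType R} {f : U -> V}.
Hypothesis fL : linear f.

Lemma linfD x y : f (x + y) = f x + f y.
Proof. by rewrite -[in LHS](scale1r x) fL scale1r. Qed.

Lemma linf0 : f 0 = 0.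
Proof. by apply: (addrI (f 0)); rewrite -linfD !addr0. Qed.

Lemma linfZ a x : f (a *: x) = a *: f x.
Proof. by rewrite -[a *: x]addr0 fL linf0 addr0. Qed.

Lemma linfN x : f (- x) = - f x.
Proof. by rewrite -scaleN1r linfZ scaleN1r. Qed.

Lemma linfB x y : f (x - y) = f x - f y.
Proof. by rewrite linfD linfN. Qed.

End LinearMaps.

Lemma le_of_sqr {R : realDomainType} (a b : R) :
  0 <= b -> a ^+ 2 <= b ^+ 2 -> a <= b.
Proof. move=> b0; nra. Qed.

Section Riesz.
Context {R : realType}.

(** A common form of the Riesz theorem and of Douglas' range inclusion lemma:
    a functional dominated by [|K h|] is the inner product of [K h] with a
    fixed vector.  The quadratic functional [|K h|^2 - 2 phi h] is bounded
    below; by the parallelogram law the images of a minimising sequence are a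
    Cauchy sequence, whose limit is the vector sought. *)
Lemma dominated_functional (U : lmodType R) (Y : hilbertType R) (K : U -> Y)
    (phi : U -> R) (c : R) :
  linear K -> scalar phi -> 0 <= c -> (forall h, `|phi h| <= c * `|K h|) ->
  exists2 p : Y, `|p| <= c & forall h, phi h = inner (K h) p.
Proof.
move=> KL phiL c0 phic.
have phiD x y : phi (x + y) = phi x + phi y.
  by rewrite -[in LHS](scale1r x) phiL mul1r.
have phi0 : phi 0 = 0 by apply: (addrI (phi 0)); rewrite -phiD !addr0.
have phiZ a x : phi (a *: x) = a * phi x.
  by rewrite -[a *: x]addr0 phiL phi0 addr0.
pose J h := `|K h| ^+ 2 - 2 * phi h.
have Jlb h : - c ^+ 2 <= J h.
  have := phic h; rewrite ler_norml => /andP[_ ph].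
  have := sqr_ge0 (`|K h| - c); rewrite /J; nra.
have Jinf : has_inf (range J).
  by split; [exists (J 0), 0 | exists (- c ^+ 2) => _ [h _ <-]].
pose j := inf (range J).
have jJ h : j <= J h by apply: ge_inf; [exact: Jinf.2 | exists h].
pose r (n : nat) : R := n.+1%:R^-1.
have r0 n : 0 < r n by rewrite invr_gt0 ltr0n.
have rsmall (e : R) : 0 < e -> exists N, forall n, (N <= n)%N -> r n <= e.
  move=> e0; exists (Num.truncn e^-1) => n Nn.
  rewrite /r invf_ple ?posrE ?ltr0n // ltW //.
  apply: lt_le_trans (truncnS_gt _) _; by rewrite ler_nat ltnS.
have [u hu] : {u : nat -> U & forall n, J (u n) <= j + r n}.
  apply: (@choice _ _ (fun n h => J h <= j + r n)) => n.
  have [_ [h _ <-] hj] := inf_adherent (r0 n) Jinf.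
  by exists h; exact: ltW.
(* The parallelogram law, with [J] bounded below by [j] at the midpoint. *)
have par h g : `|K h - K g| ^+ 2 <= 2 * (J h + J g - 2 * j).
  have /(_ (2^-1 *: (h + g))) jm := jJ.
  move: jm; rewrite /J (linfZ KL) normZ_sqr phiZ (linfD KL) phiD sqnormB sqnormD.
  have -> : (2^-1 : R) ^+ 2 = 4^-1 by field.
  lra.
have [p hp] : exists l, forall e : R, 0 < e -> exists N, forall n, (N <= n)%N ->
     `|K (u n) - l| <= e.
  apply: cauchy_limit => e e0.
  have [N hN] := rsmall (e ^+ 2 / 4) (divr_gt0 (exprn_gt0 2 e0) (ltr0Sn R 3)).
  exists N => m n Nm Nn; apply: le_of_sqr; first exact: ltW.
  have := par (u m) (u n); have := hu m; have := hu n.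
  have := hN m Nm; have := hN n Nn. lra.
have rep h : phi h = inner (K h) p.
  pose d := inner (K h) p - phi h.
  (* [J] cannot decrease along the line through the limit in direction [h]. *)
  have quad t : 0 <= 2 * t * d + t ^+ 2 * `|K h| ^+ 2.
    apply/ler_addgt0Pr => e e0.
    have T0 : 0 < 2 * `|t| * `|K h| + 1.
      by rewrite ltr_wpDl // mulr_ge0 // mulr_ge0.
    have e2 : 0 < e / 2 by rewrite divr_gt0.
    have [N1 h1] := hp _ (divr_gt0 e2 T0).
    have [N2 h2] := rsmall _ e2.
    pose n := maxn N1 N2.
    have := h1 n (leq_maxl _ _); have := h2 n (leq_maxr _ _).
    have := jJ (u n + t *: h); have := hu n.
    rewrite /J (linfD KL) (linfZ KL) phiD phiZ sqnormD normZ_sqr innerZr.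
    move=> a1 a2 a3 a4.
    have : `|2 * t * inner (K h) (K (u n) - p)| <= e / 2.
      rewrite normrM normrM (ger0_norm (ler0n R 2)).
      apply: (@le_trans _ _ (2 * `|t| * (`|K h| * (e / 2 / (2 * `|t| * `|K h| + 1))))).
        rewrite ler_wpM2l ?mulr_ge0 // (le_trans (CauchySchwarz_abs _ _)) //.
        by rewrite ler_wpM2l.
      rewrite mulrA mulrA ler_pdivrMr // mulrC ler_wpM2l ?(ltW e2) //; lra.
    rewrite ler_norml innerBr => /andP[_ a5].
    rewrite /d (innerC (K h) (K (u n))) in a5 *; nra.
  have q1 : 0 < `|K h| ^+ 2 + 1 by rewrite ltr_wpDl ?sqr_ge0.
  have := quad (- d / (`|K h| ^+ 2 + 1)).
  set q := `|K h| ^+ 2 in q1 *.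
  have -> : 2 * (- d / (q + 1)) * d + (- d / (q + 1)) ^+ 2 * q =
     - (d / (q + 1)) ^+ 2 * (q + 2) by field; rewrite gt_eqF.
  rewrite mulNr oppr_ge0 => dq.
  have qq : 0 < q + 2 by rewrite (lt_trans q1) // ltrD2l ltr1n.
  have : (d / (q + 1)) ^+ 2 <= 0 by rewrite -(pmulr_lle0 _ qq) .
  move=> d2; have : (d / (q + 1)) ^+ 2 == 0 by rewrite eq_le d2 sqr_ge0.
  by rewrite sqrf_eq0 mulf_eq0 invr_eq0 (gt_eqF q1) orbF subr_eq0 => /eqP.
exists p => //.
have [->|p0] := eqVneq p 0; first by rewrite normr0.
have pp : 0 < `|p| by rewrite normr_gt0.
rewrite -(ler_pM2l pp) -expr2; apply/ler_addgt0Pr => e e0.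
have pc : 0 < `|p| + c by rewrite ltr_wpDr.
have [N hN] := hp _ (divr_gt0 e0 pc).
have := hN N (leqnn N); set v := K (u N) => vp.
have := phic (u N); rewrite rep -/v ler_norml => /andP[_ a1].
have a2 : inner (p - v) p <= `|p| * (e / (`|p| + c)).
  rewrite (le_trans (CauchySchwarz_inner _ _)) // mulrC ler_wpM2l //.
  by rewrite distrC.
have a3 : `|v| <= `|p| + e / (`|p| + c).
  by rewrite -(subrK p v) addrC (le_trans (ler_normD _ _)) // lerD2l.
have a4 : e / (`|p| + c) * (`|p| + c) = e by rewrite divfK // gt_eqF.
move: a2; rewrite innerBl -sqr_norm_inner => a2; nra.
Qed.
End Riesz.

Section Adjoint.
Context {R : realType} {X Y : hilbertType R}.

Lemma adjointP (T : X -> Y) (c : R) :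
  linear T -> 0 <= c -> (forall x, `|T x| <= c * `|x|) ->
  forall x y, inner (T x) y = inner x (adjoint T y).
Proof.
move=> TL c0 Tc x y; apply: (getPex (P := [set z : X | forall x, inner (T x) y = inner x z])).
have [|||p _ hp] := @dominated_functional R X X idfun
    (fun h => inner (T h) y) (c * `|y|) _ _ (mulr_ge0 c0 (normr_ge0 y)).
- by move=> a u v.
- by move=> a u v /=; rewrite TL innerDl innerZl.
- move=> h /=; rewrite (le_trans (CauchySchwarz_abs _ _)) //.
  by rewrite mulrAC ler_wpM2r.
by exists p.
Qed.

(** A continuous linear map is bounded on the unit ball, so that the supremum
    that defines its operator norm is an upper bound. *)
Lemma opnorm_bound (T : {linear X -> Y}) (c : R) :
  continuous T -> opnorm T <= c -> 0 <= c /\ forall h, `|T h| <= c * `|h|.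
Proof.
move=> Tc Tn.
pose S := [set `|T h| | h in [set h : X | `|h| <= 1]].
have [d d0 hd] : exists2 d : R, 0 < d & forall h, `|h| <= d -> `|T h| <= 1.
  have /cvgrPdist_le /(_ 1 ltr01) := Tc 0.
  rewrite linear0 => /nbhs_ballP [d /= d0 hd].
  exists (d / 2); first by rewrite divr_gt0.
  move=> h hh; have := hd h; rewrite /= sub0r normrN; apply.
  rewrite -ball_normE /ball_ /= sub0r normrN (le_lt_trans hh) //.
  by rewrite ltr_pdivrMr // ltr_pMr // ltr1n.
have Sup : has_ubound S.
  exists d^-1 => _ [h /= h1 <-].
  have := hd (d *: h); rewrite linearZ !normrZ (gtr0_norm d0) => H.
  rewrite -(ler_pM2l d0) divff ?gt_eqF // H //.
  by rewrite -[leRHS]mulr1 ler_wpM2l // ltW.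
have Sle h : `|h| <= 1 -> `|T h| <= c.
  move=> h1; apply: le_trans Tn; apply: ub_le_sup => //.
  by exists h.
have c0 : 0 <= c by have := Sle 0; rewrite normr0 ler01 linear0 normr0; apply.
split=> // h; have [->|h0] := eqVneq h 0; first by rewrite linear0 !normr0 mulr0.
have hp : 0 < `|h| by rewrite normr_gt0.
have := Sle (`|h|^-1 *: h); rewrite linearZ !normrZ normfV normr_id.
rewrite mulVf ?gt_eqF // => /(_ (lexx _)).
by rewrite ler_pdivrMl // mulrC.
Qed.

End Adjoint.

(** * Spectrum and norm of polynomials of a symmetric operator *)

Section Symmetric.
Context {R : realType} {X : hilbertType R}.

Definition symmetric_op (A : X -> X) := forall x y, inner (A x) y = inner x (A y).

Lemma symmetric_linear A : symmetric_op A -> linear A.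
Proof.
move=> As a x y; apply: inner_ext => z.
by rewrite As !innerE !As.
Qed.

(** The range of a symmetric operator which is bounded below is the whole
    space: [h |-> inner y h] is dominated by [|A h|], and the vector which
    represents it is a preimage of [y]. *)
Lemma symmetric_bounded_inverse (A : X -> X) (c : R) :
  symmetric_op A -> 0 < c -> (forall x, c * `|x| <= `|A x|) ->
  exists S, bounded_inverse A S.
Proof.
move=> As c0 Ac; have AL := symmetric_linear As.
have surj y : exists x, A x = y.
  have [|||p _ hp] := @dominated_functional R X X A (fun h => inner y h)
      (`|y| / c) AL.
  - by move=> a u v; rewrite innerDr innerZr.
  - by rewrite divr_ge0 // ltW.
  - move=> h; rewrite (le_trans (CauchySchwarz_abs _ _)) // -mulrA ler_wpM2l //.
    by rewrite mulrC ler_pdivlMr // mulrC.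
  by exists p; apply: inner_ext => z; rewrite As innerC -hp.
have [S AS] := choice surj.
have inj x y : A x = A y -> x = y.
  move=> e; apply/eqP; rewrite -subr_eq0 -normr_le0 -(pmulr_rle0 _ c0).
  by rewrite (le_trans (Ac _)) // (linfB AL) e subrr normr0.
exists S; split=> //; first by move=> x; apply: inj.
by exists c^-1 => x; rewrite ler_pdivlMl // -[in leRHS](AS x).
Qed.

Section Polynomials.
Variable A : X -> X.
Implicit Types (p q : {poly R}) (x y : X) (a : R).
Hypothesis As : symmetric_op A.
Let AL := symmetric_linear As.
Local Notation P p := (op_horner p A).

Lemma op_horner_wide n p x : (size p <= n)%N ->
  P p x = \sum_(i < n) p`_i *: iter i A x.
Proof.
move=> pn; rewrite /op_horner (big_ord_widen n (fun i => p`_i *: iter i A x)) //.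
rewrite big_mkcond; apply: eq_bigr => i _ /=.
by case: ltnP => // /(nth_default 0) ->; rewrite scale0r.
Qed.

Lemma op_hornerD p q x : P (p + q) x = P p x + P q x.
Proof.
have m1 := leq_maxl (size p) (size q); have m2 := leq_maxr (size p) (size q).
rewrite (op_horner_wide x (size_polyD p q)) (op_horner_wide x m1).
rewrite (op_horner_wide x m2) -big_split; apply: eq_bigr => i _.
by rewrite coefD scalerDl.
Qed.

Lemma op_hornerZ a p x : P (a *: p) x = a *: P p x.
Proof.
rewrite (op_horner_wide x (size_scale_leq a p)) /op_horner scaler_sumr.
by apply: eq_bigr => i _; rewrite coefZ scalerA.
Qed.

Lemma op_hornerC a x : P a%:P x = a *: x.
Proof.
rewrite (@op_horner_wide 1) ?size_polyC ?leq_b1 //.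
by rewrite big_ord1 /= coefC.
Qed.

Lemma op_hornerN p x : P (- p) x = - P p x.
Proof. by rewrite -scaleN1r op_hornerZ scaleN1r. Qed.

Lemma op_hornerB p q x : P (p - q) x = P p x - P q x.
Proof. by rewrite op_hornerD op_hornerN. Qed.

Lemma op_hornerMX p x : P (p * 'X) x = P p (A x).
Proof.
have sz : (size (p * 'X)%R <= (size p).+1)%N.
  by have [->|p0] := eqVneq p 0; rewrite ?mul0r ?size_poly0 // size_mulX.
rewrite (op_horner_wide x sz) big_ord_recl coefMX eqxx scale0r add0r.
by apply: eq_bigr => i _; rewrite coefMX /= -iterSr.
Qed.

Lemma op_horner_sym p : symmetric_op (P p).
Proof.
elim/poly_ind: p => [|p c IH] x y.
  by rewrite -polyC0 !op_hornerC !scale0r inner0l inner0r.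
rewrite !op_hornerD !op_hornerC !op_hornerMX !innerE IH As.
congr (_ + _).
elim/poly_ind: p x y {IH} => [|p d IH] x y.
  by rewrite -polyC0 !op_hornerC !scale0r inner0r (linf0 AL) inner0r.
by rewrite !op_hornerD !op_hornerC !op_hornerMX (linfD AL) (linfZ AL) !innerE IH.
Qed.

Lemma op_hornerX x : P 'X x = A x.
Proof. by rewrite -['X]mul1r op_hornerMX -polyC1 op_hornerC scale1r. Qed.

Lemma op_horner_comm p x : P p (A x) = A (P p x).
Proof.
elim/poly_ind: p x => [|p d IH] x.
  by rewrite -polyC0 !op_hornerC !scale0r (linf0 AL).
by rewrite !op_hornerD !op_hornerC !op_hornerMX (linfD AL) (linfZ AL) IH.
Qed.

Lemma op_hornerM p q x : P (p * q) x = P p (P q x).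
Proof.
elim/poly_ind: p x => [|p d IH] x.
  by rewrite mul0r -polyC0 !op_hornerC !scale0r.
rewrite mulrDl mulrAC mul_polyC !op_hornerD op_hornerC !op_hornerMX op_hornerZ.
by rewrite IH op_horner_comm.
Qed.

Hypothesis Abnd : exists2 c : R, 0 <= c & forall x, `|A x| <= c * `|x|.

Lemma op_horner_bounded p : exists2 c : R, 0 <= c & forall x, `|P p x| <= c * `|x|.
Proof.
have [k k0 hk] := Abnd.
elim/poly_ind: p => [|p d [c c0 IH]].
  by exists 0 => // x; rewrite -polyC0 op_hornerC scale0r normr0 mul0r.
exists (c * k + `|d|); first by rewrite addr_ge0 // mulr_ge0.
move=> x; rewrite op_hornerD op_hornerC op_hornerMX.
rewrite (le_trans (ler_normD _ _)) // normrZ mulrDl lerD2r.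
by rewrite (le_trans (IH _)) // -mulrA ler_wpM2l.
Qed.

End Polynomials.
End Symmetric.

Section RealFactors.
Variable R : realType.
Import complex.
Local Notation toC := (real_complex R).

(** The quadratic factor comes from a pair of conjugate complex roots. *)
Lemma real_poly_factor (r : {poly R}) : size r != 1%N -> r != 0 ->
  (exists l, root r l) \/
  (exists a b, b != 0 /\ (('X - a%:P) ^+ 2 + (b ^+ 2)%:P) %| r).
Proof.
move=> sr r0.
have /closed_rootP [z rz] : size (map_poly toC r) != 1%N by rewrite size_map_poly.
case: z rz => a b rz; have [b0|b0] := eqVneq b 0.
  by left; exists a; rewrite -(fmorph_root toC) b0 in rz *.
right; exists a, b; split=> //.
have rz' : root (map_poly toC r) (Complex a (- b)).
  have E : map_poly conjc (map_poly toC r) = map_poly toC r.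
    by rewrite -map_poly_comp; apply: eq_map_poly => x /=; rewrite oppr0.
  by rewrite -E complex_root_conj /= opprK.
rewrite -(dvdp_map toC).
have -> : map_poly toC (('X - a%:P) ^+ 2 + (b ^+ 2)%:P) =
    ('X - (Complex a b)%:P) * ('X - (Complex a (- b))%:P).
  rewrite rmorphD rmorphXn /= rmorphB /= map_polyX !map_polyC /=.
  have -> : ('X - (Complex a b)%:P) * ('X - (Complex a (- b))%:P) =
    'X ^+ 2 - (Complex a b + Complex a (- b))%:P * 'X +
    (Complex a b * Complex a (- b))%:P.
    by rewrite polyCD polyCM; ring.
  have -> : Complex a b + Complex a (- b) = 2 * toC a.
    by apply/eqP; rewrite eq_complex /= ; apply/andP; split; apply/eqP => /=; ring.
  have -> : Complex a b * Complex a (- b) = toC a ^+ 2 + toC (b ^+ 2).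
    by apply/eqP; rewrite eq_complex /= ; apply/andP; split; apply/eqP => /=; ring.
  by rewrite polyCD polyCM polyC_exp; ring.
rewrite Gauss_dvdp ?dvdp_XsubCl ?rz //.
rewrite coprimep_XsubC root_XsubC eq_complex /= eqxx /=.
by rewrite eqNr.
Qed.

End RealFactors.

Section SpectralNorm.
Context {R : realType} {X : hilbertType R}.
Variable A : X -> X.
Hypothesis As : symmetric_op A.
Hypothesis Abnd : exists2 c : R, 0 <= c & forall x, `|A x| <= c * `|x|.
Implicit Types (p q r : {poly R}) (x y : X) (l : R).
Let AL := symmetric_linear As.
Local Notation P p := (op_horner p A).

Definition bounded_below (B : X -> X) :=
  exists2 c : R, 0 < c & forall x, c * `|x| <= `|B x|.

Lemma op_horner_XsubC l x : P ('X - l%:P) x = A x - l *: x.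
Proof. by rewrite op_hornerB op_hornerX op_hornerC. Qed.

Lemma notin_spectrum l : ~ spectrum A l -> bounded_below (P ('X - l%:P)).
Proof.
move=> /contrapT [S [SK _ [c hc]]].
have c1 : 0 < `|c| + 1 by rewrite ltr_wpDl.
exists (`|c| + 1)^-1; first by rewrite invr_gt0.
move=> x; rewrite op_horner_XsubC ler_pdivrMl // -{1}(SK x).
by rewrite (le_trans (hc _)) // ler_wpM2r // (le_trans (ler_norm c)) // lerDl.
Qed.

Lemma bounded_below_mul p q :
  bounded_below (P p) -> bounded_below (P q) -> bounded_below (P (p * q)).
Proof.
move=> [c c0 hc] [d d0 hd]; exists (c * d); first exact: mulr_gt0.
move=> x; rewrite (op_hornerM As) -mulrA (le_trans _ (hc _)) //.
by rewrite ler_wpM2l // ltW.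
Qed.

Lemma bounded_below_quadratic (a b : R) :
  b != 0 -> bounded_below (P (('X - a%:P) ^+ 2 + (b ^+ 2)%:P)).
Proof.
move=> b0; have b2 : 0 < b ^+ 2 by rewrite exprn_even_gt0.
exists (b ^+ 2) => // x; have [->|x0] := eqVneq x 0; first by rewrite normr0 mulr0.
have xp : 0 < `|x| by rewrite normr_gt0.
rewrite -(ler_pM2l xp); apply: le_trans (CauchySchwarz_inner _ _).
rewrite op_hornerD expr2 (op_hornerM As) op_hornerC innerDr innerZr.
rewrite -(op_horner_sym As) -!sqr_norm_inner; have := sqr_ge0 `|P ('X - a%:P) x|.
by move=> H; rewrite mulrCA -expr2 lerDr.
Qed.

(** A polynomial without roots in the spectrum is a product of linear factors
    [X - l] with [l] outside the spectrum and of quadratic factors without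
    real roots, each of which is bounded below at [A]. *)
Lemma bounded_below_horner r :
  r != 0 -> (forall l, spectrum A l -> r.[l] != 0) -> bounded_below (P r).
Proof.
move: {2}(size r) (leqnn (size r)) => n.
elim: n r => [|n IH] r; first by rewrite leqn0 size_poly_eq0 => ->.
move=> rn r0 hr; have [/eqP/size_poly1P[c c0 ->]|s1] := eqVneq (size r) 1%N.
  exists `|c|; first by rewrite normr_gt0.
  by move=> x; rewrite op_hornerC normrZ.
have [f fr [fs fb]] : exists2 f : {poly R}, f %| r &
    (1 < size f)%N /\ bounded_below (P f).
  have [[l rl]|[a [b [b0 fr]]]] := real_poly_factor s1 r0.
    exists ('X - l%:P); first by rewrite dvdp_XsubCl.
    split; first by rewrite size_XsubC.
    by apply: notin_spectrum => /hr; rewrite -rootE rl.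
  exists (('X - a%:P) ^+ 2 + (b ^+ 2)%:P) => //; split.
    rewrite size_polyDl size_exp_XsubC // size_polyC.
    by case: (_ != 0).
  exact: bounded_below_quadratic.
have [q rE] := dvdpP _ _ fr; move: r0 rn hr; rewrite rE mulf_eq0 negb_or.
case/andP=> q0 f0; rewrite size_mul // => rn hr.
apply: bounded_below_mul => //; apply: IH => //.
  by move: rn fs; case: (size f) => [|[|m]] //; rewrite !addnS /= ltnS => h _; exact: leq_trans (leq_addr _ _) h.
by move=> l /hr; rewrite hornerM mulf_eq0 negb_or => /andP[].
Qed.

(** If [M] is the norm of [Q := q(A)] then [|Q x_n|] tends to [M] for suitable
    unit vectors [x_n], along which [(M^2 - Q^2) x_n] tends to [0]. *)
Lemma norm_sqr_not_bounded_below q :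
  exists M : R, [/\ 0 <= M, forall x, `|P q x| <= M * `|x| &
    bounded_below (P ((M ^+ 2)%:P - q ^+ 2)) -> forall x, x = 0].
Proof.
have [c c0 hc] := op_horner_bounded Abnd q.
have QL := symmetric_linear (op_horner_sym As q).
pose S := [set `|P q x| | x in [set x : X | `|x| <= 1]].
have Sub : has_ubound S.
  exists c => _ [x /= x1 <-]; rewrite (le_trans (hc _)) //.
  by rewrite -[leRHS]mulr1 ler_wpM2l.
pose M := sup S.
have MS x : `|x| <= 1 -> `|P q x| <= M by move=> x1; apply: ub_le_sup => //; exists x.
have M0 : 0 <= M by rewrite (le_trans _ (MS 0 _)) // normr0.
have SM m : 0 <= m -> (forall x, `|P q x| <= m * `|x|) -> M <= m.
  move=> m0 hm; apply: ge_sup; first by exists `|P q 0|, 0 => //=; rewrite normr0.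
  by move=> _ [x /= x1 <-]; rewrite (le_trans (hm _)) // -[leRHS]mulr1 ler_wpM2l.
have hM x : `|P q x| <= M * `|x|.
  have [->|x0] := eqVneq x 0; first by rewrite (linf0 QL) !normr0 mulr0.
  have xp : 0 < `|x| by rewrite normr_gt0.
  have := MS (`|x|^-1 *: x); rewrite (linfZ QL) !normrZ normfV normr_id.
  rewrite mulVf ?gt_eqF // => /(_ (lexx _)).
  by rewrite ler_pdivrMl // mulrC.
exists M; split=> // -[d d0 hd] x.
(* With [Q := q(A)]: [|(M^2 - Q^2) z|^2 <= M^2 (M^2 |z|^2 - |Q z|^2)]. *)
have key z : d ^+ 2 * `|z| ^+ 2 <= M ^+ 2 * (M ^+ 2 * `|z| ^+ 2 - `|P q z| ^+ 2).
  have := hd z; rewrite -(@ler_pXn2r _ 2) ?nnegrE // ?mulr_ge0 ?(ltW d0) //.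
  rewrite op_hornerB op_hornerC expr2 (op_hornerM As) sqnormB normZ_sqr innerZl exprMn.
  rewrite -(op_horner_sym As) -sqr_norm_inner.
  have : `|P q (P q z)| ^+ 2 <= M ^+ 2 * `|P q z| ^+ 2.
    by rewrite -exprMn ler_pXn2r ?nnegrE // mulr_ge0.
  move=> a1 a2; have -> : M ^+ 2 * (M ^+ 2 * `|z| ^+ 2 - `|P q z| ^+ 2) =
   (M * M) ^+ 2 * `|z| ^+ 2 - M ^+ 2 * `|P q z| ^+ 2 by ring.
  lra.
have d2 : 0 < d ^+ 2 by rewrite exprn_gt0.
apply/eqP; rewrite -normr_eq0; apply/negP => /negP x0.
have xp : 0 < `|x| ^+ 2 by rewrite exprn_even_gt0.
have M1 : 0 < M.
  rewrite lt0r M0 andbT; apply/negP => /eqP M00.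
  have := key x; rewrite M00 expr0n /= mul0r => H.
  by have := mulr_gt0 d2 xp; lra.
have M2 : 0 < M ^+ 2 by rewrite exprn_gt0.
(* Then [Q] has norm at most [sqrt L], which is less than [M]. *)
pose L := M ^+ 2 - d ^+ 2 / M ^+ 2.
have LM : L < M ^+ 2 by rewrite /L ltrBlDr ltrDl divr_gt0.
have QL2 z : `|P q z| ^+ 2 <= L * `|z| ^+ 2.
  rewrite -(ler_pM2l M2) /L mulrBl mulrBr.
  have -> : M ^+ 2 * (d ^+ 2 / M ^+ 2 * `|z| ^+ 2) = d ^+ 2 * `|z| ^+ 2.
    by field; rewrite gt_eqF.
  have := key z; lra.
have L0 : 0 <= L.
  by rewrite -(pmulr_lge0 _ xp) (le_trans _ (QL2 x)) // sqr_ge0.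
have : M <= Num.sqrt L.
  apply: SM => [|z]; first exact: sqrtr_ge0.
  apply: le_of_sqr; first by rewrite mulr_ge0 ?sqrtr_ge0.
  by rewrite exprMn sqr_sqrtr.
rewrite -(@ler_pXn2r _ 2) ?nnegrE ?sqrtr_ge0 // sqr_sqrtr // => ML.
by have := lt_le_trans LM ML; rewrite ltxx.
Qed.

(** If [q(A)] had norm [M > c] then [M^2 - q^2] would be positive on the spectrum
    and thus bounded below at [A], which it is not.  This argument fails only if
    [M^2 - q^2] is the zero polynomial; then the spectrum is empty, and the
    argument applies to ['X] instead of [q]. *)
Theorem op_horner_norm_le q (c : R) :
  0 <= c -> (forall l, spectrum A l -> `|q.[l]| <= c) ->
  forall x, `|P q x| <= c * `|x|.
Proof.
move=> c0 hq x; rewrite leNgt; apply/negP => cx.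
have QL := symmetric_linear (op_horner_sym As q).
have x0 : x <> 0.
  by move=> x0; move: cx; rewrite x0 (linf0 QL) !normr0 mulr0 ltxx.
have xp : 0 < `|x| by rewrite normr_gt0; apply/eqP.
have [M [M0 hM Mb]] := norm_sqr_not_bounded_below q.
have cM : c < M by have := lt_le_trans cx (hM x); rewrite ltr_pM2r.
have nz l : spectrum A l -> ((M ^+ 2)%:P - q ^+ 2).[l] != 0.
  move=> /hq ql; rewrite !hornerE gt_eqF // subr_gt0.
  by rewrite -real_normK ?num_real // ltr_pXn2r ?nnegrE // (le_lt_trans ql).
have [r0|r0] := eqVneq ((M ^+ 2)%:P - q ^+ 2) 0; last first.
  by apply: x0; apply: Mb; exact: bounded_below_horner.
have spec0 l : ~ spectrum A l by move=> /nz; rewrite r0 horner0 eqxx.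
have [M' [_ _ Mb']] := norm_sqr_not_bounded_below 'X.
apply: x0; apply: Mb'; apply: bounded_below_horner => [|l /spec0 //].
rewrite -size_poly_eq0 addrC size_polyDl size_polyN size_polyXn //.
by rewrite size_polyC; case: (_ != 0).
Qed.

End SpectralNorm.

(** * Polynomial approximation on the unit interval *)

Section Bernstein.
Context {R : realType}.
Implicit Types (f g : R -> R) (x y e : R).

(** Uniform continuity on [0, 1], in the form that the second moment of the
    binomial distribution turns into a rate for Bernstein polynomials. *)
Definition quad_cont f := forall e : R, 0 < e ->
  exists2 M : R, 0 <= M & forall x y, 0 <= x <= 1 -> 0 <= y <= 1 ->
    `|f x - f y| <= e + M * (x - y) ^+ 2.

(** The expectation of [phi] under the binomial distribution with parameters
    [n] and ['X], by the recursion over the first trial. *)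
Fixpoint bernstein n (phi : nat -> R) : {poly R} :=
  if n is m.+1 then
    'X * bernstein m (fun k => phi k.+1) + (1 - 'X) * bernstein m phi
  else (phi 0%N)%:P.

Lemma bernsteinS n phi x : (bernstein n.+1 phi).[x] =
  x * (bernstein n (fun k => phi k.+1)).[x] + (1 - x) * (bernstein n phi).[x].
Proof. by rewrite /= !hornerE. Qed.

Lemma bernstein_le n phi psi x : 0 <= x <= 1 ->
  (forall k, (k <= n)%N -> phi k <= psi k) ->
  (bernstein n phi).[x] <= (bernstein n psi).[x].
Proof.
move=> /andP[x0 x1]; elim: n phi psi => [|n IH] phi psi h.
  by rewrite !hornerC h.
rewrite !bernsteinS lerD // ler_wpM2l ?subr_ge0 // IH // => k kn.
  exact: h.
by apply: h; apply: leqW.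
Qed.

Lemma bernstein_affine n phi a b x :
  (bernstein n (fun k => a + b * phi k)).[x] = a + b * (bernstein n phi).[x].
Proof.
elim: n phi => [|n IH] phi; first by rewrite !hornerC.
by rewrite !bernsteinS (IH (fun k => phi k.+1)) IH; ring.
Qed.

Lemma bernstein_variance n a x :
  (bernstein n (fun k => (k%:R - a) ^+ 2)).[x] =
  (n%:R * x - a) ^+ 2 + n%:R * x * (1 - x).
Proof.
elim: n a => [|n IH] a; first by rewrite hornerC /=; ring.
rewrite bernsteinS IH.
have -> : (fun k => (k.+1%:R - a) ^+ 2) = (fun k => (k%:R - (a - 1)) ^+ 2).
  by apply/funext => k; rewrite -natr1; congr (_ ^+ 2); ring.
by rewrite IH -natr1; ring.
Qed.

(** The value at [x] is the mean of [f] at [k / n]; its distance to [f x] is at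
    most [e / 2] plus [M] times the variance [x (1 - x) / n] of [k / n]. *)
Lemma quad_cont_bernstein f : quad_cont f -> forall e : R, 0 < e ->
  exists p : {poly R}, forall x, 0 <= x <= 1 -> `|p.[x] - f x| <= e.
Proof.
move=> fc e e0; have e2 : 0 < e / 2 by rewrite divr_gt0.
have [M M0 hM] := fc _ e2.
pose n := (Num.truncn (M / (e / 2))).+1.
have n0 : 0 < n%:R :> R by rewrite ltr0n.
have Mn : M / n%:R <= e / 2.
  by rewrite ler_pdivrMr // mulrC -ler_pdivrMr // ltW // truncnS_gt.
exists (bernstein n (fun k => f (k%:R / n%:R))) => x x01.
have var : M / n%:R ^+ 2 * (bernstein n (fun k => (k%:R - n%:R * x) ^+ 2)).[x] <= e / 2.
  apply: le_trans Mn; rewrite bernstein_variance subrr expr0n /= add0r.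
  have -> : M / n%:R ^+ 2 * (n%:R * x * (1 - x)) = M / n%:R * (x * (1 - x)).
    by field; rewrite gt_eqF.
  rewrite -[leRHS]mulr1 ler_wpM2l ?divr_ge0 ?(ltW n0) //.
  by case/andP: x01 => _ x1; have := sqr_ge0 x; lra.
have hk k : (k <= n)%N -> `|f (k%:R / n%:R) - f x| <=
    e / 2 + M / n%:R ^+ 2 * (k%:R - n%:R * x) ^+ 2.
  move=> kn; have -> : M / n%:R ^+ 2 * (k%:R - n%:R * x) ^+ 2 =
    M * (k%:R / n%:R - x) ^+ 2 by field; rewrite gt_eqF.
  apply: hM => //; rewrite divr_ge0 ?(ltW n0) ?ler0n //=.
  by rewrite ler_pdivrMr // mul1r ler_nat.
have up := @bernstein_le n (fun k => f (k%:R / n%:R))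
  (fun k => (f x + e / 2) + M / n%:R ^+ 2 * (k%:R - n%:R * x) ^+ 2) x x01.
have lo := @bernstein_le n
  (fun k => (f x - e / 2) + - (M / n%:R ^+ 2) * (k%:R - n%:R * x) ^+ 2)
  (fun k => f (k%:R / n%:R)) x x01.
rewrite bernstein_affine in up; rewrite bernstein_affine in lo.
rewrite ler_norml; apply/andP; split.
  rewrite lerBrDl (le_trans _ (lo _)) //; first by lra.
  by move=> k kn; have := hk k kn; rewrite ler_norml => /andP[]; lra.
rewrite lerBlDl (le_trans (up _)) //; last by lra.
by move=> k kn; have := hk k kn; rewrite ler_norml => /andP[]; lra.
Qed.

Lemma quad_cont_bounded f : quad_cont f ->
  exists2 c : R, 0 <= c & forall x, 0 <= x <= 1 -> `|f x| <= c.
Proof.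
move=> /(_ 1 ltr01) [M M0 hM]; exists (`|f 0| + 1 + M).
  by rewrite !addr_ge0.
move=> x x01; rewrite -(subrK (f 0) (f x)) (le_trans (ler_normD _ _)) //.
rewrite addrC -addrA lerD2l (le_trans (hM x 0 x01 _)) ?lexx ?ler01 // subr0 lerD2l.
by rewrite -[leRHS]mulr1 ler_wpM2l // expr_le1; case/andP: x01.
Qed.

Lemma quad_cont_lipschitz f (c : R) :
  (forall x y, 0 <= x <= 1 -> 0 <= y <= 1 -> `|f x - f y| <= c * `|x - y|) ->
  quad_cont f.
Proof.
move=> fc e e0; exists (c ^+ 2 / (4 * e)).
  by rewrite divr_ge0 ?sqr_ge0 // mulr_ge0 // ltW.
move=> x y hx hy; rewrite (le_trans (fc _ _ hx hy)) //.
rewrite -[(x - y) ^+ 2]real_normK ?num_real //.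
set d := `|x - y|; rewrite -subr_ge0.
have -> : e + c ^+ 2 / (4 * e) * d ^+ 2 - c * d = (2 * e - c * d) ^+ 2 / (4 * e).
  by field; rewrite gt_eqF.
by rewrite divr_ge0 ?sqr_ge0 // mulr_ge0 // ltW.
Qed.

Lemma quad_cont_mul f g : quad_cont f -> quad_cont g ->
  quad_cont (fun x => f x * g x).
Proof.
move=> fc gc e e0.
have [a a0 ha] := quad_cont_bounded fc; have [b b0 hb] := quad_cont_bounded gc.
have k0 : 0 < a + b + 1 by rewrite ltr_wpDl // addr_ge0.
have [M M0 hM] := fc _ (divr_gt0 e0 k0); have [N N0 hN] := gc _ (divr_gt0 e0 k0).
exists (a * N + b * M); first by rewrite addr_ge0 // mulr_ge0.
move=> x y hx hy.
have -> : f x * g x - f y * g y = f x * (g x - g y) + (f x - f y) * g y by ring.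
rewrite (le_trans (ler_normD _ _)) // !normrM.
have a1 : `|f x| * `|g x - g y| <= a * (e / (a + b + 1) + N * (x - y) ^+ 2).
  by apply: ler_pM => //; [exact: ha | exact: hN].
have a2 : `|f x - f y| * `|g y| <= (e / (a + b + 1) + M * (x - y) ^+ 2) * b.
  by apply: ler_pM => //; [exact: hM | exact: hb].
have a3 : (a + b + 1) * (e / (a + b + 1)) = e by rewrite mulrCA divff ?mulr1 ?gt_eqF.
have a4 : 0 < e / (a + b + 1) by rewrite divr_gt0.
rewrite (le_trans (lerD a1 a2)) //; lra.
Qed.

Lemma quad_cont_limit f :
  (forall e : R, 0 < e -> exists2 g, quad_cont g &
     forall x, 0 <= x <= 1 -> `|g x - f x| <= e) -> quad_cont f.
Proof.
move=> h e e0; have e3 : 0 < e / 3 by rewrite divr_gt0.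
have [g gc hg] := h _ e3; have [M M0 hM] := gc _ e3; exists M => // x y hx hy.
have -> : f x - f y = (f x - g x) + (g x - g y) + (g y - f y) by ring.
rewrite (le_trans (ler_normD _ _)) // (le_trans (lerD (ler_normD _ _) (lexx _))) //.
by have := hg x hx; rewrite distrC; have := hg y hy; have := hM x y hx hy; lra.
Qed.

(** Concavity of the power, in the form that makes it Hoelder continuous. *)
Lemma powR_subadd (a x d : R) : 0 < a -> a <= 1 -> 0 <= x -> 0 <= d ->
  (x + d) `^ a <= x `^ a + d `^ a.
Proof.
move=> a0 a1; rewrite !le0r => /orP[/eqP->|x0].
  by move=> _; rewrite add0r powR0 ?gt_eqF // add0r.
case/orP=> [/eqP->|d0]; first by rewrite addr0 powR0 ?gt_eqF // addr0.
have pw z : 0 < z -> z `^ a = z * z `^ (a - 1).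
  by move=> z0; rewrite -{2}[z]powRr1 ?ltW // -powRD ?(gt_eqF z0) ?implybT // addrC subrK.
have dec z : 0 < z -> z <= x + d -> (x + d) `^ (a - 1) <= z `^ (a - 1).
  move=> z0 zx; have w0 := lt_le_trans z0 zx.
  rewrite -(opprB 1 a) !powRN lef_pV2 ?posrE ?powR_gt0 //.
  by rewrite ge0_ler_powR ?subr_ge0 // nnegrE ltW.
rewrite (pw _ x0) (pw _ d0) (pw _ (addr_gt0 x0 d0)) mulrDl.
apply: lerD; (apply: ler_wpM2l; first exact: ltW); apply: dec => //.
  by rewrite lerDl ltW.
by rewrite lerDr ltW.
Qed.

Lemma quad_cont_powR (a : R) : 0 <= a -> a <= 1 ->
  quad_cont (fun x => x `^ a).
Proof.
rewrite le0r => /orP[/eqP-> _ e e0|a0 a1].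
  by exists 0 => // x y _ _; rewrite !powRr0 subrr normr0 mul0r addr0 ltW.
have holder x y : 0 <= x -> x <= y -> `|y `^ a - x `^ a| <= (y - x) `^ a.
  move=> x0 xy; rewrite ger0_norm; last first.
    by rewrite subr_ge0 ge0_ler_powR ?nnegrE ?(ltW a0) // (le_trans x0).
  rewrite lerBlDr addrC -{1}(subrK x y) addrC.
  by rewrite powR_subadd // subr_ge0.
have {}holder x y : 0 <= x -> 0 <= y -> `|x `^ a - y `^ a| <= `|x - y| `^ a.
  move=> x0 y0; case: (leP x y) => [xy|/ltW yx].
    by rewrite distrC (distrC x) (ger0_norm (_ : 0 <= y - x)) ?subr_ge0 // holder.
  by rewrite (ger0_norm (_ : 0 <= x - y)) ?subr_ge0 // holder.
move=> e e0; have E0 : 0 < e `^ a^-1 by rewrite powR_gt0.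
exists ((e `^ a^-1) ^+ 2)^-1; first by rewrite invr_ge0 sqr_ge0.
move=> x y /andP[x0 x1] /andP[y0 y1]; rewrite (le_trans (holder _ _ x0 y0)) //.
rewrite -[(x - y) ^+ 2]real_normK ?num_real //; set d := `|x - y|.
have d0 : 0 <= d by exact: normr_ge0.
have d1 : d <= 1 by rewrite /d ler_norml; apply/andP; split; lra.
case: (leP d (e `^ a^-1)) => de.
  have eE : (e `^ a^-1) `^ a = e by rewrite -powRrM mulVf ?gt_eqF // powRr1 // ltW.
  apply: (@le_trans _ _ ((e `^ a^-1) `^ a)).
    by rewrite ge0_ler_powR ?nnegrE ?(ltW a0) ?(ltW E0).
  by rewrite eE lerDl mulr_ge0 ?sqr_ge0 // invr_ge0 sqr_ge0.
apply: (@le_trans _ _ 1).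
  have -> : 1 = 1 `^ a :> R by rewrite powR1.
  by rewrite ge0_ler_powR ?nnegrE ?(ltW a0).
apply: (@le_trans _ _ (((e `^ a^-1) ^+ 2)^-1 * d ^+ 2)).
  by rewrite ler_pdivlMl ?exprn_gt0 // mulr1 ler_pXn2r ?nnegrE ?(ltW E0) // ltW.
by rewrite lerDr ltW.
Qed.

End Bernstein.

Section QuadContAlgebra.
Context {R : realType}.
Implicit Types (f g : R -> R) (c : R).

Lemma quad_cont_id : quad_cont (fun l : R => l).
Proof. by apply: (@quad_cont_lipschitz _ _ 1) => x y _ _; rewrite mul1r. Qed.

Lemma quad_cont_cst c : quad_cont (fun _ : R => c).
Proof.
by apply: (@quad_cont_lipschitz _ _ 0) => x y _ _; rewrite mul0r subrr normr0.
Qed.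

Lemma quad_cont_add f g : quad_cont f -> quad_cont g ->
  quad_cont (fun x => f x + g x).
Proof.
move=> fc gc e e0; have e2 : 0 < e / 2 by rewrite divr_gt0.
have [M M0 hM] := fc _ e2; have [N N0 hN] := gc _ e2.
exists (M + N); first by rewrite addr_ge0.
move=> x y hx hy; rewrite opprD addrACA (le_trans (ler_normD _ _)) //.
by have := hM x y hx hy; have := hN x y hx hy; lra.
Qed.

Lemma quad_cont_scale c f : quad_cont f -> quad_cont (fun x => c * f x).
Proof. exact/quad_cont_mul/quad_cont_cst. Qed.

Lemma quad_cont_opp f : quad_cont f -> quad_cont (fun x => - f x).
Proof.
move=> fc; have := quad_cont_scale (-1) fc.
by congr quad_cont; apply/funext => x; rewrite mulN1r.
Qed.

End QuadContAlgebra.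

(** * Functional calculus *)

Section Calculus.
Context {R : realType} {X : hilbertType R}.

Definition positive_contraction (A : X -> X) :=
  [/\ symmetric_op A, forall x, 0 <= inner (A x) x & forall x, `|A x| <= `|x|].

Variable A : X -> X.
Hypothesis Apc : positive_contraction A.
Implicit Types (f g : R -> R) (B C : X -> X) (l : R).

Let As : symmetric_op A. Proof. by case: Apc. Qed.
Let AL := symmetric_linear As.
Let Abnd : exists2 c : R, 0 <= c & forall x, `|A x| <= c * `|x|.
Proof. by exists 1 => // x; rewrite mul1r; case: Apc => _ _; apply. Qed.
Local Notation P p := (op_horner p A).

Lemma shift_symmetric l : symmetric_op (fun x => A x - l *: x).
Proof. by move=> x y; rewrite !innerE As. Qed.

Lemma spectrum_itv l : spectrum A l -> 0 <= l <= 1.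
Proof.
case: Apc => _ Apos Ac.
move=> Sl; apply/andP; split; rewrite leNgt; apply/negP => hl; apply: Sl.
- have l0 : 0 < - l by rewrite oppr_gt0.
  apply: (symmetric_bounded_inverse (@shift_symmetric l) l0) => x.
  have [->|x0] := eqVneq x 0; first by rewrite normr0 mulr0.
  have xp : 0 < `|x| by rewrite normr_gt0.
  rewrite -(ler_pM2r xp) (le_trans _ (CauchySchwarz_inner _ _)) //.
  by rewrite innerBl innerZl -sqr_norm_inner -mulrA -expr2 mulNr lerDr.
- have l0 : 0 < l - 1 by rewrite subr_gt0.
  apply: (symmetric_bounded_inverse (@shift_symmetric l) l0) => x.
  rewrite mulrBl mul1r lerBlDr -normrN opprB.
  have l1 : 0 < l by rewrite (lt_trans _ hl).
  rewrite -[X in X * _]gtr0_norm // -normrZ -{1}(subrK (A x) (l *: x)).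
  by rewrite (le_trans (ler_normD _ _)) // lerD2l.
Qed.

Lemma calculus_norm f B c : is_fun_calculus A f B -> 0 <= c ->
  (forall l, 0 <= l <= 1 -> `|f l| <= c) -> forall x, `|B x| <= c * `|x|.
Proof.
move=> fB c0 hf x; apply/ler_addgt0Pr => e e0.
have k0 : 0 < 2 * (`|x| + 1) by rewrite mulr_gt0 // ltr_wpDl.
have d0 : 0 < e / (2 * (`|x| + 1)) by rewrite divr_gt0.
have [p [hp hB]] := fB _ d0; set d := e / _ in d0 hp hB.
have de : d * (2 * (`|x| + 1)) = e by rewrite divfK // gt_eqF.
have cd0 : 0 <= c + d by rewrite addr_ge0 // ltW.
have ph l : spectrum A l -> `|p.[l]| <= c + d.
  move=> Sl; rewrite -(subrK (f l) p.[l]) addrC (le_trans (ler_normD _ _)) //.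
  by rewrite lerD ?hp // hf // spectrum_itv.
have := op_horner_norm_le As Abnd cd0 ph x; have := hB x.
rewrite -[in X in _ -> _ -> `|X| <= _](subrK (P p x) (B x)) distrC => a1 a2.
by rewrite (le_trans (ler_normD _ _)) //; have := normr_ge0 x; nra.
Qed.

Lemma calculus_unique f B C :
  is_fun_calculus A f B -> is_fun_calculus A f C -> B = C.
Proof.
move=> fB fC; apply/funext => x; apply: eq_of_approx => e e0.
have k0 : 0 < 4 * (`|x| + 1) by rewrite mulr_gt0 // ltr_wpDl.
have d0 : 0 < e / (4 * (`|x| + 1)) by rewrite divr_gt0.
have [p [hp hB]] := fB _ d0; have [q [hq hC]] := fC _ d0.
set d := e / _ in d0 hp hB hq hC.
have de : d * (4 * (`|x| + 1)) = e by rewrite divfK // gt_eqF.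
have pq l : spectrum A l -> `|(p - q).[l]| <= d + d.
  move=> Sl; rewrite hornerD hornerN -(subrK (f l) p.[l]) -addrA.
  by rewrite (le_trans (ler_normD _ _)) // lerD ?hp // distrC hq.
have dd : 0 <= d + d by rewrite addr_ge0 // ltW.
have := op_horner_norm_le As Abnd dd pq x; have := hB x; have := hC x.
rewrite op_hornerB => a1 a2 a3.
have -> : B x - C x = - (P p x - B x) + (P p x - P q x) + (P q x - C x).
  by rewrite opprB !addrA !subrK.
rewrite (le_trans (ler_normD _ _)) // (le_trans (lerD (ler_normD _ _) (lexx _))) //.
by rewrite normrN; have := normr_ge0 x; nra.
Qed.

Lemma calculus_sym f B : is_fun_calculus A f B -> symmetric_op B.
Proof.
move=> fB x y; apply: (@eq_of_approx _ R^o) => e e0.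
have k0 : 0 < 2 * (`|x| * `|y| + 1) by rewrite mulr_gt0 // ltr_wpDl // mulr_ge0.
have d0 : 0 < e / (2 * (`|x| * `|y| + 1)) by rewrite divr_gt0.
have [p [_ hB]] := fB _ d0; set d := e / _ in d0 hB.
have de : d * (2 * (`|x| * `|y| + 1)) = e by rewrite divfK // gt_eqF.
have -> : inner (B x) y - inner x (B y) =
   - inner (P p x - B x) y + inner x (P p y - B y).
  by rewrite innerBl innerBr (op_horner_sym As); ring.
rewrite (le_trans (ler_normD _ _)) // normrN.
have a1 := CauchySchwarz_abs (P p x - B x) y.
have a2 := CauchySchwarz_abs x (P p y - B y).
have a3 : `|P p x - B x| * `|y| <= d * (`|x| * `|y|).
  by rewrite mulrA ler_wpM2r.
have a4 : `|x| * `|P p y - B y| <= d * (`|x| * `|y|).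
  by rewrite mulrCA ler_wpM2l.
lra.
Qed.

Lemma calculus_horner p : is_fun_calculus A (horner p) (P p).
Proof.
move=> e e0; exists p; split=> [l _|x]; rewrite subrr normr0 ?(ltW e0) //.
by rewrite mulr_ge0 // ltW.
Qed.

Lemma calculus_add f g B C : is_fun_calculus A f B -> is_fun_calculus A g C ->
  is_fun_calculus A (fun l => f l + g l) (fun x => B x + C x).
Proof.
move=> fB gC e e0; have e2 : 0 < e / 2 by rewrite divr_gt0.
have [p [hp hB]] := fB _ e2; have [q [hq hC]] := gC _ e2.
exists (p + q); split=> [l Sl|x].
  rewrite hornerD opprD addrACA (le_trans (ler_normD _ _)) //.
  by have := hp l Sl; have := hq l Sl; lra.
rewrite op_hornerD opprD addrACA (le_trans (ler_normD _ _)) //.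
by have := hB x; have := hC x; lra.
Qed.

Lemma calculus_mul f g B C : quad_cont f -> quad_cont g ->
  is_fun_calculus A f B -> is_fun_calculus A g C ->
  is_fun_calculus A (fun l => f l * g l) (fun x => B (C x)).
Proof.
move=> fc gc fB gC e e0.
have [a a0 ha] := quad_cont_bounded fc; have [b b0 hb] := quad_cont_bounded gc.
have hBn := calculus_norm fB a0 ha; have hCn := calculus_norm gC b0 hb.
have k0 : 0 < a + b + 1 by rewrite ltr_wpDl // addr_ge0.
pose d := Num.min 1 (e / (a + b + 1)).
have d0 : 0 < d by rewrite lt_min ltr01 divr_gt0.
have d1 : d <= 1 by rewrite ge_min lexx.
have de : d * (a + b + 1) <= e by rewrite -ler_pdivlMr // ge_min lexx orbT.
have [p [hp hB]] := fB _ d0; have [q [hq hC]] := gC _ d0.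
exists (p * q); split=> [l Sl|x].
  have l01 := spectrum_itv Sl.
  have -> : (p * q).[l] - f l * g l =
     (p.[l] - f l) * (q.[l] - g l) + (p.[l] - f l) * g l + f l * (q.[l] - g l).
    by rewrite hornerM; ring.
  rewrite (le_trans (ler_normD _ _)) // (le_trans (lerD (ler_normD _ _) (lexx _))) //.
  rewrite !normrM.
  have a1 : `|p.[l] - f l| * `|q.[l] - g l| <= d * 1.
    by apply: ler_pM => //; [exact: hp | exact: le_trans (hq _ Sl) d1].
  have a2 : `|p.[l] - f l| * `|g l| <= d * b.
    by apply: ler_pM => //; [exact: hp | exact: hb].
  have a3 : `|f l| * `|q.[l] - g l| <= a * d.
    by apply: ler_pM => //; [exact: ha | exact: hq].
  lra.
have pd l : spectrum A l -> `|p.[l]| <= a + d.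
  move=> Sl; rewrite -(subrK (f l) p.[l]) addrC (le_trans (ler_normD _ _)) //.
  by rewrite lerD ?hp // ha // spectrum_itv.
have ad : 0 <= a + d by rewrite addr_ge0 // ltW.
rewrite (op_hornerM As).
have -> : P p (P q x) - B (C x) = P p (P q x - C x) + (P p (C x) - B (C x)).
  by rewrite (linfB (symmetric_linear (op_horner_sym As p))) addrA subrK.
rewrite (le_trans (ler_normD _ _)) //.
have a1 : `|P p (P q x - C x)| <= (a + d) * (d * `|x|).
  by rewrite (le_trans (op_horner_norm_le As Abnd ad pd _)) // ler_wpM2l.
have a2 : `|P p (C x) - B (C x)| <= d * (b * `|x|).
  by rewrite (le_trans (hB _)) // ler_wpM2l // ltW.
have a3 : d * (a + b + 1) * `|x| <= e * `|x| by rewrite ler_wpM2r.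
have a4 : d * d * `|x| <= d * 1 * `|x| by rewrite ler_wpM2r // ler_wpM2l // ltW.
lra.
Qed.

(** The polynomials approximating [f] form a Cauchy sequence in the operator
    norm, by the bound of [q(A)] on the spectrum. *)
Lemma calculus_exists f : quad_cont f -> exists B, is_fun_calculus A f B.
Proof.
move=> fc.
have r0 n : 0 < n.+1%:R^-1 :> R by rewrite invr_gt0 ltr0n.
have [p hp] : {p : nat -> {poly R} & forall n x, 0 <= x <= 1 ->
    `|(p n).[x] - f x| <= n.+1%:R^-1}.
  apply: (@choice _ _ (fun n p => forall x, 0 <= x <= 1 -> `|p.[x] - f x| <= n.+1%:R^-1)).
  by move=> n; have [p hp] := quad_cont_bernstein fc (r0 n); exists p.
have rsmall (e : R) : 0 < e -> exists N, forall n, (N <= n)%N -> n.+1%:R^-1 <= e.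
  move=> e0; exists (Num.truncn e^-1) => n Nn.
  rewrite invf_ple ?posrE ?ltr0n // ltW //.
  by apply: lt_le_trans (truncnS_gt _) _; rewrite ler_nat ltnS.
have pmn m n x : `|P (p m) x - P (p n) x| <= (m.+1%:R^-1 + n.+1%:R^-1) * `|x|.
  rewrite -op_hornerB; apply: (op_horner_norm_le As Abnd).
    by rewrite addr_ge0 // ltW.
  move=> l /spectrum_itv l01; rewrite hornerD hornerN -(subrK (f l) (p m).[l]) -addrA.
  by rewrite (le_trans (ler_normD _ _)) // lerD ?hp // distrC hp.
have lim x : exists y, forall e : R, 0 < e -> exists N, forall n, (N <= n)%N ->
    `|P (p n) x - y| <= e.
  apply: cauchy_limit => e e0.
  have k0 : 0 < 2 * (`|x| + 1) by rewrite mulr_gt0 // ltr_wpDl.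
  have d0 : 0 < e / (2 * (`|x| + 1)) by rewrite divr_gt0.
  have [N hN] := rsmall _ d0; exists N => m n Nm Nn.
  rewrite (le_trans (pmn m n x)) //.
  set d := e / _ in d0 hN *.
  have de : d * (2 * (`|x| + 1)) = e by rewrite divfK // gt_eqF.
  have : (m.+1%:R^-1 + n.+1%:R^-1) * `|x| <= (d + d) * `|x|.
    by rewrite ler_wpM2r // lerD // hN.
  by clearbody d; move=> H; rewrite (le_trans H) // -de; lra.
have [B hB] := choice lim; exists B => e e0.
have e2 : 0 < e / 2 by rewrite divr_gt0.
have [N hN] := rsmall _ e2; exists (p N); split=> [l /spectrum_itv l01|x].
  by rewrite (le_trans (hp _ _ l01)) // (le_trans (hN _ (leqnn _))) //; lra.
apply/ler_addgt0Pr => d d0; have [M hM] := hB x d d0.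
pose n := maxn N M.
have := hM n (leq_maxr _ _); have := pmn N n x.
have := hN _ (leqnn N); have := hN n (leq_maxl _ _).
move=> a1 a2 a3 a4; rewrite -(subrK (P (p n) x) (P (p N) x)) -addrA.
rewrite (le_trans (ler_normD _ _)) //.
have : (N.+1%:R^-1 + n.+1%:R^-1) * `|x| <= (e / 2 + e / 2) * `|x|.
  by rewrite ler_wpM2r // lerD.
move=> a5; have a6 := le_trans a3 a5; lra.
Qed.

Lemma fun_calculusP f : quad_cont f -> is_fun_calculus A f (fun_calculus A f).
Proof.
by move=> fc; apply: (getPex (P := [set B | is_fun_calculus A f B])); exact: calculus_exists.
Qed.

Local Notation Phi := (fun_calculus A).

Lemma fun_calculus_eq f g : (forall l, 0 <= l <= 1 -> f l = g l) -> Phi f = Phi g.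
Proof.
move=> fg; rewrite /fun_calculus; congr get; apply/seteqP.
split=> B fB e e0; have [p [hp hB]] := fB e e0; exists p; split=> // l Sl.
  by rewrite -fg ?hp //; apply: spectrum_itv.
by rewrite fg ?hp //; apply: spectrum_itv.
Qed.

Lemma fun_calculus_norm f (c : R) : quad_cont f -> 0 <= c ->
  (forall l, 0 <= l <= 1 -> `|f l| <= c) -> forall x, `|Phi f x| <= c * `|x|.
Proof. by move=> fc; apply: calculus_norm; apply: fun_calculusP. Qed.

Lemma fun_calculus_sym f : quad_cont f -> symmetric_op (Phi f).
Proof. by move=> fc; apply/calculus_sym/fun_calculusP. Qed.

Lemma fun_calculus_linear f : quad_cont f -> linear (Phi f).
Proof. by move=> fc; apply/symmetric_linear/fun_calculus_sym. Qed.

Lemma fun_calculus_cst (c : R) x : Phi (fun=> c) x = c *: x.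
Proof.
rewrite -(@op_hornerC _ _ A); congr (_ x).
apply: (@calculus_unique (fun=> c)); first exact/fun_calculusP/quad_cont_cst.
have -> : (fun=> c) = horner c%:P by apply/funext => l; rewrite hornerC.
exact: calculus_horner.
Qed.

Lemma fun_calculus_id : Phi (fun l => l) = A.
Proof.
apply: (@calculus_unique (fun l => l)); first exact/fun_calculusP/quad_cont_id.
have -> : (fun l : R => l) = horner 'X by apply/funext => l; rewrite hornerX.
have AX : A = P 'X by apply/funext => x; rewrite op_hornerX.
by rewrite {2}AX; exact: calculus_horner.
Qed.

Lemma fun_calculusD f g x : quad_cont f -> quad_cont g ->
  Phi (fun l => f l + g l) x = Phi f x + Phi g x.
Proof.
move=> fc gc; suff -> : Phi (fun l => f l + g l) = fun x => Phi f x + Phi g x by [].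
apply: calculus_unique; first exact/fun_calculusP/quad_cont_add.
by apply: calculus_add; apply: fun_calculusP.
Qed.

Lemma fun_calculusM f g x : quad_cont f -> quad_cont g ->
  Phi (fun l => f l * g l) x = Phi f (Phi g x).
Proof.
move=> fc gc; suff -> : Phi (fun l => f l * g l) = fun x => Phi f (Phi g x) by [].
apply: calculus_unique; first exact/fun_calculusP/quad_cont_mul.
by apply: calculus_mul => //; apply: fun_calculusP.
Qed.

Lemma fun_calculusZ (c : R) f x : quad_cont f ->
  Phi (fun l => c * f l) x = c *: Phi f x.
Proof.
move=> fc; rewrite (fun_calculusM _ (quad_cont_cst c) fc).
by rewrite fun_calculus_cst.
Qed.

Lemma fun_calculusB f g x : quad_cont f -> quad_cont g ->
  Phi (fun l => f l - g l) x = Phi f x - Phi g x.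
Proof.
move=> fc gc; rewrite (fun_calculusD _ fc (quad_cont_opp gc)); congr (_ + _).
rewrite -scaleN1r -fun_calculusZ //; congr (_ x); apply: fun_calculus_eq => l _.
by rewrite mulN1r.
Qed.

Lemma fun_calculus_comm f g x : quad_cont f -> quad_cont g ->
  Phi f (Phi g x) = Phi g (Phi f x).
Proof.
move=> fc gc; rewrite -!fun_calculusM //; congr (_ x).
by apply: fun_calculus_eq => l _; rewrite mulrC.
Qed.

(** If [0 <= f <= c] then [c - f] is bounded by [c], so that [c - f(A)] has
    norm at most [c]. *)
Lemma fun_calculus_ge0 f x : quad_cont f ->
  (forall l, 0 <= l <= 1 -> 0 <= f l) -> 0 <= inner (Phi f x) x.
Proof.
move=> fc f0; have [c c0 hc] := quad_cont_bounded fc.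
have gc := quad_cont_add (quad_cont_cst c) (quad_cont_opp fc).
have hg l : 0 <= l <= 1 -> `|c - f l| <= c.
  move=> l01; have := hc l l01; have := f0 l l01.
  by rewrite !ler_norml => a1 /andP[a2 a3]; apply/andP; split; lra.
have := fun_calculus_norm gc c0 hg x.
rewrite fun_calculusB ?fun_calculus_cst //; last exact: quad_cont_cst.
have := CauchySchwarz_inner (c *: x - Phi f x) x.
rewrite innerBl innerZl -sqr_norm_inner => a1 a2.
have : `|c *: x - Phi f x| * `|x| <= c * `|x| * `|x| by rewrite ler_wpM2r.
by lra.
Qed.

Lemma fun_calculus_le f g x : quad_cont f -> quad_cont g ->
  (forall l, 0 <= l <= 1 -> f l <= g l) ->
  inner (Phi f x) x <= inner (Phi g x) x.
Proof.
move=> fc gc fg; rewrite -subr_ge0 -innerBl -fun_calculusB //.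
apply: fun_calculus_ge0 => [|l l01]; first exact/quad_cont_add/quad_cont_opp.
by rewrite subr_ge0 fg.
Qed.

End Calculus.

(** * The inner schemes *)

Section EulerFunctions.
Context {R : realType}.
Implicit Types (h l t s : R) (k : nat).

(** The filter function of [k] implicit Euler steps of length [h] for
    [u' = T^* (b - T u)]. *)
Fixpoint euler h k l : R :=
  if k is j.+1 then (euler h j l + h) / (1 + h * l) else 0.

Lemma euler_den h l : 0 <= h -> 0 <= l -> 0 < 1 + h * l.
Proof. by move=> h0 l0; rewrite ltr_wpDr // mulr_ge0. Qed.

Lemma quad_cont_inv h : 0 <= h -> quad_cont (fun l => (1 + h * l)^-1).
Proof.
move=> h0; apply: (@quad_cont_lipschitz _ _ h) => x y /andP[x0 _] /andP[y0 _].
have dx := euler_den h0 x0; have dy := euler_den h0 y0.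
have -> : (1 + h * x)^-1 - (1 + h * y)^-1 =
    h * (y - x) * ((1 + h * x)^-1 * (1 + h * y)^-1).
  by field; rewrite !gt_eqF.
rewrite !normrM (ger0_norm h0) distrC -[leRHS]mulr1 ler_wpM2l ?mulr_ge0 //.
rewrite -normrM ger0_norm ?mulr_ge0 ?invr_ge0 ?(ltW dx) ?(ltW dy) //.
by rewrite -invfM invf_le1 ?mulr_gt0 // mulr_ege1 // lerDl mulr_ge0.
Qed.

Lemma quad_cont_euler h k : 0 <= h -> quad_cont (euler h k).
Proof.
move=> h0; elim: k => [|k IH]; first exact: quad_cont_cst.
apply: quad_cont_mul; last exact: quad_cont_inv.
by apply: quad_cont_add => //; exact: quad_cont_cst.
Qed.

Lemma euler_residual h k l : 0 <= h -> 0 <= l ->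
  1 - l * euler h k l = (1 + h * l) ^- k.
Proof.
move=> h0 l0; have d := euler_den h0 l0.
elim: k => [|k IH]; first by rewrite mulr0 subr0 expr0 invr1.
rewrite exprS invfM -IH /=; field; by rewrite gt_eqF.
Qed.

(** The filter function of [k] steps of Landweber iteration. *)
Fixpoint landweber k l : R :=
  if k is j.+1 then landweber j l + (1 - l * landweber j l) else 0.

Lemma quad_cont_landweber k : quad_cont (landweber k).
Proof.
elim: k => [|k IH]; first exact: quad_cont_cst.
apply: quad_cont_add => //; apply: quad_cont_add; first exact: quad_cont_cst.
by apply: quad_cont_opp; apply: quad_cont_mul => //; exact: quad_cont_id.
Qed.

Lemma scheme_landweber t l : scheme_fun Landweber t l = landweber (Num.truncn t) l.
Proof.
rewrite /=; elim: (Num.truncn t) => [|k IH]; first by rewrite big_geq.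
rewrite big_nat_recr //= IH; congr (_ + _).
elim: k {IH} => [|k IH]; first by rewrite expr0 mulr0 subr0.
by rewrite exprS IH /=; ring.
Qed.

Lemma scheme_implicit t l : 0 <= l ->
  scheme_fun Implicit t l = euler 1 (Num.truncn t) l.
Proof.
move=> l0; have d : 0 < 1 + l by rewrite ltr_wpDr.
rewrite /=; elim: (Num.truncn t) => [|k IH]; first by rewrite big_geq.
rewrite big_nat_recr //= IH.
have := @euler_residual 1 k l ler01 l0; rewrite !mul1r => E.
rewrite exprS invfM -E; field; by rewrite gt_eqF.
Qed.

Lemma scheme_tikhonov t l : 0 < t -> 0 <= l ->
  scheme_fun Tikhonov t l = euler t 1 l.
Proof.
move=> t0 l0; have d := euler_den (ltW t0) l0.
rewrite /= add0r; field; rewrite !gt_eqF // addrC; exact: d.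
Qed.

Lemma expr_diff_le (a b : R) k : 0 <= b -> b <= a -> a <= 1 ->
  a ^+ k - b ^+ k <= k%:R * (a - b).
Proof.
move=> b0 ba a1; have a0 := le_trans b0 ba.
elim: k => [|k IH]; first by rewrite !expr0 subrr mul0r.
have -> : a ^+ k.+1 - b ^+ k.+1 = a * (a ^+ k - b ^+ k) + (a - b) * b ^+ k.
  by rewrite !exprS; ring.
rewrite -natr1 [leRHS]mulrDl mul1r lerD //.
  rewrite (le_trans _ IH) // -[leRHS]mul1r ler_wpM2r // subr_ge0.
  by rewrite lerXn2r ?nnegrE.
by rewrite -[leRHS]mulr1 ler_wpM2l ?subr_ge0 // exprn_ile1 // (le_trans ba).
Qed.

(** [exp (- t l)] is the limit of [(1 + t l / k)^-k] with an error of order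
    [(t l)^2 / k]; the division by [l] leaves a bound uniform on [0, 1]. *)
Lemma scheme_asymptotic t l k : 0 < t -> 0 <= l <= 1 ->
  `|euler (t / k.+1%:R) k.+1 l - scheme_fun Asymptotic t l| <= t ^+ 2 / k.+1%:R.
Proof.
move=> t0 /andP[l0 l1]; rewrite [scheme_fun _ _ _]/=.
have n0 : 0 < k.+1%:R :> R by rewrite ltr0n.
set n : R := k.+1%:R in n0 *; set h := t / n.
have h0 : 0 < h by rewrite divr_gt0.
have hn : n * h = t by rewrite mulrC divfK // gt_eqF.
have [->|lN0] := eqVneq l 0.
  have -> : euler h k.+1 0 = n * h.
    rewrite /n; elim: (k.+1) => [|j IH]; first by rewrite mul0r.
    by rewrite /= IH mulr0 addr0 divr1 -natr1 mulrDl mul1r.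
  by rewrite hn subrr normr0 divr_ge0 ?sqr_ge0 // ltW.
have lp : 0 < l by rewrite lt0r lN0.
have E := @euler_residual h k.+1 l (ltW h0) l0.
have -> : euler h k.+1 l = l^-1 * (1 - (1 + h * l) ^- k.+1).
  by rewrite -E; field.
rewrite -mulrBr normrM gtr0_norm ?invr_gt0 // ler_pdivrMl //.
rewrite opprB addrC addrA subrK.
have -> : expR (- (t * l)) = expR (- (h * l)) ^+ k.+1.
  by rewrite -expRM_natl -hn /n; congr expR; ring.
rewrite -exprVn.
set x := h * l; have x0 : 0 < x by rewrite mulr_gt0.
have d : 0 < 1 + x by rewrite ltr_wpDr // ltW.
have ba : expR (- x) <= (1 + x)^-1.
  by rewrite expRN lef_pV2 ?posrE ?expR_gt0 // expR_ge1Dx.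
have a1 : (1 + x)^-1 <= 1 by rewrite invf_le1 // lerDl ltW.
have b0 : 0 <= expR (- x) by rewrite expR_ge0.
have ab : (1 + x)^-1 - expR (- x) <= x ^+ 2.
  have bx := expR_ge1Dx (- x).
  rewrite lerBlDr (le_trans _ (lerD (lexx _) bx)) //.
  rewrite -(ler_pM2r d) mulVf ?gt_eqF //.
  have -> : (x ^+ 2 + (1 - x)) * (1 + x) = 1 + x ^+ 3 by ring.
  by rewrite lerDl exprn_ge0 // ltW.
rewrite distrC ger0_norm; last by rewrite subr_ge0 lerXn2r ?nnegrE ?invr_ge0 ?(ltW d).
rewrite (le_trans (expr_diff_le _ b0 ba a1)) //.
rewrite (le_trans (ler_wpM2l (ltW n0) ab)) //.
have -> : n * x ^+ 2 = t ^+ 2 / n * l ^+ 2.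
  by rewrite /x /h; field; rewrite gt_eqF.
rewrite mulrC ler_wpM2r ?divr_ge0 ?sqr_ge0 ?(ltW n0) //.
by rewrite expr2 -[leRHS]mulr1 ler_wpM2l.
Qed.

(** Only completed steps of the discrete schemes count as elapsed inner time. *)
Definition scheme_time (m : inner_scheme) t : R :=
  match m with
  | Landweber | Implicit => (Num.truncn t)%:R
  | Asymptotic | Tikhonov => t
  end.

Lemma scheme_time_le m t : 0 <= t -> 0 <= scheme_time m t <= t.
Proof.
by move=> t0; case: m => /=; rewrite ?t0 ?lexx // ler0n /= truncn_le ?t0.
Qed.

Lemma scheme_euler_approx m t (e : R) : m <> Landweber -> 0 < t -> 0 < e ->
  exists h k, [/\ 0 <= h, h * k%:R = scheme_time m t &
    forall l, 0 <= l <= 1 -> `|euler h k l - scheme_fun m t l| <= e].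
Proof.
move=> mL t0 e0; case: m mL => // _.
- exists 1, (Num.truncn t); rewrite mul1r; split=> // l /andP[l0 _].
  by rewrite scheme_implicit // subrr normr0 ltW.
- pose k := Num.truncn (t ^+ 2 / e).
  exists (t / k.+1%:R), k.+1; split; first by rewrite divr_ge0 // ltW.
    by rewrite divfK // pnatr_eq0.
  move=> l l01; rewrite (le_trans (scheme_asymptotic _ t0 l01)) //.
  by rewrite ler_pdivrMr ?ltr0n // mulrC -ler_pdivrMr // ltW // truncnS_gt.
- exists t, 1%N; rewrite mulr1; split; rewrite ?ltW // => l /andP[l0 _].
  by rewrite scheme_tikhonov // subrr normr0 ltW.
Qed.

Lemma quad_cont_scheme m t : 0 < t -> quad_cont (scheme_fun m t).
Proof.
move=> t0; apply: quad_cont_limit => e e0; case: (pselect (m = Landweber)) => [->|mL].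
  exists (landweber (Num.truncn t)); first exact: quad_cont_landweber.
  by move=> l _; rewrite scheme_landweber subrr normr0 ltW.
have [h [k [h0 _ hk]]] := scheme_euler_approx mL t0 e0.
by exists (euler h k) => //; exact: quad_cont_euler.
Qed.

Lemma scheme_lipschitz m t s l : m = Asymptotic \/ m = Tikhonov ->
  0 < s -> s <= t -> 0 <= l -> `|scheme_fun m t l - scheme_fun m s l| <= t - s.
Proof.
move=> mE s0 st l0; have t0 := lt_le_trans s0 st.
case: mE => ->; last first.
  rewrite !scheme_tikhonov //= !add0r.
  have ds := euler_den (ltW s0) l0; have dt := euler_den (ltW t0) l0.
  have -> : t / (1 + t * l) - s / (1 + s * l) =
      (t - s) * ((1 + t * l)^-1 * (1 + s * l)^-1) by field; rewrite !gt_eqF.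
  rewrite normrM ger0_norm ?subr_ge0 // -[leRHS]mulr1 ler_wpM2l ?subr_ge0 //.
  rewrite ger0_norm ?mulr_ge0 ?invr_ge0 ?(ltW ds) ?(ltW dt) //.
  by rewrite -invfM invf_le1 ?mulr_gt0 // mulr_ege1 // lerDl mulr_ge0 // ltW.
rewrite /=; case: eqVneq => [_|lN0]; first by rewrite ger0_norm ?subr_ge0.
have lp : 0 < l by rewrite lt0r lN0.
rewrite -mulrBr normrM gtr0_norm ?invr_gt0 // ler_pdivrMl //.
have -> : - (t * l) = - (s * l) + - (l * (t - s)) by ring.
rewrite expRD; set a := expR _; set b := expR _.
have -> : 1 - a * b - (1 - a) = a * (1 - b) by ring.
have a0 : 0 <= a by rewrite expR_ge0.
have a1 : a <= 1 by rewrite /a -expR0 ler_expR oppr_le0 mulr_ge0 // ltW.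
have b1 : 0 <= 1 - b.
  by rewrite subr_ge0 /b -expR0 ler_expR oppr_le0 mulr_ge0 // subr_ge0.
have b2 : 1 - b <= l * (t - s).
  by have := expR_ge1Dx (- (l * (t - s))); rewrite -/b; lra.
by rewrite ger0_norm ?mulr_ge0 // (le_trans _ b2) // -[leRHS]mul1r ler_wpM2r.
Qed.

End EulerFunctions.

Section LinearInner.
Context {R : realType} {X Y : hilbertType R}.
Variable T : {linear X -> Y}.
Hypothesis Tc : forall x, `|T x| <= `|x|.
Local Notation Ts := (adjoint T).
Local Notation A := (adjoint T \o T).
Implicit Types (x u : X) (b r y : Y) (f g : R -> R) (h d : R) (k : nat).

Lemma adjE x y : inner (T x) y = inner x (Ts y).
Proof.
apply: (@adjointP _ _ _ T 1) => //; first by move=> a u v; rewrite linearP.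
by move=> u; rewrite mul1r.
Qed.

Lemma adj_linear : linear Ts.
Proof.
move=> a y z; apply: inner_ext => x.
by rewrite innerC -adjE !innerE !adjE !(innerC x).
Qed.

Lemma adj_norm y : `|Ts y| <= `|y|.
Proof.
have [->|y0] := eqVneq (Ts y) 0; first by rewrite normr0.
have yp : 0 < `|Ts y| by rewrite normr_gt0.
rewrite -(ler_pM2l yp) -expr2 sqr_norm_inner -adjE.
by rewrite (le_trans (CauchySchwarz_inner _ _)) // ler_wpM2r.
Qed.

Lemma normal_op_contraction : positive_contraction A.
Proof.
split=> [x z|x|x] /=.
- by rewrite innerC -adjE innerC adjE.
- by rewrite innerC -adjE -sqr_norm_inner sqr_ge0.
- by rewrite (le_trans (adj_norm _)).
Qed.
Let Apc := normal_op_contraction.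

Lemma inner_normal_op x : inner (A x) x = `|T x| ^+ 2.
Proof. by rewrite /= innerC -adjE -sqr_norm_inner. Qed.

Definition filtered f b : X := fun_calculus A f (Ts b).

Lemma filtered_dist f g d b : quad_cont f -> quad_cont g -> 0 <= d ->
  (forall l, 0 <= l <= 1 -> `|f l - g l| <= d) ->
  `|filtered f b - filtered g b| <= d * `|b|.
Proof.
move=> fc gc d0 fg; rewrite -fun_calculusB //.
have := fun_calculus_norm Apc (quad_cont_add fc (quad_cont_opp gc)) d0 fg (Ts b).
by move=> H; rewrite (le_trans H) // ler_wpM2l // adj_norm.
Qed.

Lemma filtered0 b : filtered (fun=> 0) b = 0.
Proof. by rewrite /filtered (fun_calculus_cst Apc) scale0r. Qed.

(** The operator form of [(1 + h l) euler h k.+1 l = euler h k l + h]. *)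
Lemma filtered_euler h k b : 0 <= h ->
  filtered (euler h k.+1) b = filtered (euler h k) b +
    h *: Ts (b - T (filtered (euler h k.+1) b)).
Proof.
move=> h0; have ck := quad_cont_euler k h0; have ck1 := quad_cont_euler k.+1 h0.
have cl := quad_cont_mul (@quad_cont_id R) ck1.
have E : fun_calculus A (fun l => euler h k.+1 l + h * (l * euler h k.+1 l)) =
         fun_calculus A (fun l => euler h k l + h).
  apply: (fun_calculus_eq Apc) => l /andP[l0 _] /=.
  by field; rewrite gt_eqF // euler_den.
have := congr1 (fun B => B (Ts b)) E; rewrite (fun_calculusD Apc _ ck1); last first.
  exact: quad_cont_scale.
rewrite (fun_calculusZ Apc _ _ cl) (fun_calculusM Apc _ (@quad_cont_id R) ck1).
rewrite (fun_calculusD Apc _ ck (quad_cont_cst h)) (fun_calculus_cst Apc).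
rewrite (fun_calculus_id Apc) /= -/(filtered (euler h k) b).
rewrite -/(filtered (euler h k.+1) b) => {}E.
by rewrite (linfB adj_linear) scalerBr addrA -E addrK.
Qed.

Lemma filtered_landweber k b :
  filtered (landweber k.+1) b = filtered (landweber k) b +
    Ts (b - T (filtered (landweber k) b)).
Proof.
have ck := @quad_cont_landweber R k.
have cl := quad_cont_mul (@quad_cont_id R) ck.
rewrite /filtered /= (fun_calculusD Apc _ ck); last first.
  exact: quad_cont_add (quad_cont_cst 1) (quad_cont_opp cl).
rewrite (fun_calculusB Apc _ (quad_cont_cst 1) cl) (fun_calculus_cst Apc) scale1r.
rewrite (fun_calculusM Apc _ (@quad_cont_id R) ck) (fun_calculus_id Apc) /=.
by rewrite (linfB adj_linear).
Qed.

Lemma implicit_residualE h u u' b : u' = u + h *: Ts (b - T u') ->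
  b - T u = (b - T u') + h *: T (Ts (b - T u')).
Proof.
move=> E; have -> : h *: T (Ts (b - T u')) = T (u' - u).
  by rewrite {2}E [u + _]addrC addrK linearZ.
by rewrite linearB addrA subrK.
Qed.

Lemma implicit_residual_le h u u' b : 0 <= h ->
  u' = u + h *: Ts (b - T u') -> `|b - T u'| <= `|b - T u|.
Proof.
move=> h0 /implicit_residualE ->; set r := b - T u'.
apply: le_of_sqr => //; rewrite (sqnormD r) innerZr innerC adjE -sqr_norm_inner.
by rewrite -addrA lerDl addr_ge0 ?sqr_ge0 // mulr_ge0 // mulr_ge0 ?sqr_ge0.
Qed.

Lemma implicit_residual_ge h u u' b : 0 <= h ->
  u' = u + h *: Ts (b - T u') -> `|b - T u| <= (1 + h) * `|b - T u'|.
Proof.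
move=> h0 /implicit_residualE ->; set r := b - T u'.
rewrite (le_trans (ler_normD _ _)) // mulrDl mul1r lerD2l normrZ ger0_norm //.
by rewrite ler_wpM2l // (le_trans (Tc _)) // adj_norm.
Qed.

Lemma explicit_residual_le u b :
  `|b - T (u + Ts (b - T u))| <= `|b - T u|.
Proof.
set r := b - T u; rewrite linearD opprD addrA -/r.
apply: le_of_sqr => //; rewrite (sqnormB r) innerC adjE -sqr_norm_inner.
have : `|T (Ts r)| ^+ 2 <= `|Ts r| ^+ 2 by rewrite ler_pXn2r ?nnegrE.
by have := sqr_ge0 `|Ts r|; lra.
Qed.

Section Energy.
Variables (e : X) (b : Y) (theta : R).
Hypothesis approx : `|b + T e| <= theta * `|b|.

(** [e] is the current error, [- e] an approximate solution of [T u = b].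
    The error [e + u] decreases as long as the residual dominates [b + T e]. *)
Lemma implicit_energy h u u' : 0 <= h -> u' = u + h *: Ts (b - T u') ->
  `|e + u'| ^+ 2 <= `|e + u| ^+ 2 -
    2 * h * (`|b - T u'| * (`|b - T u'| - theta * `|b|)).
Proof.
move=> h0 E; set r := b - T u'.
have -> : e + u = (e + u') - h *: Ts r by rewrite {1}E -/r addrA addrK.
rewrite (sqnormB (e + u')) innerZr -adjE (linearD T).
have -> : T u' = b - r by rewrite /r opprB addrCA subrr addr0.
have -> : T e + (b - r) = (b + T e) - r by rewrite addrCA addrA.
rewrite innerBl -sqr_norm_inner.
have a1 : inner (b + T e) r <= theta * `|b| * `|r|.
  by rewrite (le_trans (CauchySchwarz_inner _ _)) // ler_wpM2r.
have a2 : 0 <= `|h *: Ts r| ^+ 2 by rewrite sqr_ge0.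
have a3 : h * inner (b + T e) r <= h * (theta * `|b| * `|r|) by rewrite ler_wpM2l.
lra.
Qed.

Lemma explicit_energy u :
  `|e + (u + Ts (b - T u))| ^+ 2 <= `|e + u| ^+ 2 -
    `|b - T u| * (`|b - T u| - 2 * theta * `|b|).
Proof.
set r := b - T u.
rewrite addrA (sqnormD (e + u)) -adjE (linearD T).
have -> : T u = b - r by rewrite /r opprB addrCA subrr addr0.
have -> : T e + (b - r) = (b + T e) - r by rewrite addrCA addrA.
rewrite innerBl -sqr_norm_inner.
have a1 : inner (b + T e) r <= theta * `|b| * `|r|.
  by rewrite (le_trans (CauchySchwarz_inner _ _)) // ler_wpM2r.
have a2 : `|Ts r| ^+ 2 <= `|r| ^+ 2 by rewrite ler_pXn2r ?nnegrE // adj_norm.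
clearbody r; lra.
Qed.

Lemma euler_residual_le h k : 0 <= h ->
  `|b - T (filtered (euler h k.+1) b)| <= `|b - T (filtered (euler h k) b)|.
Proof. by move=> h0; apply: (implicit_residual_le h0); exact: filtered_euler. Qed.

Lemma landweber_residual_le k :
  `|b - T (filtered (landweber k.+1) b)| <= `|b - T (filtered (landweber k) b)|.
Proof. by rewrite filtered_landweber explicit_residual_le. Qed.

Lemma euler_energy h k (s : R) : 0 <= h -> 0 <= theta -> theta <= s ->
  s * `|b| <= `|b - T (filtered (euler h k) b)| ->
  `|e + filtered (euler h k) b| ^+ 2 +
    2 * s * (s - theta) * (h * k%:R) * `|b| ^+ 2 <= `|e| ^+ 2.
Proof.
move=> h0 t0 ts; elim: k => [|k IH] res.
  by rewrite filtered0 addr0 mulr0 mulr0 mul0r addr0.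
have := IH (le_trans res (euler_residual_le k h0)).
have := implicit_energy h0 (filtered_euler k b h0).
move: res; set r := `|b - _|; set u := `|e + _|; set v := `|e + _| => res.
have b0 := normr_ge0 b; have r0 : 0 <= r by exact: normr_ge0.
have a1 : s * `|b| * ((s - theta) * `|b|) <= r * (r - theta * `|b|).
  apply: ler_pM => //; rewrite ?mulr_ge0 ?subr_ge0 //; first exact: le_trans ts.
  by rewrite mulrBl lerD2r.
have a2 := ler_wpM2l h0 a1.
have -> : h * k.+1%:R = h * k%:R + h by rewrite -natr1; ring.
clearbody r u v; move: (h * k%:R) => w; lra.
Qed.

Lemma landweber_energy k (s : R) : 0 <= theta -> 2 * theta <= s ->
  (forall j, (j < k)%N -> s * `|b| <= `|b - T (filtered (landweber j) b)|) ->
  `|e + filtered (landweber k) b| ^+ 2 +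
    s * (s - 2 * theta) * k%:R * `|b| ^+ 2 <= `|e| ^+ 2.
Proof.
move=> t0 ts; elim: k => [|k IH] res.
  by rewrite filtered0 addr0 mulr0 mul0r addr0.
have := IH (fun j jk => res j (ltnW jk)).
have := explicit_energy (filtered (landweber k) b); rewrite -filtered_landweber.
have := res k (ltnSn k).
set r := `|b - _|; set u := `|e + _|; set v := `|e + _| => {}res.
have b0 := normr_ge0 b; have r0 : 0 <= r by exact: normr_ge0.
have a1 : s * `|b| * ((s - 2 * theta) * `|b|) <= r * (r - 2 * theta * `|b|).
  apply: ler_pM => //; rewrite ?mulr_ge0 ?subr_ge0 //; first lra.
  by rewrite mulrBl lerD2r.
have kE : k.+1%:R = k%:R + 1 :> R by rewrite natr1.
rewrite kE; clearbody r u v; move: (k%:R) => w. lra.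
Qed.

End Energy.
End LinearInner.

Section InnerStop.
Context {R : realType} {X Y : hilbertType R}.
Variables (m : inner_scheme) (T : {linear X -> Y}) (b : Y) (eta : R).
Hypothesis Tc : forall x, `|T x| <= `|x|.
Hypothesis eta0 : 0 < eta.
Hypothesis eta1 : eta < 1.
Hypothesis b0 : 0 < `|b|.
Implicit Types (t s : R) (k : nat).

Definition scheme_update t : X := filtered T (scheme_fun m t) b.
Definition scheme_residual t : R := `|b - T (scheme_update t)|.

Lemma scheme_update_landweber t : m = Landweber ->
  scheme_update t = filtered T (landweber (Num.truncn t)) b.
Proof.
move=> mE; rewrite /scheme_update /filtered; congr (_ _).
apply: (fun_calculus_eq (normal_op_contraction Tc)) => l _.
by rewrite mE scheme_landweber.
Qed.

Lemma scheme_update_implicit t : m = Implicit ->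
  scheme_update t = filtered T (euler 1 (Num.truncn t)) b.
Proof.
move=> mE; rewrite /scheme_update /filtered; congr (_ _).
apply: (fun_calculus_eq (normal_op_contraction Tc)) => l /andP[l0 _].
by rewrite mE scheme_implicit.
Qed.

Definition integral_time t := (m = Landweber \/ m = Implicit) ->
  t = (Num.truncn t)%:R.

Lemma scheme_time_integral t : integral_time t -> scheme_time m t = t.
Proof.
rewrite /integral_time /scheme_time.
by case: m => //= ti; rewrite -ti //; [left | right].
Qed.

Lemma scheme_update_truncn t : m = Landweber \/ m = Implicit ->
  scheme_update (Num.truncn t)%:R = scheme_update t.
Proof.
by case=> mE; [rewrite !scheme_update_landweber // natrK
              | rewrite !scheme_update_implicit // natrK].
Qed.

Lemma scheme_update0 k : (m = Landweber \/ m = Implicit) -> k = 0%N ->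
  scheme_update k%:R = 0.
Proof.
move=> mE ->; case: mE => mE.
  by rewrite scheme_update_landweber // truncn0 (filtered0 Tc).
by rewrite scheme_update_implicit // truncn0 (filtered0 Tc).
Qed.

Definition continuous_scheme := m = Asymptotic \/ m = Tikhonov.

Lemma scheme_dichotomy : (m = Landweber \/ m = Implicit) \/ continuous_scheme.
Proof. by rewrite /continuous_scheme; case: m; tauto. Qed.

Lemma scheme_residual_lipschitz s t : continuous_scheme -> 0 < s -> s <= t ->
  `|scheme_residual t - scheme_residual s| <= (t - s) * `|b|.
Proof.
move=> mE s0 st; have t0 := lt_le_trans s0 st.
rewrite (le_trans (ler_dist_dist _ _)) // opprB addrA.
have -> : b - T (scheme_update t) + T (scheme_update s) - b =
    T (scheme_update s - scheme_update t).
  by rewrite linearB addrAC [b - _]addrC addrK addrC.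
rewrite (le_trans (Tc _)) // distrC.
apply: (filtered_dist Tc) => //; try exact: quad_cont_scheme.
  by rewrite subr_ge0.
by move=> l /andP[l0 _]; exact: scheme_lipschitz.
Qed.

Lemma scheme_residual_start t : continuous_scheme -> 0 < t ->
  (1 - t) * `|b| <= scheme_residual t.
Proof.
move=> mE t0.
have ub : `|scheme_update t| <= t * `|b|.
  rewrite -[scheme_update t]subr0 -(filtered0 Tc b).
  apply: (filtered_dist Tc) => //; first exact: quad_cont_scheme.
  - exact: quad_cont_cst.
  - exact: ltW.
  move=> l /andP[l0 l1]; rewrite subr0.
  case: mE => ->; last first.
    rewrite scheme_tikhonov //= add0r.
    have d := euler_den (ltW t0) l0.
    rewrite ger0_norm ?divr_ge0 ?(ltW t0) ?(ltW d) //.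
    by rewrite ler_pdivrMr // -[leLHS]mulr1 ler_wpM2l ?(ltW t0) // lerDl mulr_ge0 ?(ltW t0).
  rewrite /=; case: eqVneq => [_|lN0]; first by rewrite gtr0_norm.
  have lp : 0 < l by rewrite lt0r lN0.
  have e1 : expR (- (t * l)) <= 1 by rewrite -expR0 ler_expR oppr_le0 mulr_ge0 // ltW.
  rewrite ger0_norm; last by rewrite mulr_ge0 ?invr_ge0 // subr_ge0.
  by rewrite ler_pdivrMl //; have := expR_ge1Dx (- (t * l)); lra.
rewrite mulrBl mul1r lerBlDr.
rewrite -{1}(subrK (T (scheme_update t)) b) (le_trans (ler_normD _ _)) //.
by rewrite lerD2l (le_trans (Tc _)).
Qed.

Definition scheme_admissible : set R :=
  [set t | 0 < t /\ scheme_residual t <= eta * `|b|].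

(** For the discrete schemes the residual only depends on the integer part of
    the inner time, for the others it depends continuously on it. *)
Lemma scheme_stop_exists : (exists t, scheme_admissible t) ->
  exists t, scheme_admissible t /\ forall s, scheme_admissible s -> t <= s.
Proof.
move=> [t [t0 ht]]; case: scheme_dichotomy => mE.
  have small k : k%:R = (Num.truncn k%:R)%:R :> R by rewrite natrK.
  pose P k := (0 < k)%N && (scheme_residual k%:R <= eta * `|b|).
  have trunc s : scheme_admissible s -> P (Num.truncn s).
    move=> [s0 hs]; rewrite /P /scheme_residual scheme_update_truncn //.
    rewrite -/(scheme_residual s) hs andbT lt0n; apply/negP => /eqP k0.
    move: hs; rewrite /scheme_residual -scheme_update_truncn // scheme_update0 //.
    rewrite linear0 subr0 -{1}[`|b|]mul1r ler_pM2r // leNgt eta1 //.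
  have ex : exists k, P k by exists (Num.truncn t); apply: trunc.
  case: (ex_minnP ex) => k /andP[k0 hk] kmin.
  exists k%:R; split; first by rewrite /scheme_admissible /= ltr0n.
  move=> s /[dup] sa /trunc /kmin ks; have [s0 _] := sa.
  by rewrite (le_trans (_ : _ <= (Num.truncn s)%:R)) ?ler_nat // truncn_le ltW.
have lb s : scheme_admissible s -> 1 - eta <= s.
  move=> [s0 hs]; have := le_trans (scheme_residual_start mE s0) hs.
  by rewrite ler_pM2r //; lra.
have hinf : has_inf scheme_admissible.
  by split; [exists t | exists (1 - eta) => s /lb].
(* By continuity of the residual the infimum is attained. *)
pose r := inf scheme_admissible.
have rlb s : scheme_admissible s -> r <= s by move=> sa; apply: ge_inf => //; exact: hinf.2.
have r0 : 0 < r.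
  apply: (@lt_le_trans _ _ (1 - eta)); first by rewrite subr_gt0.
  by apply: lb_le_inf; [exists t | move=> s /lb].
exists r; split=> //; split=> //.
apply/ler_addgt0Pr => e e0; have [s sa sr] := inf_adherent (divr_gt0 e0 b0) hinf.
have [s0 hs] := sa.
have := scheme_residual_lipschitz mE r0 (rlb s sa); rewrite ler_norml => /andP[a1 _].
have a2 : (s - r) * `|b| <= e.
  by rewrite -ler_pdivlMr // lerBlDl ltW.
by rewrite -lerBlDl; lra.
Qed.

Section Energy.
Variables (e : X) (theta : R).
Hypothesis theta0 : 0 <= theta.
Hypothesis theta_eta : 2 * theta < eta.
Hypothesis approx : `|b + T e| <= theta * `|b|.

Definition energy_rate := eta * (eta / 2 - theta).

Lemma energy_rate_gt0 : 0 < energy_rate.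
Proof. by rewrite mulr_gt0 // subr_gt0 ltr_pdivlMr // mulrC. Qed.

Lemma scheme_energy t : 0 < t -> integral_time t ->
  (forall s, 0 < s < t -> eta * `|b| < scheme_residual s) ->
  `|e + scheme_update t| ^+ 2 + energy_rate * t * `|b| ^+ 2 <= `|e| ^+ 2.
Proof.
move=> t0 ti res; have c0 := energy_rate_gt0.
have ctb : 0 <= energy_rate * t * `|b| ^+ 2.
  by apply: mulr_ge0; [apply: mulr_ge0; exact: ltW | exact: sqr_ge0].
have eb : eta * `|b| < `|b| by rewrite -[ltRHS]mul1r ltr_pM2r.
have disc k : m = Landweber \/ m = Implicit -> k%:R < t -> eta * `|b| < scheme_residual k%:R.
  move=> mE kt; case: k kt => [|k] kt; last by apply: res; rewrite ltr0n.
  by rewrite /scheme_residual scheme_update0 // linear0 subr0.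
have [mL|mL] := pselect (m = Landweber).
  have tE : t = (Num.truncn t)%:R by apply: ti; left.
  have := @landweber_energy _ _ _ _ Tc e b theta approx (Num.truncn t) eta theta0 (ltW theta_eta).
  rewrite -scheme_update_landweber // -tE.
  have -> : eta * (eta - 2 * theta) = 2 * energy_rate by rewrite /energy_rate; field.
  move=> H; apply: le_trans (H _); last first.
    move=> j jt; have jt' : j%:R < t by rewrite tE ltr_nat.
    have := ltW (disc j (or_introl mL) jt').
    by rewrite /scheme_residual scheme_update_landweber // natrK.
  lra.
(* One implicit step of length 1 at most halves the residual. *)
have hres : eta / 2 * `|b| < scheme_residual t.
  have lt2 : eta / 2 * `|b| < eta * `|b| by have := mulr_gt0 eta0 b0; lra.
  case: scheme_dichotomy => [mE|mE]; last first.
    apply: lt_le_trans lt2 _; apply/ler_addgt0Pr => d d0.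
    pose s := Num.max (t / 2) (t - d / `|b|).
    have db : 0 < d / `|b| by rewrite divr_gt0.
    have t2 : 0 < t / 2 by rewrite divr_gt0.
    have s0 : 0 < s by rewrite lt_max t2.
    have st : s < t by rewrite gt_max; apply/andP; split; lra.
    have sd : (t - s) * `|b| <= d.
      by rewrite -ler_pdivlMr // lerBlDr -lerBlDl le_max lexx orbT.
    have := scheme_residual_lipschitz mE s0 (ltW st).
    have := res s; rewrite s0 st => /(_ isT) a1.
    rewrite ler_norml => /andP[a2 _]; clearbody s; lra.
  have mI : m = Implicit by case: mE.
  have tE : t = (Num.truncn t)%:R by apply: ti.
  case: (Num.truncn t) (tE) => [|k] tk; first by move: t0; rewrite tk ltxx.
  have kt : k%:R < t by rewrite tk ltr_nat.
  have := disc k mE kt; rewrite /scheme_residual.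
  rewrite tk !scheme_update_implicit // !natrK => a1.
  have := implicit_residual_ge Tc ler01 (filtered_euler Tc k b ler01) => a2.
  have := lt_le_trans a1 a2; lra.
(* The energy estimate holds for Euler steps and passes to their limit. *)
have qs := quad_cont_scheme m t0.
pose gap := scheme_residual t - eta / 2 * `|b|.
have gap0 : 0 < gap by rewrite subr_gt0.
have near d : 0 < d -> exists2 z : X, `|e + scheme_update t - z| <= d &
    `|z| ^+ 2 + energy_rate * t * `|b| ^+ 2 <= `|e| ^+ 2.
  move=> d0; have db : 0 < Num.min d gap / `|b| by rewrite divr_gt0 // lt_min d0.
  have [h [k [h0 hk hE]]] := scheme_euler_approx mL t0 db.
  have qe := quad_cont_euler k h0.
  have := filtered_dist Tc b qe qs (ltW db) hE.
  rewrite divfK ?gt_eqF // -/(scheme_update t) le_min => /andP[ud ug].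
  exists (e + filtered T (euler h k) b).
    by rewrite opprD addrACA subrr add0r distrC.
  have hkt : h * k%:R = t.
    by rewrite hk scheme_time_integral.
  have := @euler_energy _ _ _ _ Tc e b theta approx h k (eta / 2) h0 theta0.
  have -> : 2 * (eta / 2) * (eta / 2 - theta) = energy_rate by rewrite /energy_rate; field.
  rewrite hkt; apply; first by rewrite ler_pdivlMr // mulrC ltW.
  have : scheme_residual t <= `|b - T (filtered T (euler h k) b)| + gap.
    rewrite /scheme_residual -{1}(subrK (T (filtered T (euler h k) b)) b) -addrA.
    rewrite (le_trans (ler_normD _ _)) // lerD2l -linearB (le_trans (Tc _)) //.
  by rewrite /gap; lra.
have ce : 0 <= `|e| ^+ 2 - energy_rate * t * `|b| ^+ 2.
  have [z _ hz] := near 1 ltr01; have := sqr_ge0 `|z|; lra.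
have : `|e + scheme_update t| <= Num.sqrt (`|e| ^+ 2 - energy_rate * t * `|b| ^+ 2).
  apply: norm_le_approx => d d0; have [z z1 z2] := near d d0; exists z => //.
  apply: le_of_sqr; first exact: sqrtr_ge0.
  by rewrite sqr_sqrtr //; lra.
rewrite -(@ler_pXn2r _ 2) ?nnegrE ?sqrtr_ge0 // sqr_sqrtr //; lra.
Qed.

(** Were no inner time admissible, the energy estimate would hold at every
    integer time and the error would become negative. *)
Theorem scheme_stop : exists t,
  [/\ scheme_admissible t, forall s, scheme_admissible s -> t <= s &
   `|e + scheme_update t| ^+ 2 + energy_rate * t * `|b| ^+ 2 <= `|e| ^+ 2].
Proof.
have c0 := energy_rate_gt0.
have cb : 0 < energy_rate * `|b| ^+ 2 by rewrite mulr_gt0 // exprn_gt0.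
have ex : exists t, scheme_admissible t.
  apply: contrapT => nex.
  pose k := (Num.truncn (`|e| ^+ 2 / (energy_rate * `|b| ^+ 2))).+1.
  have k0 : 0 < k%:R :> R by rewrite ltr0n.
  have := @scheme_energy k%:R k0.
  rewrite /integral_time natrK => /(_ (fun _ => erefl)) H.
  have : `|e| ^+ 2 < energy_rate * k%:R * `|b| ^+ 2.
    by rewrite mulrAC mulrC -ltr_pdivrMr // truncnS_gt.
  have := sqr_ge0 `|e + scheme_update k%:R|.
  suff : `|e + scheme_update k%:R| ^+ 2 + energy_rate * k%:R * `|b| ^+ 2 <= `|e| ^+ 2.
    by lra.
  apply: H => s /andP[s0 _]; rewrite ltNge; apply/negP => hs.
  by apply: nex; exists s.
have [t [[t0 ht] tmin]] := scheme_stop_exists ex.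
exists t; split=> //; apply: scheme_energy => //.
  move=> mE; have tr0 : 0 <= t by exact: ltW.
  apply/eqP; rewrite eq_le [X in _ && X]truncn_le tr0 andbT.
  apply: tmin; split; last by rewrite /scheme_residual scheme_update_truncn.
  rewrite ltr0n lt0n; apply/negP => /eqP k0.
  move: ht; rewrite /scheme_residual -scheme_update_truncn // scheme_update0 //.
  by rewrite linear0 subr0 -{1}[`|b|]mul1r ler_pM2r // leNgt eta1.
move=> s /andP[s0 st]; rewrite ltNge; apply/negP => hs.
have sa : scheme_admissible s by [].
by have := tmin s sa; rewrite leNgt st.
Qed.

End Energy.
End InnerStop.

(** * Fractional powers of [T^* T] *)

Section RealPowers.
Context {R : realType}.
Implicit Types (a c x y F P Q : R).

Lemma sqr_powR_split a x : 0 <= x -> x ^+ 2 = x `^ a * x `^ (2 - a).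
Proof.
move=> x0; rewrite -powRD; last by rewrite [a + _]addrC subrK pnatr_eq0.
by rewrite [a + _]addrC subrK powR_mulrn.
Qed.

Lemma powR_threshold a c l : 0 <= a <= 1 -> 0 < c -> 0 <= l ->
  l `^ a <= c `^ (a - 1) * l + c `^ a.
Proof.
move=> /andP[a0 a1] c0 l0; have [lc|/ltW cl] := leP l c.
  apply: (@le_trans _ _ (c `^ a)); first by rewrite ge0_ler_powR ?nnegrE ?(ltW c0).
  by rewrite lerDr mulr_ge0 ?powR_ge0.
have lp := lt_le_trans c0 cl.
apply: (@le_trans _ _ (c `^ (a - 1) * l)); last by rewrite lerDl powR_ge0.
have -> : l `^ a = l `^ (a - 1) * l.
  by rewrite -{3}[l]powRr1 // -powRD ?subrK // (gt_eqF lp) implybT.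
rewrite ler_wpM2r // -(opprB 1 a) !powRN lef_pV2 ?posrE ?powR_gt0 //.
by rewrite ge0_ler_powR ?subr_ge0 ?nnegrE ?(ltW c0).
Qed.

(** The differential inequality [(P^2)' <= D P^(2 - a)] bounds the growth of
    [P^a]; this is its version for one step. *)
Lemma powR_growth a (D : R) P Q : 0 < a -> a <= 2 -> 0 <= D -> 0 <= P -> 0 <= Q ->
  Q ^+ 2 <= P ^+ 2 + D * Q `^ (2 - a) -> Q `^ a <= P `^ a + D.
Proof.
move=> a0 a2 D0 P0 Q0 h; have [QP|PQ] := leP Q P.
  apply: (@le_trans _ _ (P `^ a)); last by rewrite lerDl.
  by rewrite ge0_ler_powR ?nnegrE ?(ltW a0).
have Qp := le_lt_trans P0 PQ.
have w0 : 0 < Q `^ (2 - a) by rewrite powR_gt0.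
rewrite -(ler_pM2r w0) mulrDl -sqr_powR_split // (le_trans h) // lerD2r.
rewrite (sqr_powR_split a P0) ler_wpM2l ?powR_ge0 //.
by rewrite ge0_ler_powR ?nnegrE ?subr_ge0 // ltW.
Qed.

Lemma powR_growth_forced a (c d : R) F P Q : 0 < a -> a <= 2 -> 0 <= c -> 0 <= d ->
  1 <= c + d -> 0 <= F -> 0 <= P -> 0 <= Q ->
  Q ^+ 2 <= P ^+ 2 + c * (F `^ a * P `^ (2 - a)) + d * F ^+ 2 ->
  Q `^ a <= P `^ a + (c + d) * F `^ a.
Proof.
move=> a0 a2 c0 d0 cd F0 P0 Q0 h; have Fa := powR_ge0 F a.
have [QP|PQ] := leP Q P.
  apply: (@le_trans _ _ (P `^ a)); last by rewrite lerDl mulr_ge0 // addr_ge0.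
  by rewrite ge0_ler_powR ?nnegrE ?(ltW a0).
have [QF|FQ] := leP Q F.
  have : Q `^ a <= F `^ a by rewrite ge0_ler_powR ?nnegrE ?(ltW a0).
  have : 1 * F `^ a <= (c + d) * F `^ a by rewrite ler_wpM2r.
  by have := powR_ge0 P a; lra.
apply: powR_growth => //; first by rewrite mulr_ge0 // addr_ge0.
apply: (le_trans h); rewrite -addrA lerD2l.
have b0 : 0 <= 2 - a by rewrite subr_ge0.
have w1 : P `^ (2 - a) <= Q `^ (2 - a) by rewrite ge0_ler_powR ?nnegrE // ltW.
have w2 : F `^ (2 - a) <= Q `^ (2 - a) by rewrite ge0_ler_powR ?nnegrE // ltW.
rewrite (sqr_powR_split a F0) mulrDl mulrDl -!mulrA.
by apply: lerD; apply: ler_wpM2l => //; apply: ler_wpM2l.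
Qed.

End RealPowers.

Section FractionalPowers.
Context {R : realType} {X Y : hilbertType R}.
Variables (T : {linear X -> Y}) (mu : R).
Hypothesis Tc : forall x, `|T x| <= `|x|.
Hypothesis mu0 : 0 < mu.
Hypothesis mu2 : mu <= 1 / 2.
Local Notation Ts := (adjoint T).
Local Notation A := (adjoint T \o T).
Implicit Types (x p s : X) (f : Y) (a c F h : R).
Let Apc := normal_op_contraction Tc.

Definition power a : X -> X := fun_calculus A (fun l => l `^ a).

Lemma power_sym a : 0 <= a <= 1 -> symmetric_op (power a).
Proof.
by move=> /andP[a0 a1]; apply: (fun_calculus_sym Apc); exact: quad_cont_powR.
Qed.

Lemma power_linear a : 0 <= a <= 1 -> linear (power a).
Proof. by move=> /power_sym; exact: symmetric_linear. Qed.

Lemma power_norm a x : 0 <= a <= 1 -> `|power a x| <= `|x|.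
Proof.
move=> /andP[a0 a1]; rewrite -[leRHS]mul1r.
apply: (fun_calculus_norm Apc) => //; first exact: quad_cont_powR.
move=> l /andP[l0 l1]; rewrite ger0_norm ?powR_ge0 //.
apply: (@le_trans _ _ (1 `^ a)); last by rewrite powR1.
by rewrite ge0_ler_powR ?nnegrE.
Qed.

Lemma powerD a c x : 0 < a -> 0 <= c -> a + c <= 1 ->
  power a (power c x) = power (a + c) x.
Proof.
move=> a0 c0 ac; have cc : c <= 1 by lra.
have aa : a <= 1 by lra.
rewrite /power -(fun_calculusM Apc); try by apply: quad_cont_powR => //; exact: ltW.
congr (_ x); apply: (fun_calculus_eq Apc) => l _; rewrite powRD //.
by rewrite gt_eqF // ltr_pwDl.
Qed.

Lemma power1 x : power 1 x = A x.
Proof.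
rewrite -[in RHS](fun_calculus_id Apc); congr (_ x).
by apply: (fun_calculus_eq Apc) => l /andP[l0 _]; rewrite powRr1.
Qed.

Lemma power_comm a x : 0 <= a <= 1 -> A (power a x) = power a (A x).
Proof.
move=> /andP[a0 a1]; rewrite -{1 2}(fun_calculus_id Apc).
by apply: (fun_calculus_comm Apc); [exact: quad_cont_id | exact: quad_cont_powR].
Qed.

Lemma power_half_norm x : `|power (1 / 2) x| = `|T x|.
Proof.
apply/eqP; rewrite -(@eqrXn2 _ 2) //; apply/eqP.
rewrite sqr_norm_inner power_sym; last by apply/andP; split; lra.
rewrite powerD; [|lra|lra|lra].
have -> : 1 / 2 + 1 / 2 = 1 :> R by field.
by rewrite power1 innerC (inner_normal_op Tc).
Qed.

Local Notation nu := (1 / 2 - mu).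
Let nu01 : 0 <= nu <= 1.
Proof. by have := mu0; have := mu2; move=> *; apply/andP; split; lra. Qed.
Let mu01 : 0 <= mu <= 1.
Proof. by have := mu0; have := mu2; move=> *; apply/andP; split; lra. Qed.

(** [T^* f] lies in the range of [A^mu], with a preimage [A^(1/2 - mu) f'] that
    pairs with [p] like a vector of norm [|f|] with [A^(1/2 - mu) p]. *)
Lemma adjoint_in_power_range f : exists s,
  [/\ Ts f = power mu s, `|s| <= `|f| &
      forall p, inner s p <= `|f| * `|power nu p|].
Proof.
have h01 : 0 <= (1 / 2 : R) <= 1 by apply/andP; split; lra.
have [|||g gf hg] := @dominated_functional R X X (power (1 / 2))
    (fun x => inner (T x) f) `|f| (power_linear h01).
- by move=> a u v /=; rewrite linearP innerDl innerZl.
- exact: normr_ge0.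
- by move=> x; rewrite power_half_norm mulrC CauchySchwarz_abs.
exists (power nu g); split.
- rewrite powerD //; [|by case/andP: nu01|by lra].
  have -> : mu + nu = 1 / 2 by rewrite addrC subrK.
  apply: inner_ext => z.
  by rewrite innerC -(adjE Tc) hg (power_sym h01) innerC.
- by rewrite (le_trans (power_norm _ nu01)).
- move=> p; rewrite (power_sym nu01) (le_trans (CauchySchwarz_inner _ _)) //.
  by rewrite ler_wpM2r.
Qed.

Definition rate_exponent : R := 2 / (1 + 2 * mu).
Local Notation alpha := rate_exponent.

Lemma rate_exponent_mul : alpha * (1 + 2 * mu) = 2.
Proof. by rewrite /alpha divfK // gt_eqF //; have := mu0; lra. Qed.

Lemma rate_exponent_itv : 1 <= alpha /\ alpha < 2.
Proof. by have := rate_exponent_mul; have := mu0; have := mu2; split; nra. Qed.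

Let al1 := (rate_exponent_itv).1.
Let al2 := (rate_exponent_itv).2.
Let al0 : 0 < alpha. Proof. exact: lt_le_trans ltr01 al1. Qed.

(** Interpolation, in the additive form that the energy estimates absorb. *)
Lemma power_interpolation F p : 0 <= F ->
  2 * F * `|power nu p| <=
  1 / 2 * `|T p| ^+ 2 + 5 / 2 * (F `^ alpha * `|p| `^ (2 - alpha)).
Proof.
move=> F0.
have rhs0 : 0 <= 1 / 2 * `|T p| ^+ 2 + 5 / 2 * (F `^ alpha * `|p| `^ (2 - alpha)).
  by have := sqr_ge0 `|T p|;
     have := mulr_ge0 (powR_ge0 F alpha) (powR_ge0 `|p| (2 - alpha)); lra.
have [F00|FN0] := eqVneq F 0.
  by apply: le_trans rhs0; rewrite F00 mulr0 mul0r.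
have Fp : 0 < F by rewrite lt0r FN0.
have [p0|pN0] := eqVneq p 0.
  by apply: le_trans rhs0; rewrite p0 (linf0 (power_linear nu01)) normr0 mulr0.
set P := `|p|; have Pp : 0 < P by rewrite normr_gt0.
pose r := F / P; have rp : 0 < r by rewrite divr_gt0.
have FE : F = r * P by rewrite /r divfK // gt_eqF.
pose c := r `^ alpha; have cp : 0 < c by rewrite powR_gt0.
(* At the threshold [c] the terms [d F^2] and [c P^2] agree. *)
pose d := c `^ (- (2 * mu)); have dp : 0 < d by rewrite powR_gt0.
have tgt : F `^ alpha * P `^ (2 - alpha) = c * P ^+ 2.
  rewrite FE powRM ?ltW // -mulrA -sqr_powR_split //; exact: ltW.
have dF : d * F ^+ 2 = c * P ^+ 2.
  rewrite FE exprMn mulrA; congr (_ * _).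
  rewrite /d /c -powRrM -(powR_mulrn 2) ?(ltW rp) // -powRD ?(gt_eqF rp) ?implybT //.
  by congr (_ `^ _); have := rate_exponent_mul; lra.
have nE : `|power nu p| ^+ 2 <= d * `|T p| ^+ 2 + c * d * P ^+ 2.
  have nn : power nu (power nu p) = power (2 * nu) p.
    have [nu0|nuN0] := eqVneq nu 0.
      have p0 z : power 0 z = z.
        have -> : power 0 z = fun_calculus A (fun=> 1) z.
          by congr (_ z); apply: (fun_calculus_eq Apc) => l _; rewrite powRr0.
        by rewrite (fun_calculus_cst Apc) scale1r.
      by rewrite nu0 mulr0 !p0.
    have nup : 0 < nu by rewrite lt0r nuN0; case/andP: nu01.
    rewrite powerD ?(ltW nup) //; last by have := mu0; lra.
    by congr (power _ p); ring.
  rewrite sqr_norm_inner (power_sym nu01) nn innerC.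
  have q2 : 0 <= 2 * nu <= 1 by have := mu0; have := mu2; move=> *; apply/andP; split; lra.
  have qc : quad_cont (fun l : R => d * l + c * d).
    apply: quad_cont_add; last exact: quad_cont_cst.
    by apply: quad_cont_scale; exact: quad_cont_id.
  apply: le_trans (@fun_calculus_le _ _ _ Apc (fun l => l `^ (2 * nu)) _ p _ qc _) _.
  - by case/andP: q2 => q20 q21; exact: quad_cont_powR.
  - move=> l /andP[l0 _]; have := powR_threshold q2 cp l0.
    have -> : 2 * nu - 1 = - (2 * mu) by field.
    have -> : c `^ (2 * nu) = c * d.
      rewrite /d -{2}[c]powRr1 ?(ltW cp) // -powRD ?(gt_eqF cp) ?implybT //.
      by congr (_ `^ _); field.
    by [].
  rewrite (fun_calculusD Apc _ _ (quad_cont_cst _)); last first.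
    by apply: quad_cont_scale; exact: quad_cont_id.
  rewrite (fun_calculusZ Apc _ _ (@quad_cont_id R)) (fun_calculus_id Apc).
  by rewrite (fun_calculus_cst Apc) innerDl !innerZl (inner_normal_op Tc) -sqr_norm_inner.
rewrite tgt; set n := `|power nu p| in nE *.
have sq : 0 <= (2 * d * F - n) ^+ 2 / (2 * d).
  by rewrite divr_ge0 ?sqr_ge0 // mulr_ge0 // ltW.
have sqE : (2 * d * F - n) ^+ 2 / (2 * d) = 2 * (d * F ^+ 2) - 2 * F * n + n ^+ 2 / d / 2.
  by field; rewrite gt_eqF.
have nd : n ^+ 2 / d <= `|T p| ^+ 2 + c * P ^+ 2.
  rewrite ler_pdivrMr //; have -> : (`|T p| ^+ 2 + c * P ^+ 2) * d =
    d * `|T p| ^+ 2 + c * d * P ^+ 2 by ring.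
  exact: nE.
rewrite sqE dF in sq; move: sq nd; move: (n ^+ 2 / d) => z; move: (c * P ^+ 2) => w.
clearbody n; lra.
Qed.

(** The powers [l^(2 mu)] and [l^(1 + 2 mu)] are compared on either side of the
    threshold [c = (Z / Q)^alpha], at which both terms of the bound agree. *)
Lemma power_norm_interpolation p (Q Z : R) : 0 < Q -> 0 < Z ->
  `|p| <= Q -> `|T (power mu p)| <= Z ->
  `|power mu p| ^+ 2 <= 2 * (Q `^ alpha * Z `^ (2 - alpha)).
Proof.
move=> Qp Zp pQ TZ.
pose r := Z / Q; have rp : 0 < r by rewrite divr_gt0.
have ZE : Z = r * Q by rewrite /r divfK // gt_eqF.
pose c := r `^ alpha; have cp : 0 < c by rewrite powR_gt0.
pose d := r `^ (2 - alpha); have dp : 0 < d by rewrite powR_gt0.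
have tgt : Q `^ alpha * Z `^ (2 - alpha) = d * Q ^+ 2.
  by rewrite ZE powRM ?(ltW rp) ?(ltW Qp) // mulrCA -sqr_powR_split // ltW.
have c2 : c `^ (2 * mu) = d.
  by rewrite /c /d -powRrM; congr (_ `^ _); have := rate_exponent_mul; lra.
have cZ : c^-1 * Z ^+ 2 = d * Q ^+ 2.
  rewrite ZE exprMn mulrA; congr (_ * _).
  by rewrite (sqr_powR_split alpha (ltW rp)) mulrA mulVf ?mul1r // gt_eqF.
have q2 : 0 <= 2 * mu <= 1 by have := mu0; have := mu2; move=> *; apply/andP; split; lra.
have qp : quad_cont (fun l : R => l `^ (2 * mu)).
  by case/andP: q2 => q20 q21; exact: quad_cont_powR.
have ql : quad_cont (fun l : R => l * l `^ (2 * mu)).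
  by apply: quad_cont_mul => //; exact: quad_cont_id.
have qc : quad_cont (fun l : R => c^-1 * (l * l `^ (2 * mu)) + c `^ (2 * mu)).
  by apply: quad_cont_add; [exact: quad_cont_scale | exact: quad_cont_cst].
have mm : power mu (power mu p) = power (2 * mu) p.
  by rewrite powerD ?(ltW mu0) //; [congr (power _ p); ring | case/andP: q2; lra].
have nE : `|power mu p| ^+ 2 <= c^-1 * `|T (power mu p)| ^+ 2 + d * `|p| ^+ 2.
  rewrite sqr_norm_inner (power_sym mu01) mm innerC.
  apply: le_trans (@fun_calculus_le _ _ _ Apc (fun l => l `^ (2 * mu)) _ p _ qc _) _.
  - exact: qp.
  - move=> l /andP[l0 _]; have [lc|cl] := leP l c.
      apply: (@le_trans _ _ (c `^ (2 * mu))).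
        by case/andP: q2 => q20 q21; rewrite ge0_ler_powR ?nnegrE ?(ltW cp).
      by rewrite lerDr !mulr_ge0 ?powR_ge0 // invr_ge0 ltW.
    apply: (@le_trans _ _ (c^-1 * (l * l `^ (2 * mu)))); last by rewrite lerDl powR_ge0.
    rewrite mulrA -[leLHS]mul1r ler_wpM2r ?powR_ge0 //.
    by rewrite ler_pdivlMl // mulr1 ltW.
  rewrite (fun_calculusD Apc _ _ (quad_cont_cst _)); last exact: quad_cont_scale.
  rewrite (fun_calculusZ Apc _ _ ql) (fun_calculusM Apc _ (@quad_cont_id R) qp).
  rewrite (fun_calculus_cst Apc) c2 innerDl !innerZl -sqr_norm_inner lerD2r.
  rewrite ler_wpM2l ?invr_ge0 ?(ltW cp) // (fun_calculus_id Apc).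
  rewrite -/(power (2 * mu) p) -mm (power_comm _ mu01) (power_sym mu01).
  by rewrite (inner_normal_op Tc).
rewrite tgt (le_trans nE) // [leRHS](_ : _ = c^-1 * Z ^+ 2 + d * Q ^+ 2); last first.
  by rewrite cZ; ring.
apply: lerD; apply: ler_wpM2l; rewrite ?invr_ge0 ?(ltW cp) ?(ltW dp) //.
  by rewrite lerXn2r ?nnegrE ?(ltW Zp).
by rewrite lerXn2r ?nnegrE ?(ltW Qp).
Qed.

End FractionalPowers.

(** * One outer step: evolution of the source part and of the noise part *)

Section Resolvent.
Context {R : realType} {X : hilbertType R}.
Variables (A : X -> X) (h : R).
Hypothesis Apc : positive_contraction A.
Hypothesis h0 : 0 <= h.

Definition resolvent : X -> X := fun_calculus A (fun l => (1 + h * l)^-1).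

Lemma resolvent_eq z : resolvent z + h *: A (resolvent z) = z.
Proof.
have qj := quad_cont_inv h0; have ql := quad_cont_mul (@quad_cont_id R) qj.
have E : fun_calculus A (fun l => (1 + h * l)^-1 + h * (l * (1 + h * l)^-1)) =
         fun_calculus A (fun=> 1).
  apply: (fun_calculus_eq Apc) => l /andP[l0 _].
  by field; rewrite gt_eqF // euler_den.
have := congr1 (fun B => B z) E.
rewrite (fun_calculusD Apc _ qj) ?(fun_calculus_cst Apc); last exact: quad_cont_scale.
rewrite (fun_calculusZ Apc _ _ ql) (fun_calculusM Apc _ (@quad_cont_id R) qj).
by rewrite (fun_calculus_id Apc) scale1r.
Qed.

Lemma resolventK z : resolvent (z + h *: A z) = z.
Proof.
have qj := quad_cont_inv h0; have jL := fun_calculus_linear Apc qj.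
have := fun_calculus_comm Apc z qj (@quad_cont_id R).
rewrite (fun_calculus_id Apc) => C.
by rewrite -[RHS]resolvent_eq /resolvent (linfD jL) (linfZ jL) C.
Qed.

End Resolvent.

Section SourceSteps.
Context {R : realType} {X Y : hilbertType R}.
Variables (T : {linear X -> Y}) (mu : R).
Hypothesis Tc : forall x, `|T x| <= `|x|.
Hypothesis mu0 : 0 < mu.
Hypothesis mu2 : mu <= 1 / 2.
Local Notation Ts := (adjoint T).
Local Notation A := (adjoint T \o T).
Local Notation alpha := (rate_exponent mu).
Implicit Types (x p s : X) (f : Y) (F h d : R).
Let Apc := normal_op_contraction Tc.
Let TsL := adj_linear Tc.
Let al := rate_exponent_itv mu0 mu2.
Let mu01 : 0 <= mu <= 1.
Proof. by have := mu0; have := mu2; move=> *; apply/andP; split; lra. Qed.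
Let pwL := power_linear Tc mu01.

(** In terms of [p] with [x = A^mu p] the perturbation [T^* f] of an Euler step
    is [A^(1/2 - mu) f'], and the dissipation [|T p|^2] absorbs all of its
    contribution to [|p|^2] except a term of the order [|p|^(2 - alpha)]. *)
Lemma implicit_source_step h p f F x : 0 <= h -> 0 <= F -> `|f| <= F ->
  x = power T mu p + h *: Ts (f - T x) ->
  exists p', x = power T mu p' /\
    `|p'| `^ alpha <= `|p| `^ alpha + 6 * h * F `^ alpha.
Proof.
move=> h0 F0 fF xE; have [al1 al2] := al.
have [s [sE s1 s2]] := adjoint_in_power_range Tc mu0 mu2 f.
have qj := quad_cont_inv h0.
pose p' := resolvent A h (p + h *: s); exists p'.
have p'E : p' + h *: A p' = p + h *: s by apply: resolvent_eq.
split.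
  have xE2 : x + h *: A x = power T mu (p + h *: s).
    rewrite (linfD pwL) (linfZ pwL) -sE {1}xE (linfB TsL) scalerBr /=.
    by rewrite addrA subrK.
  rewrite -(resolventK Apc h0 x) xE2 /p' /resolvent /power.
  by case/andP: mu01 => m0 m1; apply: (fun_calculus_comm Apc _ qj); exact: quad_cont_powR.
have F1 : 0 <= F `^ alpha by rewrite powR_ge0.
apply: (@le_trans _ _ (`|p| `^ alpha + 5 / 2 * h * F `^ alpha)); last first.
  rewrite lerD2l -!mulrA; have := mulr_ge0 h0 F1; lra.
apply: powR_growth => //; try lra.
  by rewrite mulr_ge0 // mulr_ge0 //; lra.
have -> : `|p| ^+ 2 = `|p' + h *: (A p' - s)| ^+ 2.
  by rewrite scalerBr addrA p'E addrK.
rewrite sqnormD innerZr innerBr (innerC p' (A p')) (inner_normal_op Tc) innerC.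
have a1 : 0 <= `|h *: (A p' - s)| ^+ 2 by rewrite sqr_ge0.
have a2 := power_interpolation Tc mu0 mu2 p' F0.
have a3 : inner s p' <= F * `|power T (1 / 2 - mu) p'|.
  by rewrite (le_trans (s2 p')) // ler_wpM2r.
rewrite -[5 / 2 * h * _ * _]mulrA.
move: a1 a2; set n := `|power _ _ _| in a3 *; set G := `|T p'|.
move: (`|h *: _| ^+ 2) => z; move: (F `^ alpha * _) => w z0 a2.
have a4 : h * (2 * inner s p') <= h * (1 / 2 * G ^+ 2 + 5 / 2 * w).
  rewrite ler_wpM2l //; clearbody n G; lra.
have a5 : 0 <= h * G ^+ 2 by rewrite mulr_ge0 // sqr_ge0.
clearbody n G; lra.
Qed.

Lemma explicit_source_step p f F : 0 <= F -> `|f| <= F ->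
  exists p', power T mu p + Ts (f - T (power T mu p)) = power T mu p' /\
    `|p'| `^ alpha <= `|p| `^ alpha + 6 * F `^ alpha.
Proof.
move=> F0 fF; have [al1 al2] := al.
have [s [sE s1 s2]] := adjoint_in_power_range Tc mu0 mu2 f.
exists (p - (A p - s)); split.
  rewrite (linfB pwL) (linfB pwL) (linfB TsL) -sE -(power_comm Tc p mu01) /=.
  by rewrite opprB.
have F1 : 0 <= F `^ alpha by rewrite powR_ge0.
apply: (@le_trans _ _ (`|p| `^ alpha + (5 / 2 + 3) * F `^ alpha)); last by lra.
apply: powR_growth_forced => //; try lra.
rewrite (sqnormB p) innerBr (innerC p (A p)) (inner_normal_op Tc) (innerC p s).
have a2 := power_interpolation Tc mu0 mu2 p F0.
have a3 : inner s p <= F * `|power T (1 / 2 - mu) p|.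
  by rewrite (le_trans (s2 p)) // ler_wpM2r.
have a4 : `|A p - s| ^+ 2 <= 3 / 2 * `|T p| ^+ 2 + 3 * F ^+ 2.
  have b1 : `|A p| ^+ 2 <= `|T p| ^+ 2 by rewrite lerXn2r ?nnegrE //= adj_norm.
  have b2 : `|s| ^+ 2 <= F ^+ 2 by rewrite lerXn2r ?nnegrE // (le_trans s1).
  have b3 := sqr_ge0 `|A p + 2 *: s|; rewrite sqnormD normZ_sqr innerZr in b3.
  rewrite (sqnormB (A p)); lra.
move: a2 a4; set n := `|power _ _ _| in a3 *.
move: (F `^ alpha * _) => w a2 a4; clearbody n; lra.
Qed.

(** The image of a ball under [A^mu] is closed, being described by the
    inequalities [<x, z> <= Q |A^mu z|]. *)
Lemma power_range_closed x (Q : R) : 0 <= Q ->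
  (forall d, 0 < d -> exists2 p, `|x - power T mu p| <= d & `|p| <= Q) ->
  exists2 p, x = power T mu p & `|p| <= Q.
Proof.
move=> Q0 hx.
have [|||p pQ hp] := @dominated_functional R X X (power T mu) (fun z => inner x z) Q pwL.
- by move=> a u v; rewrite innerDr innerZr.
- exact: Q0.
- move=> z; apply/ler_addgt0Pr => e e0.
  have z1 : 0 < `|z| + 1 by rewrite ltr_wpDl.
  have [p xp pQ] := hx _ (divr_gt0 e0 z1).
  have -> : inner x z = inner p (power T mu z) + inner (x - power T mu p) z.
    by rewrite -(power_sym Tc mu01) innerBl addrC subrK.
  rewrite (le_trans (ler_normD _ _)) // lerD //.
    by rewrite (le_trans (CauchySchwarz_abs _ _)) // ler_wpM2r.
  rewrite (le_trans (CauchySchwarz_abs _ _)) //.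
  apply: (@le_trans _ _ (e / (`|z| + 1) * `|z|)); first by rewrite ler_wpM2r.
  by rewrite mulrAC ler_pdivrMr // ler_wpM2l ?(ltW e0) // lerDl.
exists p => //; apply: inner_ext => z.
by rewrite hp (power_sym Tc mu01) innerC.
Qed.

End SourceSteps.

Section NoiseStep.
Context {R : realType} {X Y : hilbertType R}.
Variables (T : {linear X -> Y}) (nu : Y).
Hypothesis Tc : forall x, `|T x| <= `|x|.
Local Notation Ts := (adjoint T).
Implicit Types (M : X) (h : R).

Lemma implicit_noise_step h M M' : 0 <= h -> M' = M + h *: Ts (nu - T M') ->
  `|M'| ^+ 2 <= `|M| ^+ 2 + h * `|nu| ^+ 2.
Proof.
move=> h0 E; set r := nu - T M'.
have -> : M = M' - h *: Ts r by rewrite {1}E addrK.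
rewrite (sqnormB M') innerZr -(adjE Tc).
have -> : T M' = nu - r by rewrite /r opprB addrC subrK.
rewrite innerBl -(sqr_norm_inner r).
have a1 := sqr_ge0 `|h *: Ts r|.
have a2 : inner nu r <= `|nu| * `|r| by exact: CauchySchwarz_inner.
have a3 : inner nu r - `|r| ^+ 2 <= 1 / 2 * `|nu| ^+ 2.
  by have := sqr_ge0 (`|nu| - `|r|); have := sqr_ge0 `|r|; clearbody r; lra.
have a4 : h * (inner nu r - `|r| ^+ 2) <= h * (1 / 2 * `|nu| ^+ 2) by rewrite ler_wpM2l.
clearbody r; lra.
Qed.

Lemma explicit_noise_step M :
  `|M + Ts (nu - T M)| ^+ 2 <= `|M| ^+ 2 + `|nu| ^+ 2.
Proof.
set r := nu - T M; rewrite (sqnormD M) -(adjE Tc).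
have -> : T M = nu - r by rewrite /r opprB addrC subrK.
rewrite innerBl -(sqr_norm_inner r).
have a1 : `|Ts r| ^+ 2 <= `|r| ^+ 2 by rewrite lerXn2r ?nnegrE // adj_norm.
have a2 : inner nu r <= `|nu| * `|r| by exact: CauchySchwarz_inner.
have := sqr_ge0 (`|nu| - `|r|); clearbody r; lra.
Qed.

End NoiseStep.

Section OuterStep.
Context {R : realType} {X Y : hilbertType R}.
Variables (m : inner_scheme) (T Tn : {linear X -> Y}) (mu kappa : R).
Hypothesis Tc : forall x, `|T x| <= `|x|.
Hypothesis Tnc : forall x, `|Tn x| <= `|x|.
Hypothesis mu0 : 0 < mu.
Hypothesis mu2 : mu <= 1 / 2.
Hypothesis kappa0 : 0 <= kappa.
Hypothesis kappa2 : kappa <= 1 / 2.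
Hypothesis Tn_close : forall x, `|Tn x - T x| <= kappa * `|T x|.
Local Notation Ts := (adjoint T).
Local Notation alpha := (rate_exponent mu).

(** The functional [<(Tn - T) h, r>] of [h] is dominated by [|T h|]. *)
Lemma adjoint_transfer r : exists2 q, `|q| <= kappa * `|r| &
  adjoint Tn r = Ts (r + q).
Proof.
have TL : linear T by move=> a u v; rewrite linearP.
have [|||q qr hq] := @dominated_functional R X Y T
   (fun x => inner (Tn x - T x) r) (kappa * `|r|) TL.
- by move=> a u v /=; rewrite (linearP T) (linearP Tn) !innerE; ring.
- by rewrite mulr_ge0.
- move=> x; rewrite (le_trans (CauchySchwarz_abs _ _)) // mulrAC.
  by rewrite ler_wpM2r.
exists q => //; apply: inner_ext => z.
rewrite innerC -(adjE Tnc) [RHS]innerC -(adjE Tc) innerDr -hq innerBl.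
by rewrite addrC subrK.
Qed.

Variables (e : X) (b nu w : Y) (W : R).
Hypothesis bE : b = nu - T e + w.
Hypothesis wW : `|w| <= W.
Let F := W + 5 * kappa * `|b|.

Let W0 : 0 <= W. Proof. exact: le_trans (normr_ge0 w) wW. Qed.
Let F0 : 0 <= F. Proof. by rewrite /F addr_ge0 // !mulr_ge0. Qed.

(** The inner iteration for [Tn] and [b] is one for [T] and [nu], started at
    [e], with a perturbation of the data of size [F]. *)
Lemma residual_transfer u : `|b - Tn u| <= `|b| -> exists2 f, `|f| <= F &
  adjoint Tn (b - Tn u) = Ts (nu - T (e + u) + f).
Proof.
move=> res; have [q qr ->] := adjoint_transfer (b - Tn u).
exists (w - (Tn u - T u) + q); last first.
  by congr (Ts _); rewrite [in LHS]bE (linearD T); vector_ring.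
have Tnu : `|Tn u| <= 2 * `|b|.
  rewrite -(subrK b (Tn u)) (le_trans (ler_normD _ _)) // distrC; lra.
have Tu : `|T u| <= 4 * `|b|.
  have := Tn_close u; rewrite distrC => tu.
  have : `|T u| <= `|T u - Tn u| + `|Tn u| by rewrite -{1}(subrK (Tn u) (T u)) ler_normD.
  have : kappa * `|T u| <= 1 / 2 * `|T u| by rewrite ler_wpM2r.
  lra.
rewrite (le_trans (ler_normD _ _)) // (le_trans (lerD (ler_normB _ _) qr)) //.
have a1 : kappa * `|b - Tn u| <= kappa * `|b| by rewrite ler_wpM2l.
have a2 : `|Tn u - T u| <= kappa * (4 * `|b|).
  by rewrite (le_trans (Tn_close u)) // ler_wpM2l.
rewrite /F; have := wW; lra.
Qed.

Variables (p N : X).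
Hypothesis eE : e = power T mu p + N.

Definition noise_part f := N + filtered T f (nu - T N).

Lemma noise_euler h k : 0 <= h ->
  noise_part (euler h k.+1) = noise_part (euler h k) +
    h *: Ts (nu - T (noise_part (euler h k.+1))).
Proof.
move=> h0; rewrite /noise_part {1}(filtered_euler Tc _ _ h0) addrA linearD.
by rewrite opprD addrA.
Qed.

Lemma noise_landweber k :
  noise_part (landweber k.+1) = noise_part (landweber k) +
    Ts (nu - T (noise_part (landweber k))).
Proof.
by rewrite /noise_part (filtered_landweber Tc) addrA linearD opprD addrA.
Qed.

Lemma noise_start : noise_part (fun=> 0) = N.
Proof. by rewrite /noise_part (filtered0 Tc) addr0. Qed.

(** The error after the inner iteration with filter function [f] and elapsed
    time [s]: source part and noise part. *)
Definition source_decomposition f (s : R) :=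
  [/\ exists2 p', e + filtered Tn f b = power T mu p' + noise_part f &
        `|p'| `^ alpha <= `|p| `^ alpha + 6 * s * F `^ alpha,
      `|nu - T (noise_part f)| <= `|nu - T N| &
      `|noise_part f| ^+ 2 <= `|N| ^+ 2 + s * `|nu| ^+ 2].

Lemma source_start f : f = (fun=> 0) -> source_decomposition f 0.
Proof.
move=> ->; split; rewrite ?noise_start ?mul0r ?addr0 //.
by exists p; rewrite ?(filtered0 Tnc) ?addr0 ?mulr0 ?mul0r ?addr0.
Qed.

Lemma euler_residual_b h k : 0 <= h -> `|b - Tn (filtered Tn (euler h k) b)| <= `|b|.
Proof.
move=> h0; elim: k => [|k IH]; first by rewrite (filtered0 Tnc) linear0 subr0.
exact: le_trans (euler_residual_le Tnc b k h0) IH.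
Qed.

Lemma landweber_residual_b k : `|b - Tn (filtered Tn (landweber k) b)| <= `|b|.
Proof.
elim: k => [|k IH]; first by rewrite (filtered0 Tnc) linear0 subr0.
exact: le_trans (landweber_residual_le Tnc b k) IH.
Qed.

Lemma source_euler h k : 0 <= h -> source_decomposition (euler h k) (h * k%:R).
Proof.
move=> h0; elim: k => [|k [[q qE qle] n1 n2]]; first by rewrite mulr0; exact: source_start.
have hS : h * k.+1%:R = h * k%:R + h by rewrite -(natr1 k) mulrDr mulr1.
have [f fF fE] := residual_transfer (euler_residual_b k.+1 h0).
have uE := filtered_euler Tnc k b h0; have NE := noise_euler k h0.
split.
- have xE : e + filtered Tn (euler h k.+1) b - noise_part (euler h k.+1) =
    power T mu q + h *: Ts (f - T (e + filtered Tn (euler h k.+1) b -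
      noise_part (euler h k.+1))).
    set z := e + _ - _; have -> : f - T z = (nu - T (e + filtered Tn (euler h k.+1) b) + f)
       - (nu - T (noise_part (euler h k.+1))).
      by rewrite /z (linearB T); vector_ring.
    rewrite (linfB (adj_linear Tc)) -fE scalerBr /z {1}uE {1}NE addrA qE.
    vector_ring.
  have [p' [p'E p'le]] := implicit_source_step Tc mu0 mu2 h0 F0 fF xE.
  exists p'; first by rewrite -p'E subrK.
  by rewrite (le_trans p'le) // hS; lra.
- by apply: le_trans n1; apply: (implicit_residual_le Tc h0).
- have := implicit_noise_step Tc h0 NE; rewrite hS; lra.
Qed.

Lemma source_landweber k : source_decomposition (landweber k) k%:R.
Proof.
elim: k => [|k [[q qE qle] n1 n2]]; first exact: source_start.
have hS : k.+1%:R = k%:R + 1 :> R by rewrite natr1.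
have [f fF fE] := residual_transfer (landweber_residual_b k).
have uE := filtered_landweber Tnc k b; have NE := noise_landweber k.
split.
- have [p' [p'E p'le]] := explicit_source_step Tc mu0 mu2 q F0 fF.
  exists p'; last by rewrite (le_trans p'le) // hS; lra.
  rewrite -p'E uE NE fE addrA qE.
  have -> : f - T (power T mu q) = (nu - T (e + filtered Tn (landweber k) b) + f)
       - (nu - T (noise_part (landweber k))).
    by rewrite qE (linearD T); vector_ring.
  rewrite (linfB (adj_linear Tc)) qE; vector_ring.
- by rewrite NE; apply: le_trans n1; exact: explicit_residual_le.
- have := explicit_noise_step nu Tc (noise_part (landweber k)); rewrite -NE hS; lra.
Qed.

Lemma scheme_time_step t : 0 < t ->
  source_decomposition (scheme_fun m t) t.
Proof.
move=> t0; have /andP[st0 st1] := scheme_time_le m (ltW t0).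
have [al1 al2] := rate_exponent_itv mu0 mu2.
have Fa : 0 <= F `^ alpha by rewrite powR_ge0.
have [mL|mL] := pselect (m = Landweber).
  have -> : scheme_fun m t = landweber (Num.truncn t).
    by apply/funext => l; rewrite mL scheme_landweber.
  have kt : (Num.truncn t)%:R <= t by rewrite truncn_le ltW.
  have [[q qE qle] n1 n2] := source_landweber (Num.truncn t); split => //.
    exists q => //; rewrite (le_trans qle) // lerD2l -!mulrA ler_wpM2l //.
    by rewrite ler_wpM2r.
  by rewrite (le_trans n2) // lerD2l ler_wpM2r ?sqr_ge0.
(* The estimates for Euler steps pass to the limit. *)
set B := `|b| + `|nu - T N| + 1.
have B0 : 0 < B by rewrite ltr_wpDl // addr_ge0.
have qs := quad_cont_scheme m t0.
pose c := `|p| `^ alpha + 6 * t * F `^ alpha.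
have c0 : 0 <= c by rewrite addr_ge0 ?powR_ge0 // mulr_ge0 // mulr_ge0 // ltW.
have alN0 : alpha != 0 by rewrite gt_eqF // (lt_le_trans ltr01).
have near d : 0 < d -> exists f, [/\
    `|filtered Tn (scheme_fun m t) b - filtered Tn f b| <= d,
    `|noise_part (scheme_fun m t) - noise_part f| <= d,
    exists2 p', e + filtered Tn f b = power T mu p' + noise_part f &
        `|p'| <= c `^ alpha^-1,
    `|nu - T (noise_part f)| <= `|nu - T N| &
    `|noise_part f| ^+ 2 <= `|N| ^+ 2 + t * `|nu| ^+ 2].
  move=> d0; have dB : 0 < d / B by rewrite divr_gt0.
  have dBE : d / B * B = d by rewrite divfK // gt_eqF.
  have [h [k [h0 hk hE]]] := scheme_euler_approx mL t0 dB.
  have qe := quad_cont_euler k h0.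
  have [[q qE qle] n1 n2] := source_euler k h0.
  exists (euler h k); split => //.
  - rewrite distrC (le_trans (filtered_dist Tnc b qe qs (ltW dB) hE)) //.
    rewrite -[leRHS]dBE ler_wpM2l ?(ltW dB) // /B -addrA lerDl addr_ge0 //.
  - rewrite distrC /noise_part opprD addrACA subrr add0r.
    rewrite (le_trans (filtered_dist Tc _ qe qs (ltW dB) hE)) //.
    rewrite -[leRHS]dBE ler_wpM2l ?(ltW dB) // /B addrAC lerDr addr_ge0 //.
  - exists q => //; have -> : `|q| = (`|q| `^ alpha) `^ alpha^-1.
      by rewrite -powRrM mulfV // powRr1.
    rewrite ge0_ler_powR ?nnegrE ?powR_ge0 ?invr_ge0 //.
      by rewrite (le_trans _ al1).
    rewrite (le_trans qle) // lerD2l hk -!mulrA ler_wpM2l //.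
    by rewrite ler_wpM2r.
  - by rewrite (le_trans n2) // hk lerD2l ler_wpM2r ?sqr_ge0.
split.
- have [|d d0|q qE qle] := @power_range_closed _ _ _ T mu Tc mu0 mu2
    (e + filtered Tn (scheme_fun m t) b - noise_part (scheme_fun m t)) (c `^ alpha^-1).
  + exact: powR_ge0.
  + have [f [f1 f2 [q qE qle] _ _]] := near _ (divr_gt0 d0 (ltr0Sn R 1)).
    exists q => //; have -> : power T mu q = e + filtered Tn f b - noise_part f.
      by rewrite qE addrK.
    have -> : e + filtered Tn (scheme_fun m t) b - noise_part (scheme_fun m t) -
        (e + filtered Tn f b - noise_part f) =
      (filtered Tn (scheme_fun m t) b - filtered Tn f b) -
      (noise_part (scheme_fun m t) - noise_part f) by vector_ring.
    by rewrite (le_trans (ler_normB _ _)) //; lra.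
  exists q; first by rewrite -qE subrK.
  have -> : `|p| `^ alpha + 6 * t * F `^ alpha = (c `^ alpha^-1) `^ alpha.
    by rewrite -powRrM mulVf // powRr1.
  by rewrite ge0_ler_powR ?nnegrE ?powR_ge0 // (le_trans _ al1).
- apply: norm_le_approx => d d0; have [f [_ f2 _ n1 _]] := near d d0.
  exists (nu - T (noise_part f)) => //.
  have -> : nu - T (noise_part (scheme_fun m t)) - (nu - T (noise_part f)) =
     - T (noise_part (scheme_fun m t) - noise_part f).
    by rewrite (linearB T); vector_ring.
  by rewrite normrN (le_trans (Tc _)).
- have s0 : 0 <= `|N| ^+ 2 + t * `|nu| ^+ 2.
    by rewrite addr_ge0 ?sqr_ge0 // mulr_ge0 ?sqr_ge0 // ltW.
  have : `|noise_part (scheme_fun m t)| <= Num.sqrt (`|N| ^+ 2 + t * `|nu| ^+ 2).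
    apply: norm_le_approx => d d0; have [f [_ f2 _ _ n2]] := near d d0.
    exists (noise_part f) => //; apply: le_of_sqr; first exact: sqrtr_ge0.
    by rewrite sqr_sqrtr.
  by rewrite -(@ler_pXn2r _ 2) ?nnegrE ?sqrtr_ge0 // sqr_sqrtr.
Qed.

End OuterStep.

(** * The outer iteration *)

Section MeanValue.
Context {R : realType} {V : normedModType R}.

(** If the slope of [f] is locally at most [L], then so is its increment
    over the unit interval: the supremum of the times up to which
    [|f s - f 0| <= (L + e) s] is such a time and cannot be less than 1. *)
Lemma local_slope_bound (f : R -> V) (L : R) : 0 <= L ->
  (forall s e, 0 <= s <= 1 -> 0 < e -> exists2 d : R, 0 < d &
     forall s', 0 <= s' <= 1 -> `|s' - s| <= d ->
       `|f s' - f s| <= (L + e) * `|s' - s|) ->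
  `|f 1 - f 0| <= L.
Proof.
move=> L0 loc; apply/ler_addgt0Pr => e e0.
have Le : 0 <= L + e by rewrite addr_ge0 // ltW.
pose S := [set s : R | 0 <= s <= 1 /\ `|f s - f 0| <= (L + e) * s].
have S0 : S 0 by split; rewrite ?lexx ?ler01 // subrr normr0 mulr0.
have Sub : has_ubound S by exists 1 => s [/andP[]].
have Ssup : has_sup S by split => //; exists 0.
pose c := sup S.
have c0 : 0 <= c by apply: ub_le_sup.
have c1 : c <= 1 by apply: ge_sup; [exists 0 | move=> s [/andP[]]].
have c01 : 0 <= c <= 1 by rewrite c0.
have [d d0 hd] := loc c e c01 e0.
have Sc : `|f c - f 0| <= (L + e) * c.
  have [s [s01 hs] sc] := sup_adherent d0 Ssup.
  have sle : s <= c by apply: ub_le_sup.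
  have := hd s s01; rewrite distrC ger0_norm ?subr_ge0 // => H.
  have {}H : `|f s - f c| <= (L + e) * (c - s).
    by apply: H; rewrite lerBlDr -lerBlDl ltW.
  rewrite -(subrK (f s) (f c)) -addrA (le_trans (ler_normD _ _)) //.
  by rewrite distrC; lra.
have [c1'|c1'] := ltP c 1; last first.
  have cE : c = 1 by apply/eqP; rewrite eq_le c1.
  by move: Sc; rewrite cE mulr1.
pose s := Num.min 1 (c + d).
have s1 : s <= 1 by rewrite ge_min lexx.
have cs : c < s by rewrite lt_min c1' ltrDl.
have sd : s <= c + d by rewrite ge_min lexx orbT.
have s01 : 0 <= s <= 1 by rewrite s1 (le_trans c0) // ltW.
have Ss : S s.
  split => //; have := hd s s01; rewrite ger0_norm ?subr_ge0 ?(ltW cs) //.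
  rewrite lerBlDl => /(_ sd) H.
  rewrite -(subrK (f c) (f s)) -addrA (le_trans (ler_normD _ _)) //; lra.
have : s <= c by apply: ub_le_sup.
by rewrite leNgt cs.
Qed.

End MeanValue.

Section Setting.
Context {R : realType} {X Y : hilbertType R}.
Variables (Theta : R) (D : set X) (F : X -> Y) (F' : X -> {linear X -> Y}).
Variables (xd : X) (y : Y) (rho K0 : R).
Hypothesis setting : newton_setting Theta D F F' xd y rho K0.
Implicit Types (x z h : X).
Local Notation ball := (ball_le xd rho).

Lemma ball_center : ball xd.
Proof. by rewrite /ball_le /= subrr normr0 ltW // (setting_rho setting). Qed.

Lemma derivative_contraction x : ball x -> forall h, `|F' x h| <= `|h|.
Proof.
move=> bx h; have [cx _] := setting_frechet setting (setting_ball setting bx).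
have [T0 Th] := opnorm_bound cx (setting_opnorm setting bx).
rewrite (le_trans (Th h)) // -[leRHS]mul1r ler_wpM2r //.
exact: ltW (setting_Theta setting).
Qed.

Lemma ball_segment x z (s : R) : ball x -> ball z -> 0 <= s <= 1 ->
  ball (z + s *: (x - z)).
Proof.
rewrite /ball_le /= => bx bz /andP[s0 s1].
have -> : z + s *: (x - z) - xd = s *: (x - xd) + (1 - s) *: (z - xd).
  by vector_ring.
rewrite (le_trans (ler_normD _ _)) // !normrZ (ger0_norm s0) ger0_norm ?subr_ge0 //.
have a1 : s * `|x - xd| <= s * rho by rewrite ler_wpM2l.
have a2 : (1 - s) * `|z - xd| <= (1 - s) * rho by rewrite ler_wpM2l ?subr_ge0.
lra.
Qed.

(** The slope of [s |-> F (z + s h) - s F'(z) h] is [(F'(z + s h) - F'(z)) h]. *)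
Lemma linearization_error x z : ball x -> ball z ->
  `|F x - F z - F' z (x - z)| <= K0 * `|x - z| * `|F' z (x - z)|.
Proof.
move=> bx bz; set h := x - z; have K00 := setting_K0 setting.
pose f (s : R) := F (z + s *: h) - s *: F' z h.
have L0 : 0 <= K0 * `|h| * `|F' z h| by rewrite !mulr_ge0.
have -> : F x - F z - F' z h = f 1 - f 0.
  have zh : z + h = x by rewrite /h addrC subrK.
  by rewrite /f !scale1r !scale0r addr0 subr0 zh addrAC.
apply: local_slope_bound => // s e s01 e0.
pose p := z + s *: h; have bp : ball p by apply: ball_segment.
have [_ /(_ (e / (`|h| + 1)))] := setting_frechet setting (setting_ball setting bp).
have h1 : 0 < `|h| + 1 by rewrite ltr_wpDl.
move=> /(_ (divr_gt0 e0 h1)); rewrite /within /=.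
move=> /nbhs_ballP [d /= d0 hd].
exists (d / 2 / (`|h| + 1)); first by rewrite !divr_gt0.
move=> s' s'01 s's; pose p' := z + s' *: h.
have p'p : p' - p = (s' - s) *: h by rewrite /p' /p; vector_ring.
have dp : `|p' - p| < d.
  rewrite p'p normrZ; apply: (@le_lt_trans _ _ (d / 2)); last by lra.
  apply: (@le_trans _ _ (d / 2 / (`|h| + 1) * `|h|)); first by rewrite ler_wpM2r.
  by rewrite mulrAC ler_pdivrMr // ler_wpM2l ?lerDl //; lra.
have := hd p'; rewrite -ball_normE /ball_ /= distrC => /(_ dp).
move=> /(_ (setting_ball setting (ball_segment bx bz s'01))) fr.
have -> : f s' - f s = (F p' - F p - F' p (p' - p)) + (s' - s) *: (F' p h - F' z h).
  by rewrite p'p linearZ /f -/p -/p'; vector_ring.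
rewrite (le_trans (ler_normD _ _)) // normrZ.
have lip := setting_lipschitz setting bp bz h.
have pz : `|p - z| <= `|h|.
  rewrite /p addrAC subrr add0r normrZ; case/andP: s01 => s0 s1.
  by rewrite ger0_norm // -[leRHS]mul1r ler_wpM2r.
have a1 : `|F' p h - F' z h| <= K0 * `|h| * `|F' z h|.
  by rewrite (le_trans lip) // ler_wpM2r // ler_wpM2l.
have a2 : `|s' - s| * `|F' p h - F' z h| <= `|s' - s| * (K0 * `|h| * `|F' z h|).
  by rewrite ler_wpM2l.
have a3 : e / (`|h| + 1) * `|p' - p| <= e * `|s' - s|.
  rewrite p'p normrZ mulrAC ler_pdivrMr // -mulrA ler_wpM2l ?(ltW e0) //.
  by rewrite ler_wpM2l // lerDl.
rewrite (le_trans (lerD fr a2)) // (le_trans (lerD a3 (lexx _))) //.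
by rewrite mulrDl addrC [X in X + _]mulrC.
Qed.

End Setting.

Section Constants.
Context {R : realType}.
Variables tau eta : R.

(** The quarter makes the linearization error a fraction of [|T e|]; the other
    two bounds give [theta < eta / 2] and [q < 1]. *)
Definition newton_eps : R :=
  Num.min (1 / 4) (Num.min ((eta / 2 - tau^-1) / 4) ((1 - eta) / 8)).
(** Bounds [|b + F'(x) e| / |b|] for the residual [b] and the error [e]. *)
Definition newton_theta : R := (eta / 2 + tau^-1) / 2.
(** Bounds the quotient of successive residuals. *)
Definition newton_q : R := (1 + eta) / 2.

Hypothesis htau : 2 < tau.
Hypothesis heta0 : 0 < eta.
Hypothesis heta1 : eta < 1.
Hypothesis htaueta : 2 < tau * eta.

Lemma tau_inv : 0 < tau^-1 /\ tau^-1 < eta / 2.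
Proof.
have t0 : 0 < tau by have := htau; lra.
split; first by rewrite invr_gt0.
by rewrite -div1r ltr_pdivrMr //; have := htaueta; lra.
Qed.

Lemma newton_eps_bounds : [/\ 0 < newton_eps, newton_eps <= 1 / 4,
  4 * newton_eps <= eta / 2 - tau^-1 & 8 * newton_eps <= 1 - eta].
Proof.
have [t1 t2] := tau_inv; have h1 := heta1; rewrite /newton_eps; split.
- by rewrite !lt_min; apply/andP; split; [lra | apply/andP; split; lra].
- by rewrite ge_min lexx.
- have : newton_eps <= (eta / 2 - tau^-1) / 4 by rewrite /newton_eps !ge_min lexx !orbT.
  by rewrite /newton_eps; lra.
- have : newton_eps <= (1 - eta) / 8 by rewrite /newton_eps !ge_min lexx !orbT.
  by rewrite /newton_eps; lra.
Qed.

Lemma newton_theta_bounds : 0 <= newton_theta /\ 2 * newton_theta < eta.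
Proof. by have [t1 t2] := tau_inv; have h := heta0; rewrite /newton_theta; split; lra. Qed.

Lemma newton_q_bounds : 0 < newton_q /\ newton_q < 1.
Proof. by have h0 := heta0; have h1 := heta1; rewrite /newton_q; split; lra. Qed.

End Constants.

Section NewtonStep.
Context {R : realType} {X Y : hilbertType R}.
Variables (m : inner_scheme) (tau eta : R).
Hypothesis htau : 2 < tau.
Hypothesis heta0 : 0 < eta.
Hypothesis heta1 : eta < 1.
Hypothesis htaueta : 2 < tau * eta.
Local Notation eps := (newton_eps tau eta).
Local Notation theta := (newton_theta tau eta).
Local Notation q := (newton_q eta).
Local Notation rate := (energy_rate eta theta).
Variables (Theta : R) (D : set X) (F : X -> Y) (F' : X -> {linear X -> Y}).
Variables (xd : X) (y : Y) (rho K0 : R).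
Hypothesis setting : newton_setting Theta D F F' xd y rho K0.
Variables (delta : R) (yd : Y).
Hypothesis delta0 : 0 < delta.
Hypothesis noise : `|yd - y| <= delta.
Local Notation ball := (ball_le xd rho).
Local Notation res x := (`|yd - F x|).
Local Notation err x := (`|x - xd|).
Implicit Types x : X.

Let K00 : 0 <= K0. Proof. exact: setting_K0 setting. Qed.

Lemma error_image_bound x : ball x -> K0 * err x <= eps ->
  [/\ `|F' x (x - xd)| <= 4 / 3 * `|F x - y|,
      `|F' xd (x - xd)| <= 4 / 3 * `|F x - y| &
      `|F x - y| <= 5 / 4 * `|F' xd (x - xd)|].
Proof.
move=> bx Kx; have [e0 e1 _ _] := newton_eps_bounds htau heta1 htaueta.
have bd := ball_center setting.
have Fd := setting_Fxd setting.
have k4 : K0 * err x <= 1 / 4 by apply: le_trans e1.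
have l1 := linearization_error setting bd bx.
have l2 := linearization_error setting bx bd.
have l1' : `|y - F x + F' x (x - xd)| <= 1 / 4 * `|F' x (x - xd)|.
  move: l1; rewrite Fd -(opprB x xd) linearN opprK !normrN => l1.
  by rewrite (le_trans l1) // ler_wpM2r.
have l2' : `|F x - y - F' xd (x - xd)| <= 1 / 4 * `|F' xd (x - xd)|.
  by move: l2; rewrite Fd => l2; rewrite (le_trans l2) // ler_wpM2r.
split.
- have : `|F' x (x - xd)| <= `|y - F x + F' x (x - xd)| + `|F x - y|.
    rewrite -[in X in X <= _](addKr (y - F x) (F' x (x - xd))) opprB addrC.
    by rewrite ler_normD.
  lra.
- have : `|F' xd (x - xd)| <= `|F x - y - F' xd (x - xd)| + `|F x - y|.
    rewrite [leRHS]addrC -[in X in X <= _](subKr (F x - y) (F' xd (x - xd))).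
    by rewrite ler_normB.
  lra.
- have : `|F x - y| <= `|F x - y - F' xd (x - xd)| + `|F' xd (x - xd)|.
    by rewrite -[in X in X <= _](subrK (F' xd (x - xd)) (F x - y)) ler_normD.
  lra.
Qed.

Lemma defect_bound x : `|F x - y| <= res x + delta.
Proof.
rewrite -[in leLHS](subrK yd (F x)) -addrA (le_trans (ler_normD _ _)) //.
by rewrite distrC lerD2l.
Qed.

Lemma residual_bound x : res x <= `|F x - y| + delta.
Proof.
rewrite -(subrK y yd) -addrA (le_trans (ler_normD _ _)) //.
by rewrite [leLHS]addrC (distrC y) lerD2l.
Qed.

Section Active.
Variable x : X.
Hypothesis bx : ball x.
Hypothesis Kx : K0 * err x <= eps.
Hypothesis active : tau * delta < res x.

Lemma delta_le_residual : delta <= tau^-1 * res x.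
Proof.
have t0 : 0 < tau by have := htau; lra.
by rewrite ler_pdivlMl // ltW.
Qed.

Lemma delta_le_half : delta <= 1 / 2 * res x.
Proof.
have [t1 t2] := tau_inv htau htaueta; have h1 := heta1.
rewrite (le_trans delta_le_residual) // ler_wpM2r //; lra.
Qed.

Lemma residual_gt0 : 0 < res x.
Proof.
apply: lt_trans active; rewrite mulr_gt0 //; have := htau; lra.
Qed.

(** The defect [b + F'(x) e] consists of the noise, which is less than [b / tau],
    and of the linearization error. *)
Lemma newton_approx : `|yd - F x + F' x (x - xd)| <= theta * res x.
Proof.
have [e0 e1 e2 _] := newton_eps_bounds htau heta1 htaueta.
have [n1 _ _] := error_image_bound bx Kx.
have bd := ball_center setting.
have := linearization_error setting bd bx; rewrite (setting_Fxd setting).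
rewrite -(opprB x xd) linearN opprK !normrN => l1.
have l2 : K0 * err x * `|F' x (x - xd)| <= eps * `|F' x (x - xd)| by rewrite ler_wpM2r.
have -> : yd - F x + F' x (x - xd) = (yd - y) + (y - F x + F' x (x - xd)).
  by rewrite !addrA subrK.
rewrite (le_trans (ler_normD _ _)) //.
have d1 := delta_le_residual; have d2 := delta_le_half; have d3 := defect_bound x.
have n2 : `|F' x (x - xd)| <= 2 * res x by lra.
have n3 : eps * `|F' x (x - xd)| <= eps * (2 * res x) by rewrite ler_wpM2l // ltW.
have n4 : 4 * eps * res x <= (eta / 2 - tau^-1) * res x by rewrite ler_wpM2r.
have nz := noise; rewrite /newton_theta; lra.
Qed.

Lemma newton_inner_stop : exists t, is_inner_stop m eta F F' yd x t.
Proof.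
have [th0 th1] := newton_theta_bounds htau heta0 htaueta.
have [t [ta tmin _]] := scheme_stop m (derivative_contraction setting bx) heta0 heta1
  residual_gt0 th0 th1 newton_approx.
by exists t; split.
Qed.

(** The new residual is the final inner residual, at most [eta |b|], up to the
    linearization error, which is small as [K0 |u|] is. *)
Lemma newton_step t : is_inner_stop m eta F F' yd x t ->
  let x' := x + inner_update m F F' yd x t in
  [/\ 0 < t, err x' <= err x,
      err x' ^+ 2 + rate * t * res x ^+ 2 <= err x ^+ 2 &
      res x' <= q * res x].
Proof.
move=> [[t0 ta] tmin] x'.
have [th0 th1] := newton_theta_bounds htau heta0 htaueta.
have [e0 e1 e2 e3] := newton_eps_bounds htau heta1 htaueta.
have Tc := derivative_contraction setting bx.
have [t' [ta' tmin' en]] := scheme_stop m Tc heta0 heta1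
  residual_gt0 th0 th1 newton_approx.
have tt : t' = t.
  by apply/eqP; rewrite eq_le tmin' //= tmin.
rewrite {}tt in en {ta' tmin'}.
have xE : x' - xd = x - xd + scheme_update m (F' x) (yd - F x) t.
  by rewrite /x' addrAC.
rewrite -xE in en.
have r0 : 0 < rate by apply: energy_rate_gt0.
have mono : err x' <= err x.
  apply: le_of_sqr => //; have : 0 <= rate * t * res x ^+ 2.
    by apply: mulr_ge0; [apply: mulr_ge0; exact: ltW | exact: sqr_ge0].
  lra.
split=> //.
have bx' : ball x' by rewrite /ball_le /= (le_trans mono).
set u := inner_update m F F' yd x t in ta x' xE en mono bx' *.
have xu : x' - x = u by rewrite /x' addrC addKr.
have := linearization_error setting bx' bx; rewrite xu => lin.
have un : `|u| <= 2 * err x.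
  have -> : u = (x' - xd) - (x - xd) by rewrite -xu; vector_ring.
  rewrite (le_trans (ler_normB _ _)) //; lra.
have Ku : K0 * `|u| <= 2 * eps.
  have : K0 * `|u| <= K0 * (2 * err x) by rewrite ler_wpM2l.
  by have := Kx; lra.
have Tu : `|F' x u| <= 2 * res x.
  rewrite -[F' x u](subKr (yd - F x)) (le_trans (ler_normB _ _)) //.
  have : eta * res x <= 1 * res x by rewrite ler_wpM2r // ltW.
  lra.
have lin' : `|F x' - F x - F' x u| <= 4 * eps * res x.
  rewrite (le_trans lin) //.
  have := ler_pM (mulr_ge0 K00 (normr_ge0 u)) (normr_ge0 (F' x u)) Ku Tu; lra.
have -> : yd - F x' = (yd - F x - F' x u) - (F x' - F x - F' x u) by vector_ring.
rewrite (le_trans (ler_normB _ _)) //.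
have : 8 * eps * res x <= (1 - eta) * res x by rewrite ler_wpM2r.
rewrite /newton_q; clearbody u x' => H; lra.
Qed.

End Active.
End NewtonStep.

Section Iteration.
Context {R : realType} {X Y : hilbertType R}.
Variables (m : inner_scheme) (tau eta : R).
Hypothesis htau : 2 < tau.
Hypothesis heta0 : 0 < eta.
Hypothesis heta1 : eta < 1.
Hypothesis htaueta : 2 < tau * eta.
Local Notation eps := (newton_eps tau eta).
Local Notation q := (newton_q eta).
Local Notation rate := (energy_rate eta (newton_theta tau eta)).
Variables (Theta : R) (D : set X) (F : X -> Y) (F' : X -> {linear X -> Y}).
Variables (xd : X) (y : Y) (rho K0 : R).
Hypothesis setting : newton_setting Theta D F F' xd y rho K0.
Variable x0 : X.
Hypothesis bx0 : ball_le xd rho x0.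
Hypothesis Kx0 : K0 * `|x0 - xd| <= eps.
Local Notation ball := (ball_le xd rho).

Section Data.
Variables (delta : R) (yd : Y).
Hypothesis delta0 : 0 < delta.
Hypothesis noise : `|yd - y| <= delta.
Local Notation it := (newton_iterate m eta F F' x0 yd).
Local Notation res n := (`|yd - F (it n)|).
Local Notation err n := (`|it n - xd|).
Local Notation stop n := (inner_stop m eta F F' yd (it n)).

Let K00 : 0 <= K0. Proof. exact: setting_K0 setting. Qed.

Lemma iterate_step k : ball (it k) -> K0 * err k <= eps -> tau * delta < res k ->
  [/\ is_inner_stop m eta F F' yd (it k) (stop k), 0 < stop k, err k.+1 <= err k,
      err k.+1 ^+ 2 + rate * stop k * res k ^+ 2 <= err k ^+ 2 &
      res k.+1 <= q * res k].
Proof.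
move=> bk Kk ak.
have ex := newton_inner_stop m htau heta0 heta1 htaueta setting delta0 noise bk Kk ak.
have st : is_inner_stop m eta F F' yd (it k) (stop k).
  exact: (getPex (P := [set t | is_inner_stop m eta F F' yd (it k) t])).
by have [] := newton_step htau heta0 heta1 htaueta setting delta0 noise bk Kk ak st.
Qed.

Variable n : nat.
Hypothesis active : forall k, (k < n)%N -> tau * delta < res k.

Lemma iterates_in_ball k : (k <= n)%N -> ball (it k) /\ K0 * err k <= eps.
Proof.
elim: k => [//|k IH] kn; have [bk Kk] := IH (ltnW kn).
have [_ _ e1 _ _] := iterate_step bk Kk (active kn); split.
  by rewrite /ball_le /= (le_trans e1).
by rewrite (le_trans _ Kk) // ler_wpM2l.
Qed.

Lemma active_step k : (k < n)%N ->
  [/\ is_inner_stop m eta F F' yd (it k) (stop k), 0 < stop k, err k.+1 <= err k,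
      err k.+1 ^+ 2 + rate * stop k * res k ^+ 2 <= err k ^+ 2 &
      res k.+1 <= q * res k].
Proof.
by move=> kn; have [bk Kk] := iterates_in_ball (ltnW kn); exact: iterate_step (active kn).
Qed.

Lemma residual_decay k : (k <= n)%N -> res k <= q ^+ k * res 0.
Proof.
have [q0 q1] := newton_q_bounds heta0 heta1.
elim: k => [|k IH] kn; first by rewrite expr0 mul1r.
have [_ _ _ _ r] := active_step kn.
by rewrite (le_trans r) // exprS -mulrA ler_wpM2l ?(ltW q0) // IH // ltnW.
Qed.

(** The residuals decay geometrically and stay above [tau * delta]; moreover
    the iteration only starts if [delta] is below the initial defect. *)
Lemma active_count : n%:R <=
  (1 + (1 + `|ln (2 * `|F x0 - y| / tau)|) / - ln q) * (1 + `|ln delta|).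
Proof.
have t0 : 0 < tau by have := htau; lra.
have [q0 q1] := newton_q_bounds heta0 heta1.
have lq : 0 < - ln q by rewrite oppr_gt0 ln_lt0 // q0.
set M := `|F x0 - y|; set L := ln _.
have LL : 0 <= (1 + `|L|) / - ln q by rewrite divr_ge0 ?addr_ge0 // ltW.
case nE : n => [|k]; first by rewrite mulr_ge0 // addr_ge0.
have kn : (k < n)%N by rewrite nE.
have a0 : tau * delta < res 0 by apply: active; rewrite nE.
have dM := residual_bound F noise x0; rewrite -/M in dM.
have td : 2 * delta < tau * delta by rewrite ltr_pM2r.
have M0 : 0 < M by have := delta0; rewrite /= in a0; lra.
have r2 : res 0 <= 2 * M by rewrite /= in a0 *; lra.
have ak : tau * delta < q ^+ k * (2 * M).
  apply: (lt_le_trans (active kn)); apply: (le_trans (residual_decay (ltnW kn))).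
  by rewrite ler_wpM2l // exprn_ge0 // ltW.
have qk : 0 < q ^+ k by rewrite exprn_gt0.
have M2 : 0 < 2 * M by rewrite mulr_gt0.
(* Logarithms turn [tau delta < q^k (2 M)] into a bound of [k]. *)
have lnk : ln delta < k%:R * ln q + L.
  rewrite mulr_natl.
  rewrite -lnXn // -lnM ?posrE ?divr_gt0 // ltr_ln ?posrE ?mulr_gt0 ?invr_gt0 //.
  by rewrite mulrA ltr_pdivlMr // mulrC.
have kle : k%:R * - ln q <= `|L| + `|ln delta|.
  rewrite mulrN; clearbody L; move: (k%:R * _) lnk => z lnk.
  have := ler_norm L; have := ler_norm (- ln delta); rewrite normrN; lra.
have kle2 : k%:R <= (`|L| + `|ln delta|) / - ln q by rewrite ler_pdivlMr.
rewrite -natr1.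
have d0 := normr_ge0 (ln delta); have L1 := normr_ge0 L.
have step : (`|L| + `|ln delta|) / - ln q <= (1 + `|L|) / - ln q * (1 + `|ln delta|).
  rewrite [leRHS]mulrAC ler_wpM2r ?invr_ge0 ?(ltW lq) //.
  by have := mulr_ge0 L1 d0; lra.
rewrite mulrDl mul1r; clearbody L; lra.
Qed.

End Data.

Lemma discrepancy_stop_exists : exists C' : R, forall (delta : R) (yd : Y),
  0 < delta -> `|yd - y| <= delta ->
  exists n : nat,
    [/\ discrepancy_stop m tau eta F F' x0 delta yd n,
        newton_well_defined m eta D F F' x0 yd n &
        n%:R <= C' * (1 + `|ln delta|)].
Proof.
exists (1 + (1 + `|ln (2 * `|F x0 - y| / tau)|) / - ln q).
set C' := 1 + _ => delta yd d0 nz.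
pose it := newton_iterate m eta F F' x0 yd.
pose P n := `|yd - F (it n)| <= tau * delta.
have ex : exists n, P n.
  apply: contrapT => nex.
  have act k : tau * delta < `|yd - F (it k)|.
    by rewrite ltNge; apply/negP => Pk; apply: nex; exists k.
  have := active_count d0 nz
    (n := (Num.truncn (C' * (1 + `|ln delta|))).+1) (fun k _ => act k).
  by rewrite leNgt truncnS_gt.
case: (ex_minnP ex) => n Pn nmin; exists n.
have act k : (k < n)%N -> tau * delta < `|yd - F (it k)|.
  by move=> kn; rewrite ltNge; apply/negP => /nmin; rewrite leqNgt kn.
split; first by split.
- split=> k kn.
    by have [bk _] := iterates_in_ball d0 nz act kn; exact: (setting_ball setting).
  by have [st _ _ _ _] := active_step d0 nz act kn; exists (inner_stop m eta F F' yd (it k)).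
- exact: active_count act.
Qed.

End Iteration.

(** * A scalar recursion *)

Section RateRecursion.
Context {R : realType}.
Variables alpha q c : R.
Hypothesis al1 : 1 <= alpha.
Hypothesis al2 : alpha < 2.
Hypothesis q0 : 0 < q.
Hypothesis q1 : q < 1.
Hypothesis c0 : 0 < c.

Let C := 24 / c.
Let C' := C / (1 - q).
Let r := q `^ ((2 - alpha) / 2).

(** Bounds the elapsed time at residual [B], multiplied by [B^alpha] and
    relative to [W^alpha]. *)
Definition time_bound : R := (C' + C) * expR (C + C').
Local Notation G := time_bound.
Let H := Num.sqrt (72 + 6 * G).

(** The increments of [pi_] then sum up to at most [W^alpha]; 294 is 6 times the
    bound 49 of [7^alpha]. *)
Definition source_smallness : R := (1 - r) / (294 * H * G).

Let q1' : 0 < 1 - q. Proof. by rewrite subr_gt0. Qed.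
Let C0 : 0 < C. Proof. exact: divr_gt0. Qed.
Let C'0 : 0 < C'. Proof. exact: divr_gt0. Qed.
Let C'E : C' * (1 - q) = C. Proof. by rewrite divfK // gt_eqF. Qed.
Let qq : q * (2 - q) <= 1. Proof. by have := sqr_ge0 (1 - q); lra. Qed.
Let r0 : 0 < r. Proof. exact: powR_gt0. Qed.
Let r1 : r < 1.
Proof.
have a2 : 0 < (2 - alpha) / 2 by have := al2; lra.
apply: (@lt_le_trans _ _ (1 `^ ((2 - alpha) / 2))); last by rewrite powR1.
by rewrite gt0_ltr_powR ?nnegrE ?(ltW q0).
Qed.

Lemma time_bound_gt0 : 0 < G.
Proof. by rewrite mulr_gt0 ?expR_gt0 // addr_gt0. Qed.

Let HE : H ^+ 2 = 72 + 6 * G.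
Proof. by rewrite sqr_sqrtr //; have := time_bound_gt0; lra. Qed.

Let H0 : 0 < H.
Proof. by rewrite sqrtr_gt0; have := time_bound_gt0; lra. Qed.

Lemma source_smallness_gt0 : 0 < source_smallness.
Proof.
rewrite divr_gt0 ?subr_gt0 // mulr_gt0 ?time_bound_gt0 //.
by rewrite mulr_gt0.
Qed.

(** [B] and [E] stand for the norms of the residuals and of the errors, [t] for
    the inner times with sums [s], [pi_] for the bound of [|p|^alpha] and [W] for
    the norm of the source element. *)
Variables (n : nat) (B E s t pi_ : nat -> R) (delta W K : R).
Hypothesis delta0 : 0 < delta.
Hypothesis W0 : 0 < W.
Hypothesis K0 : 0 <= K.
Hypothesis KW : K * W <= source_smallness.
Local Notation w := (W `^ alpha).
Hypothesis s0 : s 0 = 0.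
Hypothesis sS : forall j, (j < n)%N -> s j.+1 = s j + t j.
Hypothesis t0 : forall j, (j < n)%N -> 0 <= t j.
Hypothesis Bd : forall j, (j < n)%N -> delta <= B j.
Hypothesis BS : forall j, (j.+1 < n)%N -> B j.+1 <= q * B j.
Hypothesis B0 : (0 < n)%N -> B 0 <= 3 * W.
Hypothesis E0 : forall j, 0 <= E j.
Hypothesis KE : forall j, (j < n)%N -> K * E j <= 1.
Hypothesis energy : forall j, (j < n)%N -> c * (t j * B j ^+ 2) <= E j ^+ 2.
Hypothesis error : forall j, (j < n)%N -> pi_ j <= 2 * w ->
  E j ^+ 2 <= 24 * w * B j `^ (2 - alpha) + 2 * s j * delta ^+ 2.
Hypothesis pi0 : pi_ 0 = w.
Hypothesis piS : forall j, (j < n)%N ->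
  pi_ j.+1 = pi_ j + 6 * t j * (7 * (K * E j) * B j) `^ alpha.

Let al0 : 0 < alpha. Proof. exact: lt_le_trans ltr01 al1. Qed.
Let w0 : 0 < w. Proof. exact: powR_gt0. Qed.
Let Bp j : (j < n)%N -> 0 < B j. Proof. by move=> /Bd; exact: lt_le_trans. Qed.

Lemma time_ge0 j : (j <= n)%N -> 0 <= s j.
Proof.
elim: j => [|j IH] jn; first by rewrite s0.
by rewrite sS // addr_ge0 ?t0 // IH // ltnW.
Qed.

Lemma residual_geometric j : (j < n)%N -> B j <= q ^+ j * (3 * W).
Proof.
elim: j => [|j IH] jn; first by rewrite expr0 mul1r B0.
rewrite (le_trans (BS jn)) // exprS -mulrA ler_wpM2l ?(ltW q0) //.
by apply: IH; exact: ltnW.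
Qed.

Let yy j := (delta / B j) ^+ 2.

Let yy0 j : 0 <= yy j. Proof. exact: sqr_ge0. Qed.

Let yy1 j : (j < n)%N -> yy j <= 1.
Proof.
move=> jn; rewrite /yy expr_le1 ?divr_ge0 ?(ltW delta0) ?(ltW (Bp jn)) //.
by rewrite ler_pdivrMr ?mul1r ?Bd // Bp.
Qed.

Let yyS j : (j.+1 < n)%N -> yy j <= q * yy j.+1.
Proof.
move=> jn; have Bj := Bp (ltnW jn); have Bj1 := Bp jn.
have a1 : delta / B j <= q * (delta / B j.+1).
  rewrite ler_pdivrMr // [q * _]mulrC -mulrA mulrAC ler_pdivlMr //.
  by rewrite ler_wpM2l ?(ltW delta0) // BS.
have a2 : 0 <= delta / B j by rewrite divr_ge0 ?(ltW delta0) ?(ltW Bj).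
have a3 : yy j <= (q * (delta / B j.+1)) ^+ 2.
  by rewrite /yy lerXn2r ?nnegrE // (le_trans a2).
rewrite (le_trans a3) // exprMn /yy ler_wpM2r ?sqr_ge0 //.
by rewrite expr2 -[leRHS]mulr1 ler_wpM2l ?(ltW q0) // ltW.
Qed.

(** Elapsed time compared with the residuals.  The exponential weight takes
    care of the noise term: [y = (delta / B)^2] grows geometrically in [j]
    towards its last value, which is at most 1. *)
Definition time_invariant j := (j < n)%N ->
  s j * B j `^ alpha <= C' * w * expR (C' * yy j).

(** The energy estimate bounds [t] by [(E / B)^2], and [E] is bounded by the
    source part and by the noise part, the latter of size [s delta^2]. *)
Lemma time_step j : (j < n)%N -> pi_ j <= 2 * w -> time_invariant j ->
  s j.+1 * B j `^ alpha <= (C' + C) * w * expR ((C + C') * yy j).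
Proof.
move=> jn pij /(_ jn) inv.
have Bj := Bp jn; have b0 : 0 < B j `^ alpha by rewrite powR_gt0.
have v0 : 0 < B j `^ (2 - alpha) by rewrite powR_gt0.
have B2 := sqr_powR_split alpha (ltW Bj).
have d2 : delta ^+ 2 = yy j * B j ^+ 2 by rewrite /yy expr_div_n divfK // expf_neq0 // gt_eqF.
have sj := time_ge0 (ltnW jn); have y0 := yy0 j.
have a0 : 0 <= s j * B j `^ alpha by rewrite mulr_ge0 // ltW.
have tb : t j * B j `^ alpha <= C * w + C * (s j * B j `^ alpha) * yy j.
  have := le_trans (energy jn) (error jn pij); rewrite d2 B2.
  move: (B j `^ alpha) (B j `^ (2 - alpha)) b0 v0 a0 => b v b0 v0 a0 en.
  have en2 : c * (t j * b) <= 24 * w + 2 * (s j * b) * yy j.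
    by rewrite -(ler_pM2r v0); lra.
  have ay : 0 <= s j * b * yy j by rewrite mulr_ge0.
  have -> : C * w + C * (s j * b) * yy j = (24 * w + 24 * (s j * b) * yy j) / c.
    by rewrite /C; field; rewrite gt_eqF.
  by rewrite ler_pdivlMr // mulrC (le_trans en2) // lerD2l; lra.
have -> : s j.+1 * B j `^ alpha = s j * B j `^ alpha + t j * B j `^ alpha.
  by rewrite sS // mulrDl.
have e1 := expR_ge1Dx (C * yy j).
have -> : (C + C') * yy j = C * yy j + C' * yy j by ring.
rewrite expRD; set Z := expR (C * _) in e1 *; set V := expR (C' * _) in inv *.
have V1 : 1 <= V by rewrite /V -expR0 ler_expR mulr_ge0 // ltW.
have Cy : 0 <= C * yy j by rewrite mulr_ge0 // ltW.
have Z1 : 1 <= Z by lra.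
have a1 : (1 + C * yy j) * (s j * B j `^ alpha) <= Z * (C' * w * V).
  by apply: ler_pM => //; lra.
have a2 : 1 <= Z * V by rewrite mulr_ege1.
have a3 : C * w * 1 <= C * w * (Z * V) by rewrite ler_wpM2l // mulr_ge0 // ltW.
move: (s j * _) (t j * _) tb a1 => a b tb a1; clearbody Z V; lra.
Qed.

Lemma time_le j : (j < n)%N -> pi_ j <= 2 * w -> time_invariant j ->
  s j.+1 * B j `^ alpha <= G * w.
Proof.
move=> jn pij inv; rewrite (le_trans (time_step jn pij inv)) //.
rewrite /time_bound [leRHS]mulrAC ler_wpM2l //.
  by rewrite mulr_ge0 ?(ltW w0) // addr_ge0 ?ltW.
rewrite ler_expR -[leRHS]mulr1 ler_wpM2l ?yy1 // addr_ge0 ?ltW //.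
Qed.

(** The growth factor [1 + C y] is absorbed by the increase of [y], and the
    constant term by the decrease of [B]. *)
Lemma time_invariant_step j : (j < n)%N -> pi_ j <= 2 * w ->
  time_invariant j -> time_invariant j.+1.
Proof.
move=> jn pij inv j1n; have st := time_step jn pij inv.
have Bj := Bp jn; have Bj1 := Bp j1n.
have bS : B j.+1 `^ alpha <= q * B j `^ alpha.
  apply: (@le_trans _ _ ((q * B j) `^ alpha)).
    by rewrite ge0_ler_powR ?nnegrE ?(ltW al0) ?(ltW Bj1) ?BS // (le_trans (ltW Bj1)) ?BS.
  rewrite powRM ?(ltW q0) ?(ltW Bj) // ler_wpM2r ?powR_ge0 //.
  by rewrite ge1r_powR // q0 ltW.
have sj := time_ge0 jn.
have e1 : expR ((C + C') * yy j) <= expR (C' * yy j.+1).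
  rewrite ler_expR; have := yyS j1n => y1.
  have y2 : (C + C') * yy j <= (C + C') * (q * yy j.+1).
    by rewrite ler_wpM2l // addr_ge0 ?ltW.
  rewrite (le_trans y2) //.
  have -> : (C + C') * (q * yy j.+1) = C' * (q * (2 - q)) * yy j.+1.
    by rewrite -[in LHS]C'E; ring.
  rewrite ler_wpM2r ?yy0 // -[leRHS]mulr1 ler_wpM2l ?qq //; exact: (ltW C'0).
have a1 : s j.+1 * B j.+1 `^ alpha <= q * (s j.+1 * B j `^ alpha).
  by rewrite [leRHS]mulrCA ler_wpM2l.
have a2 : q * (s j.+1 * B j `^ alpha) <= q * ((C' + C) * w * expR ((C + C') * yy j)).
  by rewrite ler_wpM2l // ltW.
have a3 : q * ((C' + C) * w * expR ((C + C') * yy j)) <=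
    C' * w * expR ((C + C') * yy j).
  rewrite mulrA ler_wpM2r ?expR_ge0 // mulrA ler_wpM2r ?(ltW w0) //.
  have -> : q * (C' + C) = C' * (q * (2 - q)) by rewrite -[in LHS]C'E; ring.
  by rewrite -[leRHS]mulr1 ler_wpM2l ?qq //; exact: (ltW C'0).
rewrite (le_trans a1) // (le_trans a2) // (le_trans a3) // ler_wpM2l //.
by rewrite mulr_ge0 // ltW.
Qed.

Lemma error_geometric j : (j < n)%N -> pi_ j <= 2 * w -> time_invariant j ->
  E j <= H * W * r ^+ j.
Proof.
move=> jn pij inv; have tl := time_le jn pij inv.
have Bj := Bp jn; have b0 : 0 < B j `^ alpha by rewrite powR_gt0.
have v0 : 0 < B j `^ (2 - alpha) by rewrite powR_gt0.
have B2 := sqr_powR_split alpha (ltW Bj).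
have d2 : delta ^+ 2 = yy j * B j ^+ 2 by rewrite /yy expr_div_n divfK // expf_neq0 // gt_eqF.
have sj := time_ge0 (ltnW jn).
have E1 : E j ^+ 2 <= (24 + 2 * G) * w * B j `^ (2 - alpha).
  rewrite (le_trans (error jn pij)) // d2 B2.
  have a1 : s j * B j `^ alpha * yy j <= G * w * 1.
    apply: ler_pM => //; first by rewrite mulr_ge0 // ltW.
      by rewrite (le_trans _ tl) // ler_wpM2r ?(ltW b0) // sS // lerDl t0.
    exact: yy1.
  move: (B j `^ alpha) (B j `^ (2 - alpha)) b0 v0 a1 => b v b0 v0 a1.
  have := ler_wpM2r (ltW v0) a1; lra.
have v1 : B j `^ (2 - alpha) <= 3 * W `^ (2 - alpha) * (r ^+ j) ^+ 2.
  have a20 : 0 <= 2 - alpha by rewrite subr_ge0 ltW.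
  apply: (@le_trans _ _ ((q ^+ j * (3 * W)) `^ (2 - alpha))).
    rewrite ge0_ler_powR ?nnegrE ?(ltW Bj) ?residual_geometric //.
    by rewrite mulr_ge0 ?exprn_ge0 ?mulr_ge0 ?(ltW q0) ?(ltW W0).
  rewrite powRM ?exprn_ge0 ?(ltW q0) ?mulr_ge0 ?(ltW W0) //.
  rewrite powRM ?(ltW W0) // mulrC.
  have -> : (q ^+ j) `^ (2 - alpha) = (r ^+ j) ^+ 2.
    rewrite /r -!(powR_mulrn _ (ltW _)) ?powR_gt0 // -?powRrM.
    by congr (_ `^ _); field.
  rewrite ler_wpM2r ?sqr_ge0 // ler_wpM2r ?powR_ge0 //.
  by rewrite ler1_powR //; have := al1; lra.
apply: le_of_sqr; first by rewrite !mulr_ge0 ?exprn_ge0 // ltW.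
rewrite (le_trans E1) // !exprMn HE (sqr_powR_split alpha (ltW W0)).
have -> : (72 + 6 * G) * (w * W `^ (2 - alpha)) * (r ^+ j) ^+ 2 =
  (24 + 2 * G) * w * (3 * W `^ (2 - alpha) * (r ^+ j) ^+ 2) by ring.
rewrite ler_wpM2l // mulr_ge0 ?(ltW w0) //; have := time_bound_gt0; lra.
Qed.

Lemma source_step j : (j < n)%N -> pi_ j <= 2 * w -> time_invariant j ->
  pi_ j.+1 <= pi_ j + w * ((1 - r) * r ^+ j).
Proof.
move=> jn pij inv; rewrite piS // lerD2l.
have tl := time_le jn pij inv; have eg := error_geometric jn pij inv.
have Bj := Bp jn; have b0 : 0 < B j `^ alpha by rewrite powR_gt0.
have KE0 : 0 <= K * E j by rewrite mulr_ge0.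
have a1 : (7 * (K * E j) * B j) `^ alpha <= 49 * (K * E j) * B j `^ alpha.
  rewrite powRM ?(ltW Bj) ?mulr_ge0 // ler_wpM2r ?powR_ge0 //.
  rewrite powRM //; apply: ler_pM; rewrite ?powR_ge0 //.
    apply: (@le_trans _ _ (7 `^ 2%:R)); last by rewrite powR_mulrn //; lra.
    by rewrite ler_powR ?(ltW al2) //; lra.
  have [->|KN0] := eqVneq (K * E j) 0; first by rewrite powR0 // gt_eqF.
  by rewrite ge1r_powR // KE // lt0r KN0 KE0.
have a2 : t j * B j `^ alpha <= G * w.
  by rewrite (le_trans _ tl) // ler_wpM2r ?(ltW b0) // sS // lerDr time_ge0 // ltnW.
have a3 : K * E j <= K * (H * W * r ^+ j) by rewrite ler_wpM2l.
have HG : 0 < 294 * H * G by rewrite mulr_gt0 ?time_bound_gt0 // mulr_gt0.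
have sm : K * W * (294 * H * G) <= 1 - r by rewrite -ler_pdivlMr.
have a4 : t j * (7 * (K * E j) * B j) `^ alpha <= t j * (49 * (K * E j) * B j `^ alpha).
  by rewrite ler_wpM2l // t0.
have a5 : K * E j * (t j * B j `^ alpha) <= K * (H * W * r ^+ j) * (G * w).
  by apply: ler_pM => //; rewrite mulr_ge0 ?t0 // ltW.
have a6 : K * W * (294 * H * G) * (r ^+ j * w) <= (1 - r) * (r ^+ j * w).
  by rewrite ler_wpM2r // mulr_ge0 ?(ltW w0) // exprn_ge0 // ltW.
move: a4 a5 a6; move: (B j `^ alpha) (_ `^ alpha) => b f a4 a5 a6; lra.
Qed.

(** As long as [pi_] is at most [2 W^alpha], its increments are bounded by those
    of the geometric series [W^alpha (1 - r^j)], which never exceeds [W^alpha]. *)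
Theorem rate_recursion : pi_ n <= 2 * w /\ s n * delta `^ alpha <= G * w.
Proof.
have inv j : (j <= n)%N -> pi_ j <= w + w * (1 - r ^+ j) /\ time_invariant j.
  elim: j => [|j IH] jn.
    split; first by rewrite pi0 expr0 subrr mulr0 addr0.
    move=> _; rewrite s0 mul0r; apply: mulr_ge0; last exact: expR_ge0.
    by apply: mulr_ge0; [exact: (ltW C'0) | exact: ltW].
  have [pij inv] := IH (ltnW jn).
  have rj : 0 <= r ^+ j by rewrite exprn_ge0 // ltW.
  have pi2 : pi_ j <= 2 * w.
    by rewrite (le_trans pij) //; have := mulr_ge0 (ltW w0) rj; lra.
  split; last exact: time_invariant_step.
  rewrite (le_trans (source_step jn pi2 inv)) // exprS.
  by move: (r ^+ j) pij => z pij; lra.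
have le2 j : (j <= n)%N -> pi_ j <= 2 * w.
  move=> /inv [pij _]; rewrite (le_trans pij) //.
  have rj : 0 <= r ^+ j by rewrite exprn_ge0 // ltW.
  by have := mulr_ge0 (ltW w0) rj; lra.
split; first exact: le2.
case nE : n => [|k]; first by rewrite s0 mul0r mulr_ge0 ?(ltW w0) ?(ltW time_bound_gt0).
have kn : (k < n)%N by rewrite nE.
have [_ ik] := inv k (ltnW kn).
rewrite (le_trans _ (time_le kn (le2 k (ltnW kn)) ik)) // ler_wpM2l ?time_ge0 //.
by rewrite ge0_ler_powR ?nnegrE ?(ltW al0) ?(ltW delta0) ?(ltW (Bp kn)) // Bd.
Qed.

End RateRecursion.

(** * Convergence rate *)

Section Rate.
Context {R : realType} {X Y : hilbertType R}.
Variables (m : inner_scheme) (tau eta : R).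
Hypothesis htau : 2 < tau.
Hypothesis heta0 : 0 < eta.
Hypothesis heta1 : eta < 1.
Hypothesis htaueta : 2 < tau * eta.
Local Notation eps := (newton_eps tau eta).
Local Notation q := (newton_q eta).
Local Notation rate := (energy_rate eta (newton_theta tau eta)).
Variables (Theta : R) (D : set X) (F : X -> Y) (F' : X -> {linear X -> Y}).
Variables (xd : X) (y : Y) (rho K0 : R).
Hypothesis setting : newton_setting Theta D F F' xd y rho K0.
Variable mu : R.
Hypothesis mu0 : 0 < mu.
Hypothesis mu2 : mu <= 1 / 2.
Local Notation alpha := (rate_exponent mu).
Local Notation T := (F' xd).

Definition newton_smallness : R := source_smallness alpha q rate.
Definition newton_rate_const : R :=
  Num.sqrt (2 * (4 * (2 * tau + 4) + time_bound q rate)).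

Variables x0 omega : X.
Hypothesis bx0 : ball_le xd rho x0.
Hypothesis Kx0 : K0 * `|x0 - xd| <= eps.
Hypothesis source : x0 - xd = power T mu omega.
Hypothesis small : K0 * `|omega| <= newton_smallness.
Variables (delta : R) (yd : Y).
Hypothesis delta0 : 0 < delta.
Hypothesis noise : `|yd - y| <= delta.
Variable n : nat.
Hypothesis stopped : discrepancy_stop m tau eta F F' x0 delta yd n.
Local Notation it := (newton_iterate m eta F F' x0 yd).
Local Notation res k := (`|yd - F (it k)|).
Local Notation err k := (`|it k - xd|).
Local Notation stop k := (inner_stop m eta F F' yd (it k)).
Local Notation nu := (yd - y).
Local Notation w := (`|omega| `^ alpha).

Let active k : (k < n)%N -> tau * delta < res k.
Proof. by case: stopped => _; apply. Qed.

Let Tc : forall h, `|T h| <= `|h|.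
Proof. exact: (derivative_contraction setting (ball_center setting)). Qed.

Let mu01 : 0 <= mu <= 1.
Proof. by have := mu0; have := mu2; move=> *; apply/andP; split; lra. Qed.

Let al := rate_exponent_itv mu0 mu2.

Definition elapsed_time k : R := \sum_(i < k) stop i.
Definition source_bound k : R :=
  w + \sum_(i < k) 6 * stop i * (7 * (K0 * err i) * res i) `^ alpha.

Lemma residual_dominates k : (k < n)%N -> delta <= 1 / 2 * res k.
Proof. by move=> kn; exact: (delta_le_half htau heta1 htaueta (active kn)). Qed.

Lemma error_image_le k : (k <= n)%N -> `|T (it k - xd)| <= 4 / 3 * (res k + delta).
Proof.
move=> kn; have [bk Kk] := iterates_in_ball htau heta0 heta1 htaueta setting bx0 Kx0
  delta0 noise active kn.
have [_ e1 _] := error_image_bound htau heta1 htaueta setting bk Kk.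
rewrite (le_trans e1) // ler_wpM2l //; exact: defect_bound.
Qed.

(** The error is the sum of the image under [A^mu] of a vector whose growth is
    controlled by the nonlinearity alone, and of a part due to the noise. *)
Lemma error_decomposition k : (k <= n)%N -> exists p N : X,
  [/\ it k - xd = power T mu p + N, `|p| `^ alpha <= source_bound k,
      `|nu - T N| <= delta & `|N| ^+ 2 <= elapsed_time k * delta ^+ 2].
Proof.
elim: k => [|k IH] kn.
  exists omega, 0; split.
  - by rewrite addr0.
  - by rewrite /source_bound big_ord0 addr0.
  - by rewrite linear0 subr0.
  - by rewrite /elapsed_time big_ord0 mul0r normr0 expr0n.
have [p [N [eE ple TN Nle]]] := IH (ltnW kn).
have [bk Kk] := iterates_in_ball htau heta0 heta1 htaueta setting bx0 Kx0
  delta0 noise active (ltnW kn).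
have [_ t0 _ _ _] := active_step htau heta0 heta1 htaueta setting bx0 Kx0
  delta0 noise active kn.
have [_ e1 _ _] := newton_eps_bounds htau heta1 htaueta.
have K00 := setting_K0 setting; have bd := ball_center setting.
pose kappa := K0 * err k.
have kappa0 : 0 <= kappa by rewrite mulr_ge0.
have kappa2 : kappa <= 1 / 2 by rewrite /kappa; lra.
have close h : `|F' (it k) h - T h| <= kappa * `|T h|.
  exact: (setting_lipschitz setting bk bd).
pose v := - (F (it k) - y - T (it k - xd)).
have bE : yd - F (it k) = nu - T (it k - xd) + v by rewrite /v; vector_ring.
have vle : `|v| <= 2 * kappa * res k.
  have := linearization_error setting bk bd; rewrite (setting_Fxd setting) => l1.
  have -> : 2 * kappa * res k = kappa * (2 * res k) by ring.
  rewrite /v normrN (le_trans l1) // -/kappa ler_wpM2l //.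
  have := error_image_le (ltnW kn); have := residual_dominates kn; lra.
have [[p' p'E p'le] n1 n2] := scheme_time_step m Tc (derivative_contraction setting bk)
  mu0 mu2 kappa0 kappa2 close bE vle eE t0.
exists p', (noise_part T nu N (scheme_fun m (stop k))); split.
- by rewrite -p'E /= addrAC.
- rewrite /source_bound big_ord_recr /= addrA (le_trans p'le) // lerD //.
  by rewrite /kappa; have -> : 2 * (K0 * err k) * res k + 5 * (K0 * err k) * res k =
     7 * (K0 * err k) * res k by ring.
- exact: le_trans n1 TN.
- rewrite (le_trans n2) // /elapsed_time big_ord_recr /= mulrDl lerD //.
  by rewrite ler_wpM2l ?(ltW t0) // lerXn2r ?nnegrE // ltW.
Qed.

Lemma noise_image_le (N : X) : `|nu - T N| <= delta -> `|T N| <= 2 * delta.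
Proof.
move=> TN; rewrite -[T N](subKr nu) (le_trans (ler_normB _ _)) //.
by have := noise; lra.
Qed.

(** Interpolation for the source part; its image under [T] is the image of the
    error up to that of the noise part, which is at most [2 delta]. *)
Lemma error_sqr_bound k (Q Z s : R) : (k <= n)%N -> 0 < Q -> 0 < Z ->
  source_bound k <= Q -> `|T (it k - xd)| + 2 * delta <= Z ->
  elapsed_time k * delta ^+ 2 <= s ->
  err k ^+ 2 <= 4 * (Q * Z `^ (2 - alpha)) + 2 * s.
Proof.
move=> kn Q0 Z0 hQ hZ hs; have [al1 al2] := al.
have [p [N [eE ple TN Nle]]] := error_decomposition kn.
have alN0 : alpha != 0 by rewrite gt_eqF // (lt_le_trans ltr01).
have pQ : `|p| <= Q `^ alpha^-1.
  have -> : `|p| = (`|p| `^ alpha) `^ alpha^-1 by rewrite -powRrM mulfV // powRr1.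
  rewrite ge0_ler_powR ?nnegrE ?powR_ge0 ?invr_ge0 ?(le_trans ple) ?(ltW Q0) //.
  by rewrite (le_trans _ al1).
have TZ : `|T (power T mu p)| <= Z.
  have -> : power T mu p = (it k - xd) - N by rewrite eE addrK.
  rewrite linearB (le_trans (ler_normB _ _)) // (le_trans _ hZ) // lerD2l.
  exact: noise_image_le.
have Qp : 0 < Q `^ alpha^-1 by rewrite powR_gt0.
have := power_norm_interpolation Tc mu0 mu2 Qp Z0 pQ TZ.
have -> : (Q `^ alpha^-1) `^ alpha = Q by rewrite -powRrM mulVf // powRr1 // ltW.
move=> i1; rewrite eE.
have : `|power T mu p + N| ^+ 2 <= 2 * `|power T mu p| ^+ 2 + 2 * `|N| ^+ 2.
  have := sqr_ge0 `|power T mu p - N|; rewrite sqnormB sqnormD; lra.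
lra.
Qed.

Lemma start_residual_le : (0 < n)%N -> res 0 <= 3 * `|omega|.
Proof.
move=> n0; have [_ _ e1] := error_image_bound htau heta1 htaueta setting bx0 Kx0.
have a1 := residual_bound F noise x0; have a2 := residual_dominates n0.
have a3 : `|T (x0 - xd)| <= `|omega|.
  by rewrite (le_trans (Tc _)) // source power_norm.
rewrite /= in a2 *; have := normr_ge0 omega; lra.
Qed.

(** At the stopping index [|T e|] is at most [4/3 (tau + 1) delta], so that the
    interpolation bound is of the order [|omega|^alpha delta^(2 - alpha)]; the
    noise part is of the same order by the bound on the elapsed time. *)
Lemma newton_rate : `|it n - xd| <= newton_rate_const *
  `|omega| `^ (1 / (1 + 2 * mu)) * delta `^ (2 * mu / (1 + 2 * mu)).
Proof.
have [al1 al2] := al; have [q0 q1] := newton_q_bounds heta0 heta1.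
have [th0 th1] := newton_theta_bounds htau heta0 htaueta.
have c0 : 0 < rate by exact: energy_rate_gt0.
have [e0 e1 _ _] := newton_eps_bounds htau heta1 htaueta.
have K00 := setting_K0 setting.
have [om0|omN0] := eqVneq omega 0.
  have x0E : x0 = xd.
    apply/eqP; rewrite -subr_eq0 source om0; apply/eqP.
    exact: linf0 (power_linear Tc mu01).
  have n0 : n = 0%N.
    have [//|np] := posnP n; exfalso; have := start_residual_le np; rewrite om0 normr0 mulr0.
    have := active np; have : 0 < tau * delta.
      by rewrite mulr_gt0 //; have := htau; lra.
    lra.
  by rewrite n0 /= x0E subrr normr0 !mulr_ge0 ?powR_ge0 // sqrtr_ge0.
have W0 : 0 < `|omega| by rewrite normr_gt0.
have w0 : 0 < w by rewrite powR_gt0.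
have step k (kn : (k < n)%N) := active_step htau heta0 heta1 htaueta setting bx0 Kx0
  delta0 noise active kn.
have [pin sn] : source_bound n <= 2 * w /\
    elapsed_time n * delta `^ alpha <= time_bound q rate * w.
  apply: (@rate_recursion _ alpha q rate al1 al2 q0 q1 c0 n (fun k => res k)
    (fun k => err k) elapsed_time (fun k => stop k) source_bound delta `|omega| K0) => //.
  - by rewrite /elapsed_time big_ord0.
  - by move=> j jn; rewrite /elapsed_time big_ord_recr.
  - by move=> j /step [_ t0 _ _ _]; exact: ltW.
  - by move=> j jn; have := residual_dominates jn; have := normr_ge0 (yd - F (it j)); lra.
  - by move=> j jn; have [_ _ _ _] := step j (ltnW jn).
  - exact: start_residual_le.
  - move=> j jn; have [_ Kj] := iterates_in_ball htau heta0 heta1 htaueta setting bx0 Kx0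
      delta0 noise active (ltnW jn).
    by lra.
  - move=> j /step [_ _ _ en _]; rewrite mulrA (le_trans _ en) // lerDr sqr_ge0 //.
  - move=> j jn pij.
    have rj : 0 < res j by exact: (residual_gt0 htau delta0 (active jn)).
    have hd := residual_dominates jn; have hT := error_image_le (ltnW jn).
    have w2 : 0 < 2 * w by rewrite mulr_gt0.
    have Z0 : 0 < 3 * res j by rewrite mulr_gt0.
    have hZ : `|T (it j - xd)| + 2 * delta <= 3 * res j by lra.
    apply: (le_trans (error_sqr_bound (ltnW jn) w2 Z0 pij hZ (lexx _))).
    rewrite -[2 * elapsed_time j * _]mulrA lerD2r powRM //.
    have h3 : 3 `^ (2 - alpha) <= 3 :> R by rewrite ler1_powR //; lra.
    have : 3 `^ (2 - alpha) * res j `^ (2 - alpha) <= 3 * res j `^ (2 - alpha).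
      by rewrite ler_wpM2r ?powR_ge0.
    move=> /(ler_wpM2l (ltW w2)); lra.
  - by rewrite /source_bound big_ord0 addr0.
  - by move=> j jn; rewrite /source_bound big_ord_recr addrA.
have [stop_le _] := stopped.
have hT := error_image_le (leqnn n).
have t4 : 0 < 2 * tau + 4 by have := htau; lra.
have Z0 : 0 < (2 * tau + 4) * delta by rewrite mulr_gt0.
have w2 : 0 < 2 * w by rewrite mulr_gt0.
have hZ : `|T (it n - xd)| + 2 * delta <= (2 * tau + 4) * delta.
  by have : 0 < tau * delta; [rewrite mulr_gt0 //; have := htau | ]; lra.
have v0 : 0 <= delta `^ (2 - alpha) by rewrite powR_ge0.
have hs : elapsed_time n * delta ^+ 2 <= time_bound q rate * w * delta `^ (2 - alpha).
  by rewrite (sqr_powR_split alpha (ltW delta0)) mulrA ler_wpM2r.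
have := error_sqr_bound (leqnn n) w2 Z0 pin hZ hs.
rewrite powRM ?(ltW t4) ?(ltW delta0) // => E2.
have h4 : (2 * tau + 4) `^ (2 - alpha) <= 2 * tau + 4.
  by rewrite ler1_powR //; have := htau; lra.
have G0 := time_bound_gt0 q1 c0.
have aE : 1 / (1 + 2 * mu) = alpha / 2.
  by rewrite /rate_exponent; field; rewrite gt_eqF //; have := mu0; lra.
have bE : 2 * mu / (1 + 2 * mu) = (2 - alpha) / 2.
  by rewrite /rate_exponent; field; rewrite gt_eqF //; have := mu0; lra.
apply: le_of_sqr; first by rewrite !mulr_ge0 ?powR_ge0 ?sqrtr_ge0.
rewrite !exprMn sqr_sqrtr; last first.
  by rewrite mulr_ge0 // addr_ge0 ?(ltW G0) // mulr_ge0 // ltW.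
have half (z a : R) : 0 <= z -> (z `^ (a / 2)) ^+ 2 = z `^ a.
  by move=> z0; rewrite -powR_mulrn ?powR_ge0 // -powRrM divfK.
rewrite aE bE half // half ?(ltW delta0) // (le_trans E2) //.
have : (2 * tau + 4) `^ (2 - alpha) * (w * delta `^ (2 - alpha)) <=
   (2 * tau + 4) * (w * delta `^ (2 - alpha)).
  by rewrite ler_wpM2r // mulr_ge0 // ltW.
move: (_ `^ (2 - alpha)) (_ `^ (2 - alpha)) => z1 z2; lra.
Qed.

End Rate.

Theorem theorem2p1 (R : realType) (m : inner_scheme) (tau eta Theta : R)
    (htau : 2 < tau) (heta0 : 0 < eta) (heta1 : eta < 1)
    (htaueta : 2 < tau * eta) :
  exists eps : R, 0 < eps /\
    (forall (X Y : hilbertType R) (D : set X) (F : X -> Y)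
        (F' : X -> {linear X -> Y}) (xd : X) (y : Y) (rho K0 : R),
      newton_setting Theta D F F' xd y rho K0 ->
      forall x0 : X, ball_le xd rho x0 -> K0 * `|x0 - xd| <= eps ->
      exists C' : R, forall (delta : R) (yd : Y),
        0 < delta -> `|yd - y| <= delta ->
        exists n : nat,
          [/\ discrepancy_stop m tau eta F F' x0 delta yd n,
              newton_well_defined m eta D F F' x0 yd n &
              n%:R <= C' * (1 + `|ln delta|)]) /\
    (forall mu : R, 0 < mu -> mu <= 1 / 2 ->
      exists eps' : R, 0 < eps' /\
        forall (X Y : hilbertType R) (D : set X) (F : X -> Y)
          (F' : X -> {linear X -> Y}) (xd : X) (y : Y) (rho K0 : R),
        newton_setting Theta D F F' xd y rho K0 ->
        exists C : R, 0 < C /\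
          forall x0 omega : X, ball_le xd rho x0 -> K0 * `|x0 - xd| <= eps ->
          orthocomplement (null_space (F' xd)) omega ->
          x0 - xd = fun_calculus (adjoint (F' xd) \o F' xd)
                      (fun l => l `^ mu) omega ->
          K0 * `|omega| <= eps' ->
          forall (delta : R) (yd : Y), 0 < delta -> `|yd - y| <= delta ->
          forall n : nat, discrepancy_stop m tau eta F F' x0 delta yd n ->
            `|newton_iterate m eta F F' x0 yd n - xd|
              <= C * `|omega| `^ (1 / (1 + 2 * mu))
                   * delta `^ (2 * mu / (1 + 2 * mu))).
Proof.
have [e0 _ _ _] := newton_eps_bounds htau heta1 htaueta.
have [q0 q1] := newton_q_bounds heta0 heta1.
have [th0 th1] := newton_theta_bounds htau heta0 htaueta.
have c0 : 0 < energy_rate eta (newton_theta tau eta) by exact: energy_rate_gt0.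
exists (newton_eps tau eta); split=> //; split.
  move=> X Y D F F' xd y rho K0 setting x0 bx0 Kx0.
  exact: (discrepancy_stop_exists m htau heta0 heta1 htaueta setting bx0 Kx0).
move=> mu mu0 mu2; have [al1 al2] := rate_exponent_itv mu0 mu2.
exists (newton_smallness tau eta mu); split.
  exact: source_smallness_gt0.
move=> X Y D F F' xd y rho K0 setting; exists (newton_rate_const tau eta); split.
  have G0 := time_bound_gt0 q1 c0; rewrite sqrtr_gt0 mulr_gt0 // addr_gt0 //.
  by rewrite mulr_gt0 // addr_gt0 // mulr_gt0 //; lra.
move=> x0 omega bx0 Kx0 _ source small delta yd delta0 noise n stopped.
exact: (newton_rate htau heta0 heta1 htaueta setting mu0 mu2 bx0 Kx0 source small
  delta0 noise stopped).
Qed.
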